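(* Consider the one-factor equicorrelated model with block noise described in the context, fix $w\in\mathbb R$, and for $t\in(0,1)$ let $G(t)=(1-\pi_1)\gamma_0(t)+\pi_1\gamma_1(t)$, where $$\gamma_r(t)=\bar\Phi\Big(\frac{\bar\Phi^{-1}(t)-\mu_Ar-\sqrt{\rho_1}\,w}{\sqrt{1-\rho_1}}\Big),\quad r\in\{0,1\}.$$ Let $\tau_*=\sup\{t\in(0,1):G(t)\ge t/q\}$ (with $\sup\emptyset=0$). Suppose $w$ is such that $\tau_*>0$, $\tau_*=\sup\{t\in(0,1):G(t)>t/q\}$, and $\tau_*$ is not an accumulation point of $\{t\in(0,1):G(t)=t/q\}$. Then, with $\pi_0=1-\pi_1$, conditionally on $W=w$, $$\sqrt m\Big(\mathrm{FDP}_m-\frac{q\pi_0\gamma_0(\tau_* )}{\tau_*}\Big)\xrightarrow{d}\mathcal N(0,\sigma_{L,2}^2)\quad\text{as }m\to\infty,$$ where $$\sigma_{L,2}^2=\frac{q^2}{\tau_*^2}\Big((1+\alpha)^2c^{(0,0)}(\tau_*,\tau_* )+\alpha^2c^{(1,1)}(\tau_*,\tau_* )+2\alpha(1+\alpha)c^{(1,0)}(\tau_*,\tau_* )\Big),\qquad\alpha=\frac{\pi_0\gamma_0'(\tau_* )-\pi_0\gamma_0(\tau_* )/\tau_*}{1/q-G'(\tau_* )},$$ and, for $r\in\{0,1\}$, $$c^{(r,r)}(\tau_*,\tau_* )=\pi_r\gamma_r(\tau_* )-\pi_r^2\gamma_r(\tau_* )\gamma_r(\tau_* )+\pi_r^2(s_B-1)\tilde\rho(\gamma_r(\tau_*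 ),\gamma_r(\tau_* ),\rho_2),$$ $$c^{(1,0)}(\tau_*,\tau_* )=-\pi_0\pi_1\gamma_0(\tau_* )\gamma_1(\tau_* )+\pi_0\pi_1(s_B-1)\tilde\rho(\gamma_0(\tau_* ),\gamma_1(\tau_* ),\rho_2).$$
   Context: Notation: $\Phi$ is the standard normal CDF, $\bar\Phi=1-\Phi$. Fix $q\in(0,1)$, $\mu_A>0$, $\pi_1\in(0,1)$, $\rho_1\in[0,1)$, a block size $s_B\in\mathbb N$ and a within-block correlation $\rho_2$. Model. For each $m\ge1$: $H_{m1},\dots,H_{mm}$ are i.i.d. Bernoulli$(\pi_1)$ ($H_{mi}=1$ iff hypothesis $i$ is nonnull); $W\sim\mathcal N(0,1)$ is a single latent variable not depending on $m$; $(\tilde\varepsilon_{m1},\dots,\tilde\varepsilon_{mm})\sim\mathcal N(0,\Gamma^{(m)})$, where $\Gamma^{(m)}$ is a block diagonal correlation matrix with blocks of $s_B$ consecutive indices, all of equal size $s_B$ except possibly the last one if $s_B$ does not divide $m$, with off-diagonal within-block correlations $\rho_2$ and zero correlation between blocks. The $H$'s, the $\tilde\varepsilon$'s and $W$ are independent of each other. The test statistics are $X_{mi}=\mu_AH_{mi}+\sqrt{\rho_1}\,W+\sqrt{1-\rho_1}\,\tilde\varepsilon_{mi}$ and the $p$-values are $P_{mi}=\bar\Phi(X_{mi})$. Benjamini-Hochberg at level $q$: with sorted $p$-values $P_{m(1)}\le\dots\le P_{m(m)}$ and $P_{m(0)}=0$, let $R_m=\max\{j\in\{0,\dots,m\}:P_{m(j)}\le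 jq/m\}$, $\tau_{\mathrm{BH},m}=P_{m(R_m)}$, $V_m=\sum_{i=1}^mI\{P_{mi}\le\tau_{\mathrm{BH},m},H_{mi}=0\}$, $\mathrm{FDP}_m=V_m/\max\{R_m,1\}$. For $t,s\in[0,1]$ and $|\rho|\le1$, $\tilde\rho(t,s,\rho)=\Pr(Z_1\ge\bar\Phi^{-1}(t),Z_2\ge\bar\Phi^{-1}(s))-ts$, where $(Z_1,Z_2)$ is centered bivariate normal with unit variances and correlation $\rho$.
   Formalization: The formal theorem additionally assumes that the denominator 1/q − G'(τ_* ) of α is nonzero; the stated conditions on τ_* allow a third-order tangency with G'(τ_* ) = 1/q, where α and hence σ²_{L,2} are undefined. *)

(* Defs.v *)
From HB Require Import structures.
From mathcomp Require Import all_boot all_order all_algebra.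
From mathcomp Require Import all_classical all_reals all_analysis.

Set Implicit Arguments.
Unset Strict Implicit.
Unset Printing Implicit Defensive.

Import Order.TTheory GRing.Theory Num.Theory.
Import numFieldNormedType.Exports.

Local Open Scope classical_set_scope.
Local Open Scope ring_scope.

Section normal_laws.
Context {R : realType}.

Definition Phi (x : R) : R := fine (normal_prob (0 : R) (1 : R) `]-oo, x]).

Definition Phibar (x : R) : R := 1 - Phi x.

(* Extended-real valued, so that Phibar^-1(0) = +oo and Phibar^-1(1) = -oo. *)
Definition Phibar_inv (t : R) : \bar R :=
  if t <= 0 then +oo%E
  else if 1 <= t then -oo%E
  else (xget 0 [set x | Phibar x = t])%:E.

(* N(0, v), parametrized by the variance.  The degenerate case is separate
   because [normal_prob m 0] is not the Dirac mass at [m]. *)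
Definition normal_law (v : R) (A : set R) : \bar R :=
  if v == 0 then \d_(0 : R) A else normal_prob 0 (Num.sqrt v) A.

(* Pr(Z1 >= Phibar^-1(t), Z2 >= Phibar^-1(s)) - t s, where the bivariate normal
   pair is realized as Z1 = U, Z2 = rho U + sqrt(1 - rho^2) V with U, V
   independent standard normal; this covers rho = 1 and rho = -1. *)
Definition rho_tilde (t s rho : R) : R :=
  fine ((normal_prob (0 : R) (1 : R) \x normal_prob (0 : R) (1 : R))%E
    [set z : R * R | (Phibar_inv t <= z.1%:E)%E /\
       (Phibar_inv s <= (rho * z.1 + Num.sqrt (1 - rho ^+ 2) * z.2)%:E)%E])
  - t * s.

Definition cvg_in_law (mu_ : nat -> set R -> \bar R) (mu : set R -> \bar R) :=
  forall x : R, mu [set x] = 0%E ->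
    mu_ n [set` `]-oo, x]] @[n --> \oo] --> mu [set` `]-oo, x]].

End normal_laws.

Section benjamini_hochberg.
Context {R : realType} (q : R) (m : nat).
Implicit Types (p : 'I_m -> R) (H : 'I_m -> bool).

(* p_(j) for 1 <= j <= m, with the convention p_(0) = 0 *)
Definition order_stat p (j : nat) : R :=
  nth 0 (0 :: sort <=%R [seq p i | i <- enum 'I_m]) j.

Definition BH_R p : nat :=
  \max_(j < m.+1 | order_stat p j <= j%:R * q / m%:R) j.

Definition BH_tau p : R := order_stat p (BH_R p).

Definition BH_V p H : nat := #|[pred i | (p i <= BH_tau p) && ~~ H i]|.

Definition FDP p H : R := (BH_V p H)%:R / (maxn (BH_R p) 1)%:R.

End benjamini_hochberg.

Section random_vectors.
Context d (T : measurableType d) (R : realType) (P : probability T R).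

(* Since [A i] may be the whole space, the product rule over all indices gives
   it over every subfamily. *)
Definition mutually_independent (I : finType) d' (T' : measurableType d')
    (X : I -> {RV P >-> T'}) :=
  forall A : I -> set T', (forall i, measurable (A i)) ->
    P [set x | forall i, A i (X i x)] = (\prod_(i : I) P (X i @^-1` A i))%E.

(* X ~ N(0, Sigma), Sigma possibly singular: every linear combination of the
   coordinates is N(0, a Sigma a^T). *)
Definition is_gaussian_vector (m : nat) (X : 'I_m -> {RV P >-> R})
    (Sigma : 'M[R]_m) :=
  forall (a : 'rV[R]_m) (B : set R), measurable B ->
    P [set x | B (\sum_(i < m) a ord0 i * X i x)] =
    normal_law ((a *m Sigma *m a^T) ord0 ord0) B.

End random_vectors.

Definition block_corr {R : realType} (sB : nat) (rho2 : R) (m : nat) : 'M[R]_m :=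
  \matrix_(i, j) (if i == j then 1
                  else if (i %/ sB == j %/ sB)%N then rho2 else 0).

Section model.
Context d (T : measurableType d) (R : realType) (P : probability T R).
Variables (H : forall m, 'I_m -> {RV P >-> bool}) (W : {RV P >-> R})
  (eps : forall m, 'I_m -> {RV P >-> R}).

(* The events below form a pi-system generating sigma(H_m., eps_m.). *)
Definition noise_event m (A : 'I_m -> set bool) (B : 'I_m -> set R) : set T :=
  [set x | (forall i, A i (H i x)) /\ (forall i, B i (eps i x))].

Record one_factor_model (pi1 : R) (sB : nat) (rho2 : R) : Prop := {
  model_H_law : forall m (i : 'I_m) (A : set bool),
    distribution P (H i) A = bernoulli_prob pi1 A ;
  model_H_indep : forall m, mutually_independent (@H m) ;
  model_W_law : forall A : set R, measurable A ->
    distribution P W A = normal_prob 0 1 A ;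
  model_eps_law : forall m,
    is_gaussian_vector (@eps m) (block_corr sB rho2 m) ;
  (* (H_m1, ..., H_mm), (eps_m1, ..., eps_mm) and W are independent *)
  model_indep : forall m (A : 'I_m -> set bool) (B : 'I_m -> set R) (C : set R),
    (forall i, measurable (A i)) -> (forall i, measurable (B i)) ->
    measurable C ->
    P (noise_event A B `&` W @^-1` C) =
    (P [set x | forall i, A i (H i x)] * P [set x | forall i, B i (eps i x)]
     * P (W @^-1` C))%E }.

(* [kappa w] is the conditional probability on T given W = w.  The
   disintegration identity determines it for almost every w only; as {W = w} is
   a null event, conditioning on an individual w requires a choice of version.
   The last two clauses select the one compatible with the independence of W
   and (H, eps): given W = w, W is w and (H_m., eps_m.) keeps its law. *)
Record conditional_given_W (kappa : R.-pker (measurableTypeR R) ~> T) : Prop := {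
  cond_disintegration : forall (E : set T) (B : set R),
    measurable E -> measurable B ->
    P (E `&` W @^-1` B) = (\int[distribution P W]_(w in B) kappa w E)%E ;
  cond_W : forall w : R, kappa w (W @^-1` [set w]) = 1%E ;
  cond_noise : forall (w : R) m (A : 'I_m -> set bool) (B : 'I_m -> set R),
    (forall i, measurable (A i)) -> (forall i, measurable (B i)) ->
    kappa w (noise_event A B) = P (noise_event A B) }.

Variables (q muA rho1 : R).

Definition Xstat m (x : T) (i : 'I_m) : R :=
  muA * (H i x)%:R + Num.sqrt rho1 * W x + Num.sqrt (1 - rho1) * eps i x.

Definition pvalue m (x : T) (i : 'I_m) : R := Phibar (Xstat x i).

Definition FDP_BH m (x : T) : R :=
  FDP q (@pvalue m x) (fun i : 'I_m => H i x).

End model.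

Section asymptotic_parameters.
Context {R : realType} (q muA pi1 rho1 : R) (sB : nat) (rho2 w : R).

(* gamma false and gamma true are gamma_0 and gamma_1; likewise for pi_. *)
Definition gamma (r : bool) (t : R) : R :=
  Phibar ((fine (Phibar_inv t) - muA * r%:R - Num.sqrt rho1 * w)
          / Num.sqrt (1 - rho1)).

Definition pi_ (r : bool) : R := if r then pi1 else 1 - pi1.

Definition G (t : R) : R := (1 - pi1) * gamma false t + pi1 * gamma true t.

(* In the library, [sup set0 = 0]. *)
Definition tau_star : R := sup [set t | 0 < t < 1 /\ t / q <= G t].

(* Division by 0 being total, [alpha] is only meaningful when the denominator is
   nonzero.  That is not automatic: G need not be concave when rho1 > 0, and the
   crossing at tau_star can then be a tangency of order 3. *)
Definition alpha : R :=
  (pi_ false * (gamma false)^`()%classic tau_star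
     - pi_ false * gamma false tau_star / tau_star)
  / (1 / q - G^`()%classic tau_star).

Definition c_same (r : bool) : R :=
  let g := gamma r tau_star in
  pi_ r * g - pi_ r ^+ 2 * g * g
  + pi_ r ^+ 2 * (sB%:R - 1) * rho_tilde g g rho2.

Definition c_cross : R :=
  let g0 := gamma false tau_star in let g1 := gamma true tau_star in
  - (pi_ false * pi_ true * g0 * g1)
  + pi_ false * pi_ true * (sB%:R - 1) * rho_tilde g0 g1 rho2.

Definition sigma2_L2 : R :=
  q ^+ 2 / tau_star ^+ 2 *
  ((1 + alpha) ^+ 2 * c_same false + alpha ^+ 2 * c_same true
   + 2 * alpha * (1 + alpha) * c_cross).

End asymptotic_parameters.

(* Main.v *)
(* Given W = w, the p-values below t are counted by N_r(t), the number of indices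
   with H_i = r whose noise exceeds a cutoff; the counts are sums over independent
   blocks, so N_r(t) - N_r(s) has variance O(m |t - s|).  The Benjamini-Hochberg
   threshold T is the last solution of N_0(T) + N_1(T) = m T / q, hence |T - tau| =
   O(1 / sqrt m) in probability, because G crosses t / q transversally at tau.
   Linearizing N_r at tau and eliminating T - tau, sqrt m (FDP - lim) differs by a
   term vanishing in probability from the normalized sum of the scores
   (q / tau) ((1 + alpha) (N_0(tau) - E N_0(tau)) + alpha (N_1(tau) - E N_1(tau))).

   The scores take finitely many values and the complete blocks are iid, so their
   central limit theorem is a computation with characteristic functions, kept real
   by using E cos(a X + b) for all a and b.  Trigonometric polynomials approximating
   the indicator of a ray pass from these expectations to distribution functions;
   the same device shows that uncorrelated jointly Gaussian vectors are independent
   and identifies the law of a pair with the one in rho_tilde. *)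

Require Import Defs.
From HB Require Import structures.
From mathcomp Require Import all_boot all_order all_algebra.
From mathcomp Require Import all_classical all_reals all_analysis.
From mathcomp Require Import measurable_realfun.
From mathcomp Require complex.
From mathcomp Require Import ring lra.

Set Implicit Arguments.
Unset Strict Implicit.
Unset Printing Implicit Defensive.

Import Order.TTheory GRing.Theory Num.Theory.
Import numFieldNormedType.Exports.

Local Open Scope classical_set_scope.
Local Open Scope ring_scope.

(** * Bounded measurable functions and their expectations *)

(** About the noise only the laws of linear combinations are given, and about the law given [W = w]
    only the probabilities of [noise_event]. So an expectation under [Q] is first written with
    finite products of one-index indicators; the Bernoulli factors split off, and a Gaussian
    expectation of step functions under [P] remains, which covariances determine. A product of two
    cosines is half a sum of cosines, so trigonometric polynomials form an algebra, and iterating a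
    polynomial inside it produces signs, hence rays.

    The obstacle is the random threshold. Beyond [tau_star] the graph of [G] stays below the
    diagonal t / q, so 1 / q - G' cannot be negative there; being nonzero it is positive, which
    gives both the crossing margin and the denominator of [alpha]. Counts have to be linearized only
    at distance O(1 / sqrt m) from [tau_star], where increments have variance O(sqrt m), negligible
    against the squared scale m.

    No relation is assumed between the arrays of different sizes; the array of size [sB], a single
    complete block, serves as the reference for all blocks. *)

Section bounded_measurable.
Context d (T : measurableType d) (R : realType).
Implicit Types f g : T -> R.

(** Such functions are integrable under every probability, so the linearity rules for [Ex] need no
    integrability conditions. *)
Definition bmf f :=
  measurable_fun [set: T] f /\ exists M, forall x, `|f x| <= M.

Lemma bmf_cst (c : R) : bmf (fun=> c).
Proof. by split; [exact: measurable_cst | exists `|c|]. Qed.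

Lemma bmfD f g : bmf f -> bmf g -> bmf (fun x => f x + g x).
Proof.
move=> [mf [M fM]] [mg [N gN]]; split; first exact: measurable_funD.
by exists (M + N) => x; rewrite (le_trans (ler_normD _ _))// lerD.
Qed.

Lemma bmfM f g : bmf f -> bmf g -> bmf (fun x => f x * g x).
Proof.
move=> [mf [M fM]] [mg [N gN]]; split; first exact: measurable_funM.
by exists (M * N) => x; rewrite normrM ler_pM.
Qed.

Lemma bmfN f : bmf f -> bmf (fun x => - f x).
Proof.
move=> bf; rewrite (_ : (fun x => - f x) = (fun x => (-1) * f x)).
  by apply: bmfM => //; exact: bmf_cst.
by apply/funext => x; rewrite mulN1r.
Qed.

Lemma bmfB f g : bmf f -> bmf g -> bmf (fun x => f x - g x).
Proof. by move=> bf bg; apply: bmfD => //; exact: bmfN. Qed.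

Lemma bmf_sum I (s : seq I) (p : pred I) (F : I -> T -> R) :
  (forall i, p i -> bmf (F i)) -> bmf (fun x => \sum_(i <- s | p i) F i x).
Proof.
move=> bF; elim: s => [|i s IH].
  by under eq_fun do rewrite big_nil; exact: bmf_cst.
case pi: (p i); last first.
  by rewrite (_ : (fun x => _) = fun x => \sum_(i <- s | p i) F i x)//;
    apply/funext => x; rewrite big_cons pi.
rewrite (_ : (fun x => _) = fun x => F i x + \sum_(i <- s | p i) F i x).
  by apply: bmfD => //; exact: bF.
by apply/funext => x; rewrite big_cons pi.
Qed.

Lemma bmf_prod I (s : seq I) (p : pred I) (F : I -> T -> R) :
  (forall i, p i -> bmf (F i)) -> bmf (fun x => \prod_(i <- s | p i) F i x).
Proof.
move=> bF; elim: s => [|i s IH].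
  by under eq_fun do rewrite big_nil; exact: bmf_cst.
case pi: (p i); last first.
  by rewrite (_ : (fun x => _) = fun x => \prod_(i <- s | p i) F i x)//;
    apply/funext => x; rewrite big_cons pi.
rewrite (_ : (fun x => _) = fun x => F i x * \prod_(i <- s | p i) F i x).
  by apply: bmfM => //; exact: bF.
by apply/funext => x; rewrite big_cons pi.
Qed.

Lemma bmfX f n : bmf f -> bmf (fun x => f x ^+ n).
Proof.
move=> bf; elim: n => [|n IH].
  by under eq_fun do rewrite expr0; exact: bmf_cst.
by under eq_fun do rewrite exprS; exact: bmfM.
Qed.

Lemma bmf_cos f : measurable_fun [set: T] f -> bmf (fun x => cos (f x)).
Proof.
move=> mf; split; last by exists 1 => x; exact: cos_max.
apply: (measurableT_comp _ mf).
by apply: continuous_measurable_fun => x; exact: continuous_cos.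
Qed.

Lemma bmf_ind (b : T -> bool) : measurable [set x | b x] ->
  bmf (fun x => (b x)%:R).
Proof.
move=> mb; split; last by exists 1 => x; case: (b x); rewrite ?normr1 ?normr0.
rewrite (_ : (fun x => (b x)%:R) = \1_[set x | b x]).
  exact: measurable_indic.
by apply/funext => x; rewrite indicE; congr (nat_of_bool _)%:R;
  apply/idP/idP => [bx|]; [exact: mem_set|exact: set_mem].
Qed.

End bounded_measurable.

Definition Ex d (T : measurableType d) (R : realType) (P : probability T R)
  (f : T -> R) : R := \int[P]_x f x.

Section expectation_bounded.
Context d (T : measurableType d) (R : realType) (P : probability T R).
Implicit Types f g : T -> R.

Lemma bmf_integrable f : bmf f -> P.-integrable [set: T] (EFin \o f).
Proof.
move=> [mf [M fM]]; apply: measurable_bounded_integrable => //.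
  by rewrite (le_lt_trans (probability_le1 _ _))// ltry.
exists M; split; first exact: num_real.
by move=> y My x _ /=; rewrite (le_trans (fM x))// ltW.
Qed.

Lemma eq_Ex f g : f =1 g -> Ex P f = Ex P g.
Proof. by move=> /funext ->. Qed.

Lemma ExD f g : bmf f -> bmf g -> Ex P (fun x => f x + g x) = Ex P f + Ex P g.
Proof. by move=> bf bg; rewrite /Ex RintegralD//; exact: bmf_integrable. Qed.

Lemma ExB f g : bmf f -> bmf g -> Ex P (fun x => f x - g x) = Ex P f - Ex P g.
Proof. by move=> bf bg; rewrite /Ex RintegralB//; exact: bmf_integrable. Qed.

Lemma ExZ c f : bmf f -> Ex P (fun x => c * f x) = c * Ex P f.
Proof. by move=> bf; rewrite /Ex RintegralZl//; exact: bmf_integrable. Qed.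

Lemma Ex_cst c : Ex P (fun=> c) = c.
Proof.
rewrite /Ex Rintegral_cst//.
rewrite -[RHS]mulr1; congr (_ * _); rewrite -[RHS]/(fine 1%E); congr fine.
exact: probability_setT.
Qed.

Lemma Ex_sum I (s : seq I) (p : pred I) (F : I -> T -> R) :
  (forall i, p i -> bmf (F i)) ->
  Ex P (fun x => \sum_(i <- s | p i) F i x) = \sum_(i <- s | p i) Ex P (F i).
Proof.
move=> bF; elim: s => [|i s IH].
  rewrite big_nil -[RHS](Ex_cst 0); apply: eq_Ex => x; exact: big_nil.
rewrite big_cons; case: ifP => pi; last first.
  by rewrite -IH; apply: eq_Ex => x; rewrite big_cons pi.
rewrite -IH -ExD//; last 2 first; [exact: bF|exact: bmf_sum|].
by apply: eq_Ex => x; rewrite big_cons pi.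
Qed.

Lemma le_Ex f g : bmf f -> bmf g -> (forall x, f x <= g x) -> Ex P f <= Ex P g.
Proof. by move=> bf bg fg; apply: le_Rintegral => //; exact: bmf_integrable. Qed.

Lemma Ex_ge0 f : (forall x, 0 <= f x) -> 0 <= Ex P f.
Proof. by move=> f0; apply: Rintegral_ge0 => x _. Qed.

Lemma Ex_ind (b : T -> bool) : measurable [set x | b x] ->
  Ex P (fun x => (b x)%:R) = fine (P [set x | b x]).
Proof.
move=> mb; rewrite /Ex /Rintegral.
rewrite (_ : (fun x => _) = fun x => (\1_[set x | b x] x)%:E).
  by rewrite integral_indic// setIT.
by apply/funext => x; rewrite indicE; congr (nat_of_bool _)%:R%:E;
  apply/idP/idP => [bx|]; [exact: mem_set|exact: set_mem].
Qed.

Lemma probability_EFin (A : set T) : measurable A -> P A = (fine (P A))%:E.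
Proof. by move=> mA; rewrite fineK// fin_num_measure. Qed.

Lemma cvg_Ex_bounded (F : nat -> T -> R) f (M : R) :
  (forall n, measurable_fun [set: T] (F n)) -> (forall n x, `|F n x| <= M) ->
  (forall x, F n x @[n --> \oo] --> f x) -> Ex P (F n) @[n --> \oo] --> Ex P f.
Proof.
move=> mF FM Ff.
have M0 : 0 <= M by rewrite (le_trans _ (FM 0%N point)).
have mf : measurable_fun [set: T] f.
  apply: (measurable_fun_cvg mF) => x _; exact: Ff.
have fM x : `|f x| <= M.
  have nf := cvg_norm (Ff x).
  rewrite -(cvg_lim _ (nf _))//; apply: limr_le; first by apply/cvg_ex; exists `|f x|; exact: nf.
  by apply: nearW => n; exact: FM.
rewrite /Ex /Rintegral; apply: fine_cvg.
rewrite fineK; last first.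
  by apply: integrable_fin_num => //; apply: bmf_integrable; split => //; exists M.
apply: (@dominated_cvg _ _ _ P setT measurableT (fun n x => (F n x)%:E)
  (fun x => (f x)%:E) (fun=> M%:E)) => //.
- by move=> n; apply/measurable_EFinP.
- by move=> x _; apply: cvg_EFin; [exact: nearW | exact: Ff].
- by apply: (@bmf_integrable (fun=> M)); exact: bmf_cst.
- by move=> n x _; rewrite lee_fin.
Qed.

Lemma norm_Ex_le f (M : R) : bmf f -> (forall x, `|f x| <= M) -> `|Ex P f| <= M.
Proof.
move=> bf fM; rewrite ler_norml -{1}(Ex_cst (- M)) -{2}(Ex_cst M).
by apply/andP; split; apply: le_Ex => //; try exact: bmf_cst;
  move=> x; have := fM x; rewrite ler_norml => /andP[].
Qed.

End expectation_bounded.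

(** * Trigonometric polynomials and uniqueness of laws *)

Section trigonometric_polynomials.
Context {R : realType}.
Implicit Types f g : R -> R.

(** The free phase [b] supplies sines and constants, and arbitrary real frequencies make the class
    closed under products. *)
Inductive trigpoly : (R -> R) -> Prop :=
| trigpoly_cos a b : trigpoly (fun x => cos (a * x + b))
| trigpoly_scale c f : trigpoly f -> trigpoly (fun x => c * f x)
| trigpoly_add f g : trigpoly f -> trigpoly g -> trigpoly (fun x => f x + g x).

Lemma mulr_cos (u v : R) : cos u * cos v = 2^-1 * (cos (u + v) + cos (u - v)).
Proof. by rewrite cosD cosB; field. Qed.

Lemma trigpoly_mul f g : trigpoly f -> trigpoly g -> trigpoly (fun x => f x * g x).
Proof.
move=> tf tg; elim: tf => [a b|c {}f _ IH|f1 f2 _ IH1 _ IH2].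
- elim: tg => [a' b'|c {}g _ IH|g1 g2 _ IH1 _ IH2].
  + rewrite (_ : (fun x => _) = (fun x => 2^-1 * (cos ((a + a') * x + (b + b'))
      + cos ((a - a') * x + (b - b'))))).
      by apply/trigpoly_scale/trigpoly_add; exact: trigpoly_cos.
    by apply/funext => x; rewrite mulr_cos; congr (_ * (cos _ + cos _)); ring.
  + rewrite (_ : (fun x => _) = fun x => c * (cos (a * x + b) * g x)).
      exact: trigpoly_scale.
    by apply/funext => x; ring.
  + rewrite (_ : (fun x => _) =
      fun x => cos (a * x + b) * g1 x + cos (a * x + b) * g2 x).
      exact: trigpoly_add.
    by apply/funext => x; ring.
- rewrite (_ : (fun x => _) = fun x => c * (f x * g x)).
    exact: trigpoly_scale.
  by apply/funext => x; ring.
- rewrite (_ : (fun x => _) = fun x => f1 x * g x + f2 x * g x).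
    exact: trigpoly_add.
  by apply/funext => x; ring.
Qed.

Lemma trigpoly_cst c : trigpoly (fun=> c).
Proof.
rewrite (_ : (fun=> c) = fun x => c * cos (0 * x + 0)).
  by apply: trigpoly_scale; exact: trigpoly_cos.
by apply/funext => x; rewrite mul0r addr0 cos0 mulr1.
Qed.

Lemma trigpoly_sin a b : trigpoly (fun x => sin (a * x + b)).
Proof.
rewrite (_ : (fun x => _) = fun x => cos (a * x + (b - pi / 2))).
  exact: trigpoly_cos.
by apply/funext => x; rewrite addrA -{1}(subrK (pi / 2) (a * x + b)) sinDpihalf.
Qed.

Lemma trigpoly_continuous f : trigpoly f -> continuous f.
Proof.
elim=> [a b|c {}f _ IH|f1 f2 _ IH1 _ IH2] x.
- apply: continuous_comp; last exact: continuous_cos.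
  apply: cvgD; last exact: cvg_cst.
  by apply: cvgM; [exact: cvg_cst|exact: cvg_id].
- by apply: cvgM; [exact: cvg_cst|exact: IH].
- by apply: cvgD; [exact: IH1|exact: IH2].
Qed.

Lemma trigpoly_bounded f : trigpoly f -> exists M, forall x, `|f x| <= M.
Proof.
elim=> [a b|c {}f _ [M fM]|f1 f2 _ [M fM] _ [N fN]].
- by exists 1 => x; exact: cos_max.
- by exists (`|c| * M) => x; rewrite normrM ler_wpM2l.
- by exists (M + N) => x; rewrite (le_trans (ler_normD _ _))// lerD.
Qed.

Lemma bmf_trigpoly d (T : measurableType d) (X : T -> R) f :
  measurable_fun [set: T] X -> trigpoly f -> bmf (f \o X).
Proof.
move=> mX tf; split.
  apply: (measurableT_comp _ mX); apply: continuous_measurable_fun => x.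
  exact: trigpoly_continuous.
by have [M fM] := trigpoly_bounded tf; exists M => x; exact: fM.
Qed.

(* Iterating this cubic drives every point of [-1, 1] to its sign. *)
Definition sgstep (y : R) : R := (3 * y - y ^+ 3) / 2.

Lemma trigpoly_iter_sgstep f k : trigpoly f ->
  trigpoly (fun x => iter k sgstep (f x)).
Proof.
move=> tf; elim: k => [//|k IH] /=.
rewrite (_ : (fun x => _) = fun x => (3 / 2) * iter k sgstep (f x) +
  (- 2^-1) * (iter k sgstep (f x) * (iter k sgstep (f x) * iter k sgstep (f x)))).
  apply: trigpoly_add; apply: trigpoly_scale => //.
  by apply: trigpoly_mul => //; exact: trigpoly_mul.
by apply/funext => x; rewrite /sgstep; field.
Qed.

Lemma sgstepN y : sgstep (- y) = - sgstep y.
Proof. by rewrite /sgstep; field. Qed.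

Lemma iter_sgstepN k y : iter k sgstep (- y) = - iter k sgstep y.
Proof. by elim: k => //= k ->; rewrite sgstepN. Qed.

Lemma iter_sgstep_itv k y : 0 <= y <= 1 -> 0 <= iter k sgstep y <= 1.
Proof.
move=> y01; elim: k => //= k; move: (iter k _ _) => z /andP[z0 z1].
rewrite /sgstep; apply/andP; split; first by nra.
(* This is twice [1 - sgstep z]. *)
suff : 0 <= (1 - z) ^+ 2 * (2 + z) by nra.
by rewrite mulr_ge0 ?sqr_ge0// addr_ge0.
Qed.

Lemma iter_sgstep_norm k y : -1 <= y <= 1 -> `|iter k sgstep y| <= 1.
Proof.
move=> /andP[yN1 y1]; have [y0|y0] := leP 0 y.
  have /(iter_sgstep_itv k)/andP[i0 i1] : 0 <= y <= 1 by rewrite y0.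
  by rewrite ger0_norm.
have /(iter_sgstep_itv k)/andP[i0 i1] : 0 <= - y <= 1 by lra.
by rewrite -normrN -iter_sgstepN ger0_norm.
Qed.

(** One step multiplies the distance to 1 by 1 - (z + z^2) / 2, which is at most 1 - h / 2 as long
    as z >= h; and z >= h persists because [sgstep] does not decrease points of [0, 1]. *)
Lemma iter_sgstep_near1 k h y : 0 < h -> h <= y -> y <= 1 ->
  1 - (1 - h / 2) ^+ k <= iter k sgstep y.
Proof.
move=> h0 hy y1.
suff [] : 1 - iter k sgstep y <= (1 - h / 2) ^+ k /\ h <= iter k sgstep y <= 1 by lra.
elim: k => [|k] /=; first by rewrite expr0; lra.
rewrite exprS; move: (iter k _ _) => z [zk /andP[hz z1]].
have e : 1 - sgstep z = (1 - z) * (1 - (z + z ^+ 2) / 2) by rewrite /sgstep; field.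
split; last first.
  rewrite /sgstep; apply/andP; split; first by nra.
  suff : 0 <= (1 - z) ^+ 2 * (2 + z) by nra.
  by rewrite mulr_ge0 ?sqr_ge0//; lra.
rewrite e mulrC ler_pM//; first by nra.
- by lra.
- by nra.
Qed.

Lemma cvg_iter_sgstep y : -1 <= y <= 1 ->
  iter k sgstep y @[k --> \oo] --> Num.sg y.
Proof.
wlog y0 : y / 0 <= y => [W|].
  move=> yN1; have [|y0] := leP 0 y; first by move/W; exact.
  have : 0 <= - y by lra.
  move=> /W h; have {}h : iter k sgstep (- y) @[k --> \oo] --> Num.sg (- y).
    by apply: h; lra.
  rewrite -(opprK (Num.sg y)) -sgrN.
  rewrite (_ : (fun k => iter k sgstep y) = fun k => - iter k sgstep (- y)).
    exact: cvgN.
  by apply/funext => k; rewrite iter_sgstepN opprK.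
move=> /andP[_ y1]; move: y0; rewrite le_eqVlt => /predU1P[<-|y0].
  rewrite sgr0 (_ : (fun k => iter k sgstep 0) = fun=> 0); first exact: cvg_cst.
  by apply/funext; elim => //= k ->; rewrite /sgstep; ring.
rewrite gtr0_sg//.
apply: (@squeeze_cvgr _ _ _ _ (fun k => 1 - (1 - y / 2) ^+ k) (fun=> 1)).
- apply: nearW => k; apply/andP; split; first exact: iter_sgstep_near1.
  by have /(iter_sgstep_itv k)/andP[] : 0 <= y <= 1 by lra.
- rewrite -[X in _ --> X]subr0; apply: cvgB; first exact: cvg_cst.
  by apply: cvg_expr; rewrite ger0_norm; lra.
- exact: cvg_cst.
Qed.

End trigonometric_polynomials.

Section step_functions.
Context {R : realType}.

(** The indicators of half-lines, bands and cells of the noise used below all have this form. *)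
Inductive stepf : (R -> R) -> Prop :=
| stepf_cst (c : R) : stepf (fun=> c)
| stepf_ray (c : R) : stepf (fun x => (x < c)%R%:R)
| stepf_scale c f : stepf f -> stepf (fun x => c * f x)
| stepf_add f g : stepf f -> stepf g -> stepf (fun x => f x + g x).

Lemma stepf_coray (z : R) : stepf (fun e : R => (z <= e)%R%:R).
Proof.
rewrite (_ : (fun e => _) = fun e => 1 + (-1) * (e < z)%R%:R).
  by apply: stepf_add; [exact: stepf_cst|apply: stepf_scale; exact: stepf_ray].
by apply/funext => e; rewrite leNgt; case: (_ < _); rewrite /= ?mulr1 ?mulr0 ?subrr ?addr0.
Qed.

Lemma measurable_ray (z : R) : measurable [set e : R | (e < z)%R].
Proof.
rewrite (_ : [set e | _] = `]-oo, z[%classic); first exact: measurable_itv.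
by apply/seteqP; split => x /=; rewrite in_itv.
Qed.

Lemma measurable_coray (z : R) : measurable [set e : R | (z <= e)%R].
Proof.
rewrite (_ : [set e | z <= e] = `[z, +oo[%classic); first exact: measurable_itv.
by apply/seteqP; split => x /=; rewrite in_itv/= andbT.
Qed.

Lemma bmf_ltr d (T : measurableType d) (X : T -> R) (c : R) :
  measurable_fun [set: T] X -> bmf (fun x => (X x < c)%R%:R : R).
Proof.
move=> mX; apply: bmf_ind.
rewrite (_ : [set x | _] = X @^-1` `]-oo, c[).
  by rewrite -[_ @^-1` _]setTI; apply: mX.
by apply/seteqP; split => x /=; rewrite in_itv.
Qed.

Lemma bmf_stepf d (T : measurableType d) (X : T -> R) f :
  measurable_fun [set: T] X -> stepf f -> bmf (f \o X).
Proof.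
move=> mX; elim=> [c|c|c {}f _ IH|f1 f2 _ IH1 _ IH2].
- exact: bmf_cst.
- exact: bmf_ltr.
- by apply: bmfM => //; exact: bmf_cst.
- exact: bmfD.
Qed.

End step_functions.

Section cosine_uniqueness.
Context d d' (T : measurableType d) (T' : measurableType d') (R : realType).
Variables (P : probability T R) (P' : probability T' R).

(** The weights [Z] and [Z'] are there for the later induction over coordinates: they hold the
    factors of the coordinates not being treated. *)
Lemma eq_Ex_trigpoly (Z X : T -> R) (Z' X' : T' -> R) f :
    bmf Z -> bmf Z' -> measurable_fun [set: T] X -> measurable_fun [set: T'] X' ->
    (forall a b, Ex P (fun x => Z x * cos (a * X x + b)) =
                 Ex P' (fun x => Z' x * cos (a * X' x + b))) ->
  trigpoly f ->
  Ex P (fun x => Z x * f (X x)) = Ex P' (fun x => Z' x * f (X' x)).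
Proof.
move=> bZ bZ' mX mX' H.
elim=> [a b|c {}f tf IH|f1 f2 tf1 IH1 tf2 IH2]; first exact: H.
- under eq_Ex do rewrite mulrCA; under [in RHS]eq_Ex do rewrite mulrCA.
  rewrite !ExZ ?IH//.
    by apply: bmfM => //; exact: (bmf_trigpoly mX').
  by apply: bmfM => //; exact: (bmf_trigpoly mX).
- under eq_Ex do rewrite mulrDr; under [in RHS]eq_Ex do rewrite mulrDr.
  rewrite !ExD ?IH1 ?IH2//;
    by apply: bmfM => //; (exact: (bmf_trigpoly mX) || exact: (bmf_trigpoly mX')).
Qed.

(** The ray is a double limit of trigonometric polynomials: for fixed n, iterating [sgstep] turns
    sin((y - c) / (n + 1)) into its sign, and letting n grow removes the periodicity. Both limits
    are bounded, so they pass under the expectation. *)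
Lemma eq_Ex_ray (Z X : T -> R) (Z' X' : T' -> R) (c : R) :
    bmf Z -> bmf Z' -> measurable_fun [set: T] X -> measurable_fun [set: T'] X' ->
    (forall a b, Ex P (fun x => Z x * cos (a * X x + b)) =
                 Ex P' (fun x => Z' x * cos (a * X' x + b))) ->
  Ex P (fun x => Z x * (X x < c)%R%:R) = Ex P' (fun x => Z' x * (X' x < c)%R%:R).
Proof.
move=> bZ bZ' mX mX' H.
pose s n y := sin (n.+1%:R^-1 * y - n.+1%:R^-1 * c) : R.
(* The polynomial (z^2 - z) / 2 is 1 at -1 and vanishes at 0 and 1, so it maps a sign to the
   indicator of being negative. *)
pose p n k y := 2^-1 * (iter k sgstep (s n y) * iter k sgstep (s n y) -
  iter k sgstep (s n y)) : R.
have s1 n y : -1 <= s n y <= 1 by rewrite sin_geN1 sin_le1.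
have tp n k : trigpoly (p n k).
  have ts : trigpoly (fun y => iter k sgstep (s n y)).
    by apply: trigpoly_iter_sgstep; exact: trigpoly_sin.
  apply: trigpoly_scale; apply: trigpoly_add; first exact: trigpoly_mul.
  rewrite (_ : (fun y => - _) = fun y => (-1) * iter k sgstep (s n y)).
    exact: trigpoly_scale.
  by apply/funext => y; rewrite mulN1r.
have p1 n k y : `|p n k y| <= 1.
  have := iter_sgstep_norm k (s1 n y); rewrite /p; move: (iter _ _ _) => z.
  rewrite !ler_norml => /andP[? ?]; apply/andP; split; nra.
have pk n y : p n k y @[k --> \oo] --> ((s n y < 0)%R%:R : R).
  have -> : ((s n y < 0)%R%:R : R) =
      2^-1 * (Num.sg (s n y) * Num.sg (s n y) - Num.sg (s n y)).
    by case: sgrP => _ /=; field.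
  apply: cvgM; first exact: cvg_cst.
  by apply: cvgB; [apply: cvgM|]; exact: cvg_iter_sgstep.
(* Once n exceeds |y - c| the argument of the sine lies in (-pi, pi), where sine has the sign of its
   argument. *)
have sn y : ((s n y < 0)%R%:R : R) @[n --> \oo] --> ((y < c)%R%:R : R).
  have [N yN] : exists N : nat, `|y - c| < N%:R.
    exists (Num.truncn `|y - c|).+1; exact: truncnS_gt.
  apply: cvg_near_cst; exists N => // n /= Nn.
  have e : s n y = sin (n.+1%:R^-1 * (y - c)) by rewrite /s mulrBr.
  have small : `|n.+1%:R^-1 * (y - c)| < pi.
    rewrite normrM ger0_norm ?invr_ge0// mulrC ltr_pdivrMr//.
    rewrite (lt_le_trans yN)// (@le_trans _ _ n.+1%:R)//.
      by rewrite ler_nat (leq_trans Nn).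
    by rewrite ler_peMl// (le_trans _ (pi_ge2 _))// ler1n.
  have n0 : 0 < n.+1%:R^-1 :> R by rewrite invr_gt0.
  congr (nat_of_bool _)%:R; rewrite e.
  have [yc|cy|->] := ltgtP y c; last by rewrite subrr mulr0 sin0 ltxx.
    rewrite -oppr_gt0 -sinN sin_gt0_pi//.
    rewrite -mulrN opprB mulr_gt0 ?subr_gt0//=.
    by move: small; rewrite -normrN -mulrN opprB ltr_norml => /andP[].
  apply/negbTE; rewrite -leNgt ltW// sin_gt0_pi//.
  rewrite mulr_gt0 ?subr_gt0//=.
  by move: small; rewrite ltr_norml => /andP[].
have cvgE d0 (T0 : measurableType d0) (P0 : probability T0 R) (Z0 X0 : T0 -> R) :
    bmf Z0 -> measurable_fun [set: T0] X0 ->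
    (forall n, Ex P0 (fun x => Z0 x * p n k (X0 x)) @[k --> \oo] -->
       Ex P0 (fun x => Z0 x * (s n (X0 x) < 0)%R%:R)) /\
    (Ex P0 (fun x => Z0 x * (s n (X0 x) < 0)%R%:R) @[n --> \oo] -->
       Ex P0 (fun x => Z0 x * (X0 x < c)%R%:R)).
  move=> [mZ0 [M ZM]] mX0; split => [n|].
    apply: (@cvg_Ex_bounded _ _ _ P0 _ _ M).
    - move=> k; apply: measurable_funM => //.
      by have [] := bmf_trigpoly mX0 (tp n k).
    - by move=> k x; rewrite normrM -[M]mulr1 ler_pM.
    - by move=> x; apply: cvgM; [exact: cvg_cst|exact: pk].
  apply: (@cvg_Ex_bounded _ _ _ P0 _ _ M).
  - move=> n; apply: measurable_funM => //.
    apply: (bmf_ltr 0 (X := s n \o X0) _).1.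
    by have [] := bmf_trigpoly mX0 (trigpoly_sin n.+1%:R^-1 (- (n.+1%:R^-1 * c))).
  - by move=> n x; rewrite normrM -[M]mulr1 ler_pM//; case: (_ < _); rewrite ?normr0 ?normr1.
  - by move=> x; apply: cvgM; [exact: cvg_cst|exact: sn].
have [h1 h2] := cvgE _ _ P Z X bZ mX.
have [h1' h2'] := cvgE _ _ P' Z' X' bZ' mX'.
suff e12 : (fun n => Ex P (fun x => Z x * (s n (X x) < 0)%R%:R)) =
    (fun n => Ex P' (fun x => Z' x * (s n (X' x) < 0)%R%:R)).
  by rewrite e12 in h2; exact: (cvg_unique _ h2 h2').
apply/funext => n; have := h1 n.
have -> : (fun k => Ex P (fun x => Z x * p n k (X x))) =
    (fun k => Ex P' (fun x => Z' x * p n k (X' x))).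
  by apply/funext => k; exact: eq_Ex_trigpoly.
by move=> h; exact: (cvg_unique _ h (h1' n)).
Qed.

Lemma eq_Ex_stepf (Z X : T -> R) (Z' X' : T' -> R) g :
    bmf Z -> bmf Z' -> measurable_fun [set: T] X -> measurable_fun [set: T'] X' ->
    (forall a b, Ex P (fun x => Z x * cos (a * X x + b)) =
                 Ex P' (fun x => Z' x * cos (a * X' x + b))) ->
  stepf g ->
  Ex P (fun x => Z x * g (X x)) = Ex P' (fun x => Z' x * g (X' x)).
Proof.
move=> bZ bZ' mX mX' H.
elim=> [c|c|c {}f tf IH|f1 f2 tf1 IH1 tf2 IH2].
- exact: (eq_Ex_trigpoly bZ bZ' mX mX' H (trigpoly_cst c)).
- exact: eq_Ex_ray.
- under eq_Ex do rewrite mulrCA; under [in RHS]eq_Ex do rewrite mulrCA.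
  rewrite !ExZ ?IH//.
    by apply: bmfM => //; exact: (bmf_stepf mX').
  by apply: bmfM => //; exact: (bmf_stepf mX).
- under eq_Ex do rewrite mulrDr; under [in RHS]eq_Ex do rewrite mulrDr.
  rewrite !ExD ?IH1 ?IH2//;
    by apply: bmfM => //; (exact: (bmf_stepf mX) || exact: (bmf_stepf mX')).
Qed.

(* A Cramer-Wold device: the coordinates are turned one at a time from the
   argument of the cosine into step-function factors of the weight. *)
Lemma eq_Ex_prod_stepf (J : eqType) (s : seq J) (X : J -> T -> R)
    (X' : J -> T' -> R) (g : J -> R -> R) (Z : T -> R) (Z' : T' -> R) :
    uniq s -> bmf Z -> bmf Z' ->
    (forall j, measurable_fun [set: T] (X j)) ->
    (forall j, measurable_fun [set: T'] (X' j)) ->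
    (forall j, stepf (g j)) ->
    (forall (a : J -> R) b,
      Ex P (fun x => Z x * cos (\sum_(j <- s) a j * X j x + b)) =
      Ex P' (fun x => Z' x * cos (\sum_(j <- s) a j * X' j x + b))) ->
  Ex P (fun x => Z x * \prod_(j <- s) g j (X j x)) =
  Ex P' (fun x => Z' x * \prod_(j <- s) g j (X' j x)).
Proof.
move=> + + + mX mX' sg; elim: s Z Z' => [|j s IH] Z Z' us bZ bZ' H.
  have := H (fun=> 0) 0.
  under eq_Ex do rewrite big_nil addr0 cos0; under [in RHS]eq_Ex do
    rewrite big_nil addr0 cos0.
  move=> h; under eq_Ex do rewrite big_nil; under [in RHS]eq_Ex do rewrite big_nil.
  exact: h.
move: us => /= /andP[js us].
under eq_Ex do rewrite big_cons mulrA; under [in RHS]eq_Ex do rewrite big_cons mulrA.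
have mS d0 (T0 : measurableType d0) (Y : J -> T0 -> R) (a : J -> R) b :
    (forall j, measurable_fun [set: T0] (Y j)) ->
    measurable_fun [set: T0] (fun x => \sum_(j <- s) a j * Y j x + b).
  move=> mY; apply: measurable_funD => //; apply: measurable_sum => i.
  by apply: measurable_funM.
apply: IH => //.
- by apply: bmfM => //; exact: (bmf_stepf (mX j)).
- by apply: bmfM => //; exact: (bmf_stepf (mX' j)).
move=> a b.
under eq_Ex do rewrite mulrAC; under [in RHS]eq_Ex do rewrite mulrAC.
apply: eq_Ex_stepf => //.
- by apply: bmfM => //; apply: bmf_cos; exact: mS.
- by apply: bmfM => //; apply: bmf_cos; exact: mS.
move=> a0 b0.
(* The product formula merges the cosine in coordinate [j] with the cosine in the others; the two
   resulting cosines have coefficients [a0] and [- a0] at [j], which does not occur in [s]. *)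
have E d0 (T0 : measurableType d0) (P0 : probability T0 R) (Z0 : T0 -> R)
    (Y : J -> T0 -> R) : bmf Z0 -> (forall j, measurable_fun [set: T0] (Y j)) ->
    Ex P0 (fun x => Z0 x * cos (\sum_(j <- s) a j * Y j x + b) *
      cos (a0 * Y j x + b0)) =
    2^-1 * (Ex P0 (fun x => Z0 x * cos (\sum_(i <- j :: s)
              (if i == j then a0 else a i) * Y i x + (b + b0)))
     + Ex P0 (fun x => Z0 x * cos (\sum_(i <- j :: s)
              (if i == j then - a0 else a i) * Y i x + (b - b0)))).
  move=> bZ0 mY.
  have sE e x : \sum_(i <- j :: s) (if i == j then e else a i) * Y i x =
      e * Y j x + \sum_(i <- s) a i * Y i x.
    rewrite big_cons eqxx; congr (_ + _); rewrite !big_seq.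
    by apply: eq_bigr => i si; rewrite ifN//; apply: contraNneq js => <-.
  have bE e c : bmf (fun x => Z0 x *
      cos (\sum_(i <- j :: s) (if i == j then e else a i) * Y i x + c)).
    apply: bmfM => //; apply: bmf_cos; under eq_fun do rewrite sE -addrA.
    by apply: measurable_funD; [apply: measurable_funM | exact: mS].
  rewrite -ExD -?ExZ.
  - by apply: eq_Ex => x; rewrite !sE -mulrA mulr_cos -mulrDr mulrCA;
      congr (_ * (_ * (cos _ + cos _))); ring.
  - by apply: bmfD.
  - by [].
  - by [].
by rewrite !E// !H.
Qed.

End cosine_uniqueness.

(** * Convergence of cosine transforms implies convergence in law *)

Section levy_continuity.
Context {R : realType}.

(** The approximation to a ray is obtained from one periodic sine, hence only on the window |y| <=
    L; tightness will pay for the outside. *)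
Lemma trigpoly_smooth_ray (x0 x1 L e : R) : x0 < x1 -> 0 < e ->
  exists f, [/\ trigpoly f, forall y, 0 <= f y <= 1,
    forall y, `|y| <= L -> y <= x0 -> 1 - e <= f y &
    forall y, `|y| <= L -> x1 <= y -> f y <= e].
Proof.
move=> x01 e0.
pose c := (x0 + x1) / 2; pose dl := (x1 - x0) / 2.
have dl0 : 0 < dl by rewrite /dl; lra.
(* Dividing by such an n puts y - c, for |y| <= L, into [-1, 1], inside the interval where sine
   increases. *)
have [n0 n0P] : exists n : nat, `|L| + `|c| + dl < n%:R.
  by exists (Num.truncn (`|L| + `|c| + dl)).+1; exact: truncnS_gt.
pose n : R := n0.+1%:R.
have nP : `|L| + `|c| + dl < n.
  by rewrite (lt_le_trans n0P)// ler_nat.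
have npos : 0 < n by rewrite ltr0n.
have pi2 : 1 <= pi / 2 :> R by have := pi_ge2 R; lra.
pose h := sin (n^-1 * dl).
have ub y : `|y| <= L -> `|n^-1 * (y - c)| <= pi / 2.
  move=> yL; rewrite normrM gtr0_norm ?invr_gt0// mulrC ler_pdivrMr//.
  have := ler_normB y c; have := ler_norm L.
  by move=> ? ?; nra.
have dlub : n^-1 * dl <= pi / 2.
  rewrite mulrC ler_pdivrMr//; have := normr_ge0 L; have := normr_ge0 c.
  by move=> ? ?; nra.
have h0 : 0 < h.
  apply: sin_gt0_pihalf; apply/andP; split; first by rewrite mulr_gt0// invr_gt0.
  rewrite mulrC ltr_pdivrMr//; have := normr_ge0 L; have := normr_ge0 c.
  by move=> ? ?; nra.
have h1 : h <= 1 by exact: sin_le1.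
(* The final function is (1 - z) / 2 with z the iterated sine, so z within 2 e of a sign is
   enough. *)
have [k kP] : exists k : nat, (1 - h / 2) ^+ k <= 2 * e.
  have : (1 - h / 2) ^+ k @[k --> \oo] --> (0 : R).
    by apply: cvg_expr; rewrite ger0_norm; lra.
  move=> /cvgrPdist_le /(_ (2 * e)); case; first by lra.
  move=> N _ /(_ N (leqnn N)) /=; rewrite sub0r normrN => H; exists N.
  by rewrite (le_trans _ H)// ler_norm.
pose s y := sin (n^-1 * y - n^-1 * c) : R.
have sE y : s y = sin (n^-1 * (y - c)) by rewrite /s mulrBr.
have s1 y : -1 <= s y <= 1 by rewrite sin_geN1 sin_le1.
have hub z : `|n^-1 * z| <= pi / 2 -> dl <= z -> h <= sin (n^-1 * z).
  rewrite ler_norml /h => /andP[z1 z2] dz.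
  have le1 : n^-1 * dl <= n^-1 * z by apply: ler_wpM2l; [rewrite invr_ge0 ltW|].
  have [->//|ne] := eqVneq (n^-1 * dl) (n^-1 * z).
  have d0 : 0 <= n^-1 * dl by rewrite mulr_ge0 ?invr_ge0// ltW.
  have i1 : n^-1 * dl \in `[- (pi / 2), pi / 2].
    by rewrite in_itv/= dlub andbT (le_trans _ d0)//; lra.
  have i2 : n^-1 * z \in `[- (pi / 2), pi / 2] by rewrite in_itv/= z1.
  by rewrite ltW// (ltr_sin i1 i2) lt_neqAle ne.
have hs y : `|y| <= L -> c + dl <= y -> h <= s y.
  by move=> yL cy; rewrite sE; apply: hub; [exact: ub|lra].
have hsN y : `|y| <= L -> y <= c - dl -> h <= - s y.
  move=> yL cy; rewrite sE -sinN -mulrN; apply: hub; last lra.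
  by rewrite mulrN normrN; exact: ub.
exists (fun y => 2^-1 + (- 2^-1) * iter k sgstep (s y)); split.
- apply: trigpoly_add; first exact: trigpoly_cst.
  by apply: trigpoly_scale; apply: trigpoly_iter_sgstep; exact: trigpoly_sin.
- move=> y; have := iter_sgstep_norm k (s1 y); rewrite ler_norml => /andP[? ?].
  by apply/andP; split; lra.
- move=> y yL yx; have /(hsN _ yL) hy : y <= c - dl by rewrite /c /dl; lra.
  have /andP[? ?] := s1 y.
  have := @iter_sgstep_near1 _ k _ _ h0 hy; rewrite iter_sgstepN; lra.
- move=> y yL yx; have /(hs _ yL) hy : c + dl <= y by rewrite /c /dl; lra.
  have /andP[? ?] := s1 y.
  have := @iter_sgstep_near1 _ k _ _ h0 hy; lra.
Qed.

Lemma le_Ex_prob d (T : measurableType d) (P : probability T R) (b : T -> bool)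
    f (e : R) (A : T -> bool) :
  measurable [set x | b x] -> measurable [set x | A x] -> bmf f ->
  (forall x, b x -> 1 - e <= f x + (A x)%:R) -> 0 <= e ->
  (forall x, 0 <= f x) ->
  fine (P [set x | b x]) <= Ex P f + e + fine (P [set x | A x]).
Proof.
move=> mb mA bf bfe e0 f0; rewrite -!Ex_ind//.
have -> : Ex P f + e + Ex P (fun x => (A x)%:R) = Ex P (fun x => f x + e + (A x)%:R).
  rewrite !ExD ?Ex_cst//; first exact: bmf_cst.
    by apply: bmfD => //; exact: bmf_cst.
  exact: bmf_ind.
apply: le_Ex; first exact: bmf_ind.
  by apply: bmfD; [apply: bmfD => //; exact: bmf_cst|exact: bmf_ind].
move=> x; have := bfe x; have := f0 x; case: (b x) => /=.
  by move=> _ /(_ isT); lra.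
by move=> fx _; case: (A x) => /=; lra.
Qed.

Lemma Ex_le_prob d (T : measurableType d) (P : probability T R) (b : T -> bool)
    f (e : R) (A : T -> bool) :
  measurable [set x | b x] -> measurable [set x | A x] -> bmf f ->
  (forall x, ~~ A x -> ~~ b x -> f x <= e) -> 0 <= e ->
  (forall x, f x <= 1) ->
  Ex P f <= fine (P [set x | b x]) + e + fine (P [set x | A x]).
Proof.
move=> mb mA bf bfe e0 f1; rewrite -!Ex_ind//.
have -> : Ex P (fun x => (b x)%:R) + e + Ex P (fun x => (A x)%:R) =
    Ex P (fun x => (b x)%:R + e + (A x)%:R).
  rewrite !ExD ?Ex_cst//; try exact: bmf_cst; try exact: bmf_ind.
  by apply: bmfD; [exact: bmf_ind|exact: bmf_cst].
apply: le_Ex => //.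
  by apply: bmfD; [apply: bmfD; [exact: bmf_ind|exact: bmf_cst]|exact: bmf_ind].
move=> x; have := bfe x; have := f1 x; case: (b x); case: (A x) => //=; lra.
Qed.

Lemma measurable_ler_preimage d (T : measurableType d) (X : T -> R) (c : R) :
  measurable_fun [set: T] X -> measurable [set x | X x <= c].
Proof.
move=> mX; rewrite (_ : [set x | _] = X @^-1` `]-oo, c]).
  by rewrite -[_ @^-1` _]setTI; apply: mX.
by apply/seteqP; split => x /=; rewrite in_itv.
Qed.

Lemma measurable_gtr_preimage d (T : measurableType d) (X : T -> R) (c : R) :
  measurable_fun [set: T] X -> measurable [set x | c < X x].
Proof.
move=> mX; rewrite (_ : [set x | _] = X @^-1` `]c, +oo[).
  by rewrite -[_ @^-1` _]setTI; apply: mX.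
by apply/seteqP; split => x /=; rewrite in_itv/= andbT.
Qed.

Lemma measurable_norm_ge d (T : measurableType d) (X : T -> R) (c : R) :
  measurable_fun [set: T] X -> measurable [set x | c <= `|X x|].
Proof.
move=> mX; rewrite (_ : [set x | _] = (fun x => `|X x|) @^-1` `[c, +oo[).
  by rewrite -[_ @^-1` _]setTI; apply: measurableT_comp.
by apply/seteqP; split => x /=; rewrite in_itv/= andbT.
Qed.

Lemma trigpoly_cvg_Ex d (T : measurableType d) (P : nat -> probability T R)
    (X : nat -> T -> R) (nu : probability (measurableTypeR R) R) f :
  (forall n, measurable_fun [set: T] (X n)) ->
  (forall a b, Ex (P n) (fun x => cos (a * X n x + b)) @[n --> \oo] -->
     Ex nu (fun x => cos (a * x + b))) ->
  trigpoly f -> Ex (P n) (f \o X n) @[n --> \oo] --> Ex nu f.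
Proof.
move=> mX H; elim=> [a b|c {}f tf IH|f1 f2 tf1 IH1 tf2 IH2]; first exact: H.
- rewrite ExZ; last exact: (bmf_trigpoly (@measurable_id _ _ _) tf).
  rewrite (_ : (fun n => _) = fun n => c * Ex (P n) (f \o X n)).
    by apply: cvgM; [exact: cvg_cst|exact: IH].
  by apply/funext => n; rewrite -ExZ//; exact: bmf_trigpoly.
- rewrite ExD; [|exact: (bmf_trigpoly (@measurable_id _ _ _) tf1)
    |exact: (bmf_trigpoly (@measurable_id _ _ _) tf2)].
  rewrite (_ : (fun n => _) = fun n => Ex (P n) (f1 \o X n) + Ex (P n) (f2 \o X n)).
    by apply: cvgD; [exact: IH1|exact: IH2].
  by apply/funext => n; rewrite -ExD//; exact: bmf_trigpoly.
Qed.

Lemma probability_tail_small (nu : probability (measurableTypeR R) R) (e : R) :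
  0 < e -> exists L, fine (nu [set x | L < `|x|]) <= e.
Proof.
move=> e0.
have mA n : measurable ([set x : measurableTypeR R | n%:R < `|x|]).
  apply: (@measurable_gtr_preimage _ (measurableTypeR R) (fun x : R => `|x|)).
  exact: normr_measurable.
pose F n : set (measurableTypeR R) := [set x | n%:R < `|x|].
have F0 : (nu (F 0%N) < +oo)%E.
  by rewrite (le_lt_trans (probability_le1 _ _))// ?ltry//; exact: mA.
have mF : measurable (\bigcap_n F n).
  by apply: bigcap_measurable => // n _; exact: mA.
have nF : {homo F : n m / (n <= m)%N >-> (m <= n)%O}.
  move=> m n mn; apply/subsetPset => x /=; apply: le_lt_trans.
  by rewrite ler_nat.
have := nonincreasing_cvg_mu F0 mA mF nF; rewrite /F.
have -> : \bigcap_n [set x : R | n%:R < `|x|] = set0.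
  apply/seteqP; split => // x /= /(_ (Num.truncn `|x|).+1 I).
  by rewrite /= ltNge ltW// truncnS_gt.
rewrite measure0 => /fine_cvgP[_] /cvgrPdist_le /(_ _ e0) [N _ /(_ N (leqnn _))].
rewrite /= sub0r normrN => h; exists N%:R.
by rewrite (le_trans _ h)// ler_norm.
Qed.

(** The function [f] lies between the rays ending at [x0] and [x1], up to [e] and the tails. The two
    laws play symmetric parts, so the bound serves from above and from below in the convergence of
    distribution functions. *)
Lemma cdf_le_gap d d' (T : measurableType d) (T' : measurableType d') (P : probability T R)
    (P' : probability T' R) (X : T -> R) (X' : T' -> R) f (x0 x1 L e : R) :
  measurable_fun [set: T] X -> measurable_fun [set: T'] X' ->
  trigpoly f -> (forall y, 0 <= f y <= 1) ->
  (forall y, `|y| <= L -> y <= x0 -> 1 - e <= f y) ->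
  (forall y, `|y| <= L -> x1 <= y -> f y <= e) -> 0 <= e ->
  fine (P [set x | X x <= x0]) <= fine (P' [set x | X' x <= x1])
    + (Ex P (f \o X) - Ex P' (f \o X')) + 2 * e
    + fine (P [set x | L < `|X x|]) + fine (P' [set x | L < `|X' x|]).
Proof.
move=> mX mX' tf f01 f0 f1 e0.
have mn d0 (T0 : measurableType d0) (Y : T0 -> R) : measurable_fun [set: T0] Y ->
    measurable [set x | L < `|Y x|].
  by move=> mY; apply: (measurable_gtr_preimage _ (X := fun x => `|Y x|)); exact: measurableT_comp.
have h1 : fine (P [set x | X x <= x0]) <= Ex P (f \o X) + e + fine (P [set x | L < `|X x|]).
  apply: (@le_Ex_prob _ _ P (fun x => X x <= x0) (f \o X) e (fun x => L < `|X x|)) => //.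
  - exact: measurable_ler_preimage.
  - exact: mn.
  - exact: bmf_trigpoly.
  - move=> x Xx; have [XL|XL] := leP `|X x| L; last first.
      by have /andP[? _] := f01 (X x); rewrite /=; lra.
    by have := f0 _ XL Xx; rewrite /=; lra.
  - by move=> x; have /andP[] := f01 (X x).
have h2 : Ex P' (f \o X') <= fine (P' [set x | X' x <= x1]) + e + fine (P' [set x | L < `|X' x|]).
  apply: (@Ex_le_prob _ _ P' (fun x => X' x <= x1) (f \o X') e (fun x => L < `|X' x|)) => //.
  - exact: measurable_ler_preimage.
  - exact: mn.
  - exact: bmf_trigpoly.
  - by move=> x; rewrite -leNgt -ltNge => xL /ltW xx; exact: f1.
  - by move=> x; have /andP[] := f01 (X' x).
lra.
Qed.

(** Tightness is assumed rather than derived from the transforms: trigonometric polynomials imitate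
    a ray only on bounded windows. *)
Lemma levy_cvg_cdf d (T : measurableType d) (P : nat -> probability T R)
    (X : nat -> T -> R) (nu : probability (measurableTypeR R) R) (x0 : R) :
  (forall n, measurable_fun [set: T] (X n)) ->
  (forall a b, Ex (P n) (fun x => cos (a * X n x + b)) @[n --> \oo] -->
     Ex nu (fun x => cos (a * x + b))) ->
  (forall e : R, 0 < e -> exists L : R, \forall n \near \oo,
     fine (P n [set x | L < `|X n x|]) <= e) ->
  nu [set x0] = 0%E ->
  fine (P n [set x | X n x <= x0]) @[n --> \oo] --> fine (nu [set` `]-oo, x0]]).
Proof.
move=> mX H tight nux0.
have mnorm n : measurable_fun [set: T] (fun x => `|X n x|).
  exact: measurableT_comp.
have mid : measurable_fun [set: measurableTypeR R] (fun x : R => x).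
  exact: measurable_id.
have mnormR : measurable_fun [set: measurableTypeR R] (fun x : R => `|x|).
  exact: normr_measurable.
have tightn e : 0 < e -> exists L, fine (nu [set x | L < `|x|]) <= e /\
    \forall n \near \oo, fine (P n [set x | L < `|X n x|]) <= e.
  move=> e0; have [L1 h1] := probability_tail_small nu e0.
  have [L2 h2] := tight _ e0; exists (Num.max L1 L2); split.
    rewrite (le_trans _ h1)// fine_le ?fin_num_measure//;
      try exact: (measurable_gtr_preimage _ mnormR).
    rewrite le_measure ?inE//; try exact: (measurable_gtr_preimage _ mnormR).
    by move=> x /=; rewrite gt_max => /andP[].
  apply: filterS h2 => n; apply: le_trans.
  rewrite fine_le ?fin_num_measure//; try exact: (measurable_gtr_preimage _ (mnorm n)).
  rewrite le_measure ?inE//; try exact: (measurable_gtr_preimage _ (mnorm n)).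
  by move=> x /=; rewrite gt_max => /andP[].
have mleR (x : R) : measurable [set t : measurableTypeR R | t <= x].
  exact: (measurable_ler_preimage _ mid).
have up x1 e : x0 < x1 -> 0 < e -> \forall n \near \oo,
    fine (P n [set x | X n x <= x0]) <= fine (nu [set x | x <= x1]) + 5 * e.
  move=> x01 e0; have [L [nuL PL]] := tightn _ e0.
  have [f [tf f01 f0 f1]] := trigpoly_smooth_ray L x01 e0.
  have := trigpoly_cvg_Ex mX H tf => /cvgrPdist_le /(_ _ e0) cf.
  near=> n.
  have h := cdf_le_gap (P n) nu (mX n) mid tf f01 f0 f1 (ltW e0).
  have h3 : fine (P n [set x | L < `|X n x|]) <= e by near: n.
  have h4 : `|Ex nu f - Ex (P n) (f \o X n)| <= e by near: n.
  move: h4; rewrite ler_norml => /andP[? ?]; apply: (le_trans h); rewrite /=.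
  by move: h3 nuL; rewrite -/(f \o id); lra.
have lo x1 e : x1 < x0 -> 0 < e -> \forall n \near \oo,
    fine (nu [set x | x <= x1]) - 5 * e <= fine (P n [set x | X n x <= x0]).
  move=> x01 e0; have [L [nuL PL]] := tightn _ e0.
  have [f [tf f01 f0 f1]] := trigpoly_smooth_ray L x01 e0.
  have := trigpoly_cvg_Ex mX H tf => /cvgrPdist_le /(_ _ e0) cf.
  near=> n.
  have h := cdf_le_gap nu (P n) mid (mX n) tf f01 f0 f1 (ltW e0).
  have h3 : fine (P n [set x | L < `|X n x|]) <= e by near: n.
  have h4 : `|Ex nu f - Ex (P n) (f \o X n)| <= e by near: n.
  move: h4; rewrite ler_norml => /andP[? ?]; rewrite lerBlDr; apply: (le_trans h).
  by move: h3 nuL; rewrite -/(f \o id); lra.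
have invn (e : R) : 0 < e -> \forall n \near \oo, n.+1%:R^-1 < e.
  by move=> e0; exact: near_infty_natSinv_lt (PosNum e0).
have -> : [set` `]-oo, x0]] = [set x : R | x <= x0].
  by apply/seteqP; split => x /=; rewrite in_itv.
have right e : 0 < e -> exists2 x1, x0 < x1 &
    fine (nu [set x | x <= x1]) <= fine (nu [set x | x <= x0]) + e.
  move=> e0.
  pose F n : set (measurableTypeR R) := [set x | x <= x0 + n.+1%:R^-1].
  have F0 : (nu (F 0%N) < +oo)%E.
    by rewrite (le_lt_trans (probability_le1 _ _))// ?ltry//; exact: mleR.
  have mF : measurable (\bigcap_n F n).
    by apply: bigcap_measurable => // n _; exact: mleR.
  have nF : {homo F : n m / (n <= m)%N >-> (m <= n)%O}.
    move=> m n mn; apply/subsetPset => x /= /le_trans; apply.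
    by rewrite lerD2l lef_pV2 ?posrE// ler_nat ltnS.
  have := nonincreasing_cvg_mu F0 (fun n => mleR _) mF nF; rewrite /F.
  have -> : \bigcap_n [set x : R | x <= x0 + n.+1%:R^-1] = [set x | x <= x0].
    apply/seteqP; split => x /= h; last first.
      by move=> n _ /=; rewrite (le_trans h)// lerDl invr_ge0.
    apply/ler_addgt0Pr => t t0; have [n _ /(_ n (leqnn _)) /= nt] := invn _ t0.
    by rewrite (le_trans (h n I))// lerD2l ltW.
  rewrite [X in _ --> X]probability_EFin// => /fine_cvgP[_] /cvgrPdist_le /(_ _ e0)[N _ /(_ N (leqnn _))].
  rewrite /= distrC => h; exists (x0 + N.+1%:R^-1); first by rewrite ltrDl invr_gt0.
  have := le_trans (ler_norm _) h; lra.
(* Left continuity of the distribution function of [nu] at [x0]; this is where [x0] must not be an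
   atom. *)
have left e : 0 < e -> exists2 x1, x1 < x0 &
    fine (nu [set x | x <= x0]) - e <= fine (nu [set x | x <= x1]).
  move=> e0.
  pose F n : set (measurableTypeR R) := [set x | x <= x0 - n.+1%:R^-1].
  have mF : measurable (\bigcup_n F n).
    by apply: bigcup_measurable => n _; exact: mleR.
  have nF : nondecreasing_seq F.
    move=> m n mn; apply/subsetPset => x /= /le_trans; apply.
    by rewrite lerD2l lerN2 lef_pV2 ?posrE// ler_nat ltnS.
  have := nondecreasing_cvg_mu (mu := nu) (fun n => mleR _) mF nF; rewrite /F.
  have -> : \bigcup_n [set x : R | x <= x0 - n.+1%:R^-1] = [set x | x < x0].
    apply/seteqP; split => x /=.
      by move=> [n _ /= h]; rewrite (le_lt_trans h)// ltrBlDr ltrDl invr_gt0.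
    rewrite -subr_gt0 => /invn[n _ /(_ n (leqnn _)) /= nt]; exists n => //=; by rewrite lerBrDr -lerBrDl ltW.
  have e1 : nu [set x : R | x <= x0] = nu [set x | x < x0].
    rewrite (_ : [set x : R | x <= x0] = [set x | x < x0] `|` [set x0]).
      have mlt : measurable ([set x | x < x0] : set (measurableTypeR R)).
        rewrite (_ : [set x | x < x0] = `]-oo, x0[%classic); first exact: measurable_itv.
        by apply/seteqP; split => x /=; rewrite in_itv.
      have m1 : measurable ([set x0] : set (measurableTypeR R)) by exact: measurable_set1.
      have dj : [set x : measurableTypeR R | x < x0] `&` [set x0] = set0.
        by apply/seteqP; split => x // [/= + xx0]; rewrite xx0 ltxx.
      have := @measureU _ _ _ nu _ _ mlt m1 dj.
      by move=> ->; rewrite -[RHS]adde0; congr (_ + _)%E; exact: nux0.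
    apply/seteqP; split => x /=; first by rewrite le_eqVlt => /orP[/eqP|]; [right|left].
    by move=> [/ltW|->].
  move=> cv; have {cv} : (nu \o F) x @[x --> \oo] --> nu [set x : R | x <= x0].
    by rewrite e1; exact: cv.
  rewrite [X in _ --> X]probability_EFin// => /fine_cvgP[_] /cvgrPdist_le /(_ _ e0)[N _ /(_ N (leqnn _))].
  rewrite /= => h; exists (x0 - N.+1%:R^-1); first by rewrite ltrBlDr ltrDl invr_gt0.
  have := le_trans (ler_norm _) h; lra.
(* Five sixths are spent in [up] or [lo], one on moving [x0] to a nearby point. *)
apply/cvgrPdist_le => e e0; have e6 : 0 < e / 6 by lra.
have [x1 x01 h1] := right _ e6; have [x2 x20 h2] := left _ e6.
near=> n; rewrite ler_norml; apply/andP; split.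
  have : fine (P n [set x | X n x <= x0]) <= fine (nu [set x | x <= x1]) + 5 * (e / 6).
    by near: n; exact: up.
  by lra.
have : fine (nu [set x | x <= x2]) - 5 * (e / 6) <= fine (P n [set x | X n x <= x0]).
  by near: n; exact: lo.
by lra.
Unshelve. all: by end_near. Qed.

End levy_continuity.

(** * The normal distribution *)

Section normal_calculus.
Context {R : realType}.
Notation mu := (@lebesgue_measure R).

(** The Radon-Nikodym derivative of the normal law and [normal_pdf] have the same integral over
    every measurable set, hence agree almost everywhere. *)
Lemma integral_normal_prob (m s : R) (f : R -> R) : bmf (T := measurableTypeR R) f ->
  Ex (normal_prob m s) f = \int[mu]_x (f x * normal_pdf m s x).
Proof.
move=> bf; rewrite /Ex /Rintegral; congr fine.
have mpdf := measurable_normal_pdf m s.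
rewrite -(Radon_Nikodym_change_of_variables (normal_prob_dominates m s))//=; last first.
  exact: (@bmf_integrable _ (measurableTypeR R) _ (normal_prob m s)).
apply: ae_eq_integral => //.
- apply: emeasurable_funM; first by apply/measurable_EFinP; exact: bf.1.
  apply: (measurable_int mu).
  by apply: Radon_Nikodym_integrable; exact: normal_prob_dominates.
- apply/measurable_EFinP; apply: measurable_funM => //; exact: bf.1.
- under [in X in ae_eq _ _ _ X]eq_fun do rewrite EFinM.
  apply: ae_eqe_mul2l => /=.
  rewrite Radon_NikodymE//=; first exact: normal_prob_dominates.
  move=> dom.
  case: cid => /= h [h1 h2 h3].
  apply: integral_ae_eq => //.
  + exact/measurable_EFinP.
  + move=> E E01 mE; have /= := h3 _ mE.
    by move=> <-.
Qed.

Variable s : R.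
Hypothesis s0 : s != 0.
Local Notation pdf := (normal_pdf 0 s).

Lemma is_derive_normal_pdf (x : R) : is_derive x 1 pdf (- x / s ^+ 2 * pdf x).
Proof.
rewrite normal_pdfE// /normal_fun.
rewrite (_ : (fun x => _) = fun x : R => normal_peak s * expR (- x ^+ 2 / (s ^+ 2 *+ 2))); last first.
  by apply/funext => y; rewrite subr0.
apply: is_derive_eq; rewrite /GRing.scale/= subr0; field.
by rewrite s0.
Qed.

(** Half of the Gaussian exponent absorbs |x|: with y = |x| / (2 |s|), one has y <= 1 + y^2 <=
    exp(y^2). The other half is a Gaussian of deviation sqrt 2 * s, which is integrable. *)
Lemma norm_mul_normal_pdf (x : R) :
  `|x| * pdf x <= 2 * `|s| * normal_peak s * normal_fun 0 (Num.sqrt 2 * s) x.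
Proof.
rewrite normal_pdfE// /normal_fun subr0 [leLHS]mulrCA [leRHS]mulrAC [leRHS]mulrC ler_wpM2l ?normal_peak_ge0//.
have s20 : 0 < s ^+ 2 by rewrite exprn_even_gt0.
pose u := x ^+ 2 / (4 * s ^+ 2).
have -> : - x ^+ 2 / (s ^+ 2 *+ 2) = - u - u by rewrite /u; field.
have -> : - x ^+ 2 / ((Num.sqrt 2 * s) ^+ 2 *+ 2) = - u.
  by rewrite exprMn sqr_sqrtr// /u; field.
rewrite expRD mulrA ler_wpM2r ?expR_ge0//.
rewrite expRN ler_pdivrMr ?expR_gt0//.
have s1 : 0 < `|s| by rewrite normr_gt0.
rewrite mulrC -ler_pdivrMr ?mulr_gt0//.
apply: (@le_trans _ _ (1 + u)); last exact: expR_ge1Dx.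
pose y := `|x| / (2 * `|s|).
have -> : u = y ^+ 2.
  by rewrite /u /y expr_div_n exprMn !real_normK ?num_real//; field.
by rewrite -/y; nra.
Qed.

Lemma integrable_norm_mul_normal_pdf :
  mu.-integrable setT (fun x => (`|x| * pdf x)%:E).
Proof.
have s2 : Num.sqrt 2 * s != 0 by rewrite mulf_neq0// sqrtr_eq0 -ltNge.
pose C := 2 * `|s| * normal_peak s / normal_peak (Num.sqrt 2 * s).
apply: (@le_integrable _ _ _ mu _ measurableT _
  (fun x => C%:E * (normal_pdf 0 (Num.sqrt 2 * s) x)%:E)%E).
- apply/measurable_EFinP; apply: measurable_funM; last exact: measurable_normal_pdf.
  exact: normr_measurable.
- move=> x _; rewrite -EFinM /= lee_fin ger0_norm ?mulr_ge0 ?normal_pdf_ge0//.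
  rewrite (le_trans (norm_mul_normal_pdf x))//.
  rewrite (le_trans _ (ler_norm _))// [in leRHS]normal_pdfE// /C.
  rewrite [leRHS]mulrA divfK// gt_eqF// normal_peak_gt0//.
- by apply: integrableZl => //; exact: integrable_normal_pdf.
Qed.

Lemma integrable_bounded_mul (f g : R -> R) (M : R) :
  measurable_fun setT f -> (forall x, `|f x| <= M) ->
  mu.-integrable setT (EFin \o g) ->
  mu.-integrable setT (fun x => (f x * g x)%:E).
Proof.
move=> mf fM ig.
apply: (@le_integrable _ _ _ mu _ measurableT _ (fun x => M%:E * (g x)%:E)%E).
- apply/measurable_EFinP; apply: measurable_funM => //.
  by move/integrableP : ig => [/measurable_EFinP].
- move=> x _; rewrite -EFinM /= lee_fin !normrM ler_wpM2r//.
  by rewrite (le_trans (fM x))// ler_norm.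
- exact: integrableZl.
Qed.

Lemma cvg_Rintegral_segment (h : R -> R) : mu.-integrable setT (EFin \o h) ->
  \int[mu]_(x in `[- n.+1%:R, n.+1%:R]) h x @[n --> \oo] --> \int[mu]_x h x.
Proof.
move=> ih; rewrite /Rintegral; apply: fine_cvg.
rewrite fineK; last exact: integrable_fin_num.
under eq_fun do rewrite integral_mkcond.
have mh : measurable_fun setT h by move/integrableP : ih => [/measurable_EFinP].
apply: (@dominated_cvg _ _ _ mu setT measurableT _ _ (fun x => `|(h x)%:E|%E)) => //.
- move=> n; apply/(measurable_restrictT _ _).1 => //.
  by apply/measurable_EFinP; exact: measurable_funTS.
- move=> x _; have [N xN] : exists N : nat, `|x| < N%:R.
    exists (Num.truncn `|x|).+1; exact: truncnS_gt.
  apply: cvg_near_cst; exists N => // n /= Nn.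
  rewrite patchE mem_set//= in_itv/= -ler_norml (le_trans (ltW xN))// ler_nat.
  by rewrite (leq_trans Nn).
- exact: integrable_abse.
- by move=> n x _; rewrite patchE; case: ifP => //; rewrite abse0.
Qed.

Lemma measurable_cos_affine (t b : R) : measurable_fun [set: R] (fun x => cos (t * x + b)).
Proof.
by apply: (bmf_cos _).1; apply: measurable_funD => //; apply: measurable_funM.
Qed.

Lemma measurable_sin_affine (t b : R) : measurable_fun [set: R] (fun x => sin (t * x + b)).
Proof.
apply: continuous_measurable_fun => x.
apply: (trigpoly_continuous (trigpoly_sin t b)).
Qed.

(** The difference of the two sides, up to the factor s^2, is the integral of the derivative of
    sin(t x + b) pdf(x), which vanishes at both ends. *)
Lemma normal_by_parts (t b : R) :
  \int[mu]_x (x * sin (t * x + b) * pdf x) =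
  s ^+ 2 * t * \int[mu]_x (cos (t * x + b) * pdf x).
Proof.
have mc := measurable_cos_affine t b; have ms := measurable_sin_affine t b.
have ipdf : mu.-integrable setT (EFin \o pdf) by exact: integrable_normal_pdf.
have ic := integrable_bounded_mul mc (fun x => cos_max (t * x + b)) ipdf.
have ixs : mu.-integrable setT (fun x => (x * sin (t * x + b) * pdf x)%:E).
  apply: (le_integrable _ _ _ integrable_norm_mul_normal_pdf) => //.
    apply/measurable_EFinP; apply: measurable_funM; last exact: measurable_normal_pdf.
    exact: measurable_funM.
  move=> x _; rewrite lee_fin !normrM normr_id ler_wpM2r// ler_piMr//.
  exact: sin_max.
have s20 : s ^+ 2 != 0 by rewrite expf_neq0.
pose h x := t * (cos (t * x + b) * pdf x) - (s ^+ 2)^-1 * (x * sin (t * x + b) * pdf x).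
have ih1 : mu.-integrable setT (fun x => (t * (cos (t * x + b) * pdf x))%:E).
  by under eq_fun do rewrite EFinM; exact: integrableZl.
have ih2 : mu.-integrable setT (fun x => ((s ^+ 2)^-1 * (x * sin (t * x + b) * pdf x))%:E).
  by under eq_fun do rewrite EFinM; exact: integrableZl.
have ih : mu.-integrable setT (EFin \o h).
  by rewrite (_ : EFin \o h = fun x => (t * (cos (t * x + b) * pdf x))%:E -
    ((s ^+ 2)^-1 * (x * sin (t * x + b) * pdf x))%:E)%E//; exact: integrableB.
have hE : \int[mu]_x h x = t * \int[mu]_x (cos (t * x + b) * pdf x) -
    (s ^+ 2)^-1 * \int[mu]_x (x * sin (t * x + b) * pdf x).
  by rewrite -!RintegralZl// -RintegralB.
suff : \int[mu]_x h x = 0.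
  rewrite hE => /eqP; rewrite subr_eq0 => /eqP e.
  by rewrite -mulrA e mulrA divff// mul1r.
pose H x := sin (t * x + b) * pdf x.
have dH (x : R) : is_derive x 1 H (h x).
  have dp := is_derive_normal_pdf x.
  by apply: is_derive_eq; rewrite /GRing.scale/= /h; field.
have cont_pdf : continuous pdf by exact: continuous_normal_pdf.
have ch : continuous h.
  move=> x; rewrite /h; apply: cvgB; apply: cvgM; try exact: cvg_cst.
    by apply: cvgM; [exact: (trigpoly_continuous (trigpoly_cos t b))|exact: cont_pdf].
  apply: cvgM; last exact: cont_pdf.
  by apply: cvgM; [exact: cvg_id|exact: (trigpoly_continuous (trigpoly_sin t b))].
have intE n : \int[mu]_(x in `[- n.+1%:R, n.+1%:R]) h x = H n.+1%:R - H (- n.+1%:R).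
  rewrite /Rintegral (@continuous_FTC2 _ h H)//.
  - by rewrite -subr_gt0 opprK addr_gt0.
  - exact: continuous_subspaceT.
  - split; first by move=> x _; have := dH x => -[].
      apply: cvg_at_right_filter.
      apply: differentiable_continuous; apply/derivable1_diffP.
      by have := dH (- n.+1%:R) => -[].
    apply: cvg_at_left_filter.
    apply: differentiable_continuous; apply/derivable1_diffP.
    by have := dH (n.+1%:R) => -[].
  - by move=> x _; rewrite derive1E; have := dH x => -[].
suff c0 : (fun n => \int[mu]_(x in `[- n.+1%:R, n.+1%:R]) h x) @ \oo --> (0 : R).
  exact: (cvg_unique _ (cvg_Rintegral_segment ih) c0).
rewrite (_ : (fun n => _) = fun n => H n.+1%:R - H (- n.+1%:R)); last exact/funext.
pose K := 2 * `|s| * normal_peak s.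
(* Boundedness of |x| pdf(x) already gives decay at rate 1 / |x|. *)
have Hb n x : `|x| = n.+1%:R -> `|H x| <= K * n.+1%:R^-1.
  move=> xn; rewrite /H normrM (@le_trans _ _ (pdf x))//.
    by rewrite (ger0_norm (normal_pdf_ge0 _ _ _)) ler_piMl ?normal_pdf_ge0// sin_max.
  rewrite ler_pdivlMr// -xn mulrC (le_trans (norm_mul_normal_pdf x))//.
  rewrite ler_piMr ?mulr_ge0 ?normal_peak_ge0//.
  rewrite /normal_fun -[leRHS]expR0 ler_expR mulNr oppr_le0 mulr_ge0 ?sqr_ge0//.
  by rewrite invr_ge0 mulrn_wge0// sqr_ge0.
apply/cvgrPdist_le => e e0.
have inv0 : K * n.+1%:R^-1 @[n --> \oo] --> (0 : R).
  by rewrite -[X in _ --> X](mulr0 K); apply: cvgM; [exact: cvg_cst|exact: cvg_harmonic].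
have e2 : 0 < e / 2 by rewrite divr_gt0.
move/cvgrPdist_le : inv0 => /(_ _ e2); apply: filterS => n /=.
rewrite !sub0r !normrN => hn; rewrite (le_trans (ler_normB _ _))//.
have := Hb n n.+1%:R; rewrite normr_nat => /(_ erefl) h1.
have := Hb n (- n.+1%:R); rewrite normrN normr_nat => /(_ erefl) h2.
have hn' := le_trans (ler_norm _) hn.
by rewrite (splitr e) lerD// (le_trans _ hn').
Qed.

(** Differentiation under the integral is dominated by |x| pdf(x); integration by parts then closes
    the equation F' = - s^2 t F. *)
Lemma is_derive_cos_normal (b t : R) :
  is_derive t 1 (fun t => \int[mu]_x (cos (t * x + b) * pdf x))
    (- (s ^+ 2 * t) * \int[mu]_x (cos (t * x + b) * pdf x)).
Proof.
have Ia : `]t - 1, t + 1[%classic t by rewrite /= in_itv/=; apply/andP; split; lra.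
have ipdf : mu.-integrable setT (EFin \o pdf) by exact: integrable_normal_pdf.
pose f u x : R := cos (u * x + b) * pdf x.
have intf u : `]t - 1, t + 1[%classic u -> mu.-integrable setT (EFin \o f u).
  move=> _; exact: integrable_bounded_mul (measurable_cos_affine u b)
    (fun x => cos_max (u * x + b)) ipdf.
have df (u x : R) : is_derive u 1 (f ^~ x) (- (x * sin (u * x + b) * pdf x)).
  by apply: is_derive_eq; rewrite /GRing.scale/=; ring.
have df1 u x : `]t - 1, t + 1[%classic u -> [set: R] x -> derivable (f ^~ x) u 1.
  by move=> _ _; have := df u x => -[].
have G0 x : 0 <= `|x| * pdf x by rewrite mulr_ge0// normal_pdf_ge0.
have pE u x : partial1of2 f u x = - (x * sin (u * x + b) * pdf x).
  by rewrite partial1of2E; have := df u x => -[].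
have Gub u x : `]t - 1, t + 1[%classic u -> [set: R] x ->
    `|partial1of2 f u x| <= `|x| * pdf x.
  move=> _ _; rewrite pE normrN !normrM (ger0_norm (normal_pdf_ge0 _ _ _)).
  by rewrite ler_wpM2r ?normal_pdf_ge0// ler_piMr// sin_max.
have D := @derivable_under_integral _ _ _ mu f setT measurableT t _ _ Ia intf df1
  _ G0 integrable_norm_mul_normal_pdf Gub.
have E := @differentiation_under_integral _ _ _ mu f setT measurableT t _ _ Ia intf df1
  _ G0 integrable_norm_mul_normal_pdf Gub.
apply: DeriveDef; first exact: D.
rewrite -derive1E E; under eq_Rintegral do rewrite pE.
rewrite mulNr -normal_by_parts.
rewrite -[RHS]mulN1r -RintegralZl//; first by under eq_Rintegral do rewrite -mulN1r.
apply: (le_integrable _ _ _ integrable_norm_mul_normal_pdf) => //.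
  apply/measurable_EFinP; apply: measurable_funM; last exact: measurable_normal_pdf.
  by apply: measurable_funM => //; exact: measurable_sin_affine.
move=> x _; rewrite lee_fin !normrM normr_id ler_wpM2r// ler_piMr//.
exact: sin_max.
Qed.

(** The transform F solves F' = - s^2 t F with F(0) = cos b, so F(t) exp(s^2 t^2 / 2) has derivative
    zero. *)
Lemma Ex_cos_normal (t b : R) :
  Ex (normal_prob 0 s) (fun x => cos (t * x + b)) =
  cos b * expR (- (s ^+ 2 * t ^+ 2 / 2)).
Proof.
have bc u : bmf (T := measurableTypeR R) (fun x => cos (u * x + b)).
  by split; [exact: measurable_cos_affine | exists 1 => x; exact: cos_max].
pose F u := \int[mu]_x (cos (u * x + b) * pdf x).
rewrite integral_normal_prob// -/(F t).
have F0 : F 0 = cos b.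
  rewrite /F -(@integral_normal_prob 0 s (fun x => cos (0 * x + b)))//.
  by under eq_Ex do rewrite mul0r add0r; rewrite Ex_cst.
pose K u := F u * expR (s ^+ 2 * u ^+ 2 / 2).
have dK (u : R) : is_derive u 1 K 0.
  have dF := is_derive_cos_normal b u.
  by apply: is_derive_eq; rewrite /GRing.scale/= -/(F u); field.
have : K t = K 0 by exact: is_derive_0_is_cst.
rewrite /K F0 expr0n/= mulr0 mul0r expR0 mulr1 => <-.
by rewrite -[RHS]mulrA -expRD addrN expR0 mulr1.
Qed.

End normal_calculus.

(** * The normal tail function and its inverse *)

Section normal_tail.
Context {R : realType}.

Lemma cdf_tails (nu : probability (measurableTypeR R) R) (e : R) : 0 < e ->
  (exists a : R, fine (nu [set` `]-oo, a]]) <= e) /\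
  (exists b : R, 1 - e <= fine (nu [set` `]-oo, b]])).
Proof.
move=> e0; have [L hL] := probability_tail_small nu e0.
have mA : measurable [set x : measurableTypeR R | L < `|x|].
  apply: measurable_gtr_preimage; exact: normr_measurable.
split.
  exists (- L - 1); apply: le_trans hL; rewrite fine_le ?fin_num_measure//.
  rewrite le_measure ?inE// => x /=; rewrite in_itv/= => h.
  rewrite -normrN (lt_le_trans _ (ler_norm _))//; lra.
exists L.
apply: (@le_trans _ _ (fine (nu (~` [set x : measurableTypeR R | L < `|x|])))).
  rewrite probability_setC// fineB ?fin_num_measure//= lerD2l lerN2.
  exact: hL.
rewrite fine_le ?fin_num_measure//; try exact: measurableC.
rewrite le_measure ?inE//; try exact: measurableC.
by move=> x /= /negP; rewrite -leNgt in_itv/= => /(le_trans (ler_norm _)).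
Qed.

Local Notation pdf := (normal_pdf (0 : R) 1).

Lemma is_derive_Phi (x : R) : is_derive x 1 Phi (pdf x).
Proof.
have ix : x < x + 1 by rewrite ltrDl.
have int1 : (@lebesgue_measure R).-integrable [set` Interval -oo%O (BRight (x + 1))]
    (EFin \o pdf).
  by apply: (integrableS _ _ (@subsetT _ _)) => //; exact: integrable_normal_pdf.
have cp : {for x, continuous pdf} by exact: continuous_normal_pdf.
have [|d e] := @continuous_FTC1 R pdf -oo%O x (x + 1) ix int1 _ cp.
  by rewrite ltNyr.
by apply: DeriveDef; [exact: d|rewrite -derive1E -e].
Qed.

Lemma is_derive_Phibar (x : R) : is_derive x 1 Phibar (- pdf x).
Proof.
have d := is_derive_Phi x; rewrite /Phibar.
apply: is_derive_eq.
by rewrite add0r mul1r.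
Qed.

Lemma continuous_Phibar : continuous (@Phibar R).
Proof.
move=> x; apply: differentiable_continuous; apply/derivable1_diffP.
by have := is_derive_Phibar x => -[].
Qed.

Lemma normal_pdf_gt0 (x : R) : 0 < pdf x.
Proof. by rewrite normal_pdfE// mulr_gt0 ?expR_gt0// normal_peak_gt0. Qed.

Lemma Phibar_lt (x y : R) : x < y -> Phibar y < Phibar x.
Proof.
move=> xy.
have [|c _ e] := MVT xy (fun z _ => is_derive_Phibar z).
  by apply: continuous_subspaceT => z; exact: continuous_Phibar.
rewrite -subr_lt0 e pmulr_llt0 ?subr_gt0// oppr_lt0; exact: normal_pdf_gt0.
Qed.

Lemma ltr_Phibar (x y : R) : (Phibar x < Phibar y) = (y < x).
Proof.
have [yx|xy|->] := ltgtP y x; last by rewrite ltxx.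
  exact: Phibar_lt.
by apply/negbTE; rewrite -leNgt ltW// Phibar_lt.
Qed.

Lemma ler_Phibar (x y : R) : (Phibar x <= Phibar y) = (y <= x).
Proof. by rewrite leNgt ltr_Phibar -leNgt. Qed.

Lemma Phibar_inj : injective (@Phibar R).
Proof.
by move=> x y e; apply/eqP; rewrite eq_le -[(x <= y)%R]ler_Phibar -[(y <= x)%R]ler_Phibar e lexx.
Qed.

Lemma Phi_itv (x : R) : 0 <= Phi x <= 1.
Proof.
rewrite /Phi fine_ge0//= -lee_fin fineK ?fin_num_measure//.
exact: probability_le1.
Qed.

Lemma Phibar_itv (x : R) : 0 < Phibar x < 1.
Proof.
have h (y : R) : 0 <= Phibar y <= 1 by have := Phi_itv y; rewrite /Phibar; lra.
have : x < x + 1 by rewrite ltrDl.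
have : x - 1 < x by rewrite ltrBlDr ltrDl.
move=> /Phibar_lt a /Phibar_lt b.
have := h (x - 1); have := h (x + 1); lra.
Qed.

Lemma Phibar_surj (t : R) : 0 < t < 1 -> exists x, Phibar x = t.
Proof.
move=> /andP[t0 t1].
have t2 : 0 < t / 2 by rewrite divr_gt0.
have t12 : 0 < (1 - t) / 2 by lra.
have [_ [b hb]] := cdf_tails (normal_prob (0 : R) 1) t2.
have [[a ha] _] := cdf_tails (normal_prob (0 : R) 1) t12.
have {}hb : Phibar b < t by rewrite /Phibar /Phi; lra.
have {}ha : t < Phibar a by rewrite /Phibar /Phi; lra.
have ab : a <= b by rewrite -ler_Phibar ltW// (lt_trans hb).
have [|//|c _ e] := @IVT R Phibar a b t ab; last by exists c.
  by apply: continuous_subspaceT => z; exact: continuous_Phibar.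
by rewrite ge_min le_max (ltW ha) (ltW hb) /= orbT.
Qed.

Lemma Phibar_invK (t : R) : 0 < t < 1 -> Phibar (fine (Phibar_inv t)) = t.
Proof.
move=> t01; have [x xt] := Phibar_surj t01; case/andP: t01 => t0 t1.
rewrite /Phibar_inv leNgt t0/= leNgt t1/=.
by case: xgetP => [y _ //|/(_ x)].
Qed.

Lemma PhibarK (x : R) : Phibar_inv (Phibar x) = x%:E.
Proof.
have h := Phibar_itv x; have := Phibar_invK h.
have /andP[h0 h1] := h.
rewrite /Phibar_inv leNgt h0/= leNgt h1/= => /Phibar_inj -> //.
Qed.

Lemma fine_Phibar_inv_gt (t x : R) : 0 < t < 1 ->
  (fine (Phibar_inv t) <= x) = (Phibar x <= t).
Proof. by move=> /Phibar_invK e; rewrite -[in RHS]e ler_Phibar. Qed.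

Lemma is_derive_Phibar_inv (t : R) : 0 < t < 1 ->
  is_derive t 1 (fine \o Phibar_inv) (- pdf (fine (Phibar_inv t)))^-1.
Proof.
move=> t01; rewrite -{1}(Phibar_invK t01).
apply: (@is_derive_inverse R Phibar).
- by near=> x; rewrite /= PhibarK.
- by near=> x; exact: continuous_Phibar.
- exact: is_derive_Phibar.
- by rewrite oppr_eq0 gt_eqF// normal_pdf_gt0.
Unshelve. all: by end_near. Qed.

End normal_tail.

(** * Cutoffs for the noise given W = w *)

Section conditional_p_value_laws.
Context {R : realType} (muA pi1 rho1 w : R).
Hypothesis hrho1 : 0 <= rho1 < 1.

(** The argument of [Phibar] in [gamma]: given [W = w], an index of type [r] has p-value at most [t]
    exactly when its noise reaches this level. *)
Definition noise_cut (r : bool) (t : R) : R :=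
  (fine (Phibar_inv t) - muA * r%:R - Num.sqrt rho1 * w) / Num.sqrt (1 - rho1).

Lemma sqrt_onem_rho_gt0 : 0 < Num.sqrt (1 - rho1).
Proof. by rewrite sqrtr_gt0 subr_gt0; case/andP: hrho1. Qed.

Lemma gammaE r t : gamma muA rho1 w r t = Phibar (noise_cut r t).
Proof. by []. Qed.

Lemma pvalue_le_noise_cut (r : bool) (t e : R) : 0 < t < 1 ->
  (Phibar (muA * r%:R + Num.sqrt rho1 * w + Num.sqrt (1 - rho1) * e) <= t) =
  (noise_cut r t <= e).
Proof.
move=> t01; rewrite -fine_Phibar_inv_gt// /noise_cut.
rewrite ler_pdivrMr ?sqrt_onem_rho_gt0// mulrC.
by apply/idP/idP; lra.
Qed.

Lemma noise_cut_le r (s t : R) : 0 < s -> s <= t -> t < 1 ->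
  noise_cut r t <= noise_cut r s.
Proof.
move=> s0 st t1; rewrite ler_pM2r ?invr_gt0 ?sqrt_onem_rho_gt0//.
rewrite !lerD2r fine_Phibar_inv_gt; last by rewrite (lt_le_trans s0).
by rewrite Phibar_invK// s0 (le_lt_trans st).
Qed.

Lemma gamma_itv r t : 0 < gamma muA rho1 w r t < 1.
Proof. exact: Phibar_itv. Qed.

Lemma derivable_gamma r t : 0 < t < 1 -> derivable (gamma muA rho1 w r) t 1.
Proof.
move=> t01; have d1 := is_derive_Phibar_inv t01.
have d2 : is_derive t 1 (noise_cut r)
  ((- normal_pdf 0 1 (fine (Phibar_inv t)))^-1 / Num.sqrt (1 - rho1)).
  rewrite /noise_cut; apply: is_derive_eq.
  by rewrite /GRing.scale/= !subr0 mulr0 add0r mulrC.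
have d3 := @is_derive1_comp R Phibar (noise_cut r) t _ _ (is_derive_Phibar _) d2.
by have := d3 => -[].
Qed.

Lemma derivable_G t : 0 < t < 1 -> derivable (G muA pi1 rho1 w) t 1.
Proof.
move=> t01; rewrite /G; apply: derivableD; apply: derivableM => //;
  exact: derivable_gamma.
Qed.

Lemma derive_G t : 0 < t < 1 -> (G muA pi1 rho1 w)^`()%classic t =
  (1 - pi1) * (gamma muA rho1 w false)^`()%classic t +
  pi1 * (gamma muA rho1 w true)^`()%classic t.
Proof.
move=> t01; rewrite !derive1E.
have d0 : is_derive t 1 (gamma muA rho1 w false) ('D_1 (gamma muA rho1 w false) t).
  by apply/derivableP; exact: derivable_gamma.
have d1 : is_derive t 1 (gamma muA rho1 w true) ('D_1 (gamma muA rho1 w true) t).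
  by apply/derivableP; exact: derivable_gamma.
apply: derive_val; rewrite /G; exact: is_derive_eq.
Qed.

End conditional_p_value_laws.

(** * The last crossing of G and the diagonal t / q *)

Lemma derivable_expansion (R : realType) (f : R -> R) (x e : R) :
  derivable f x 1 -> 0 < e ->
  exists2 dl, 0 < dl & forall y, `|y - x| <= dl ->
    `|f y - f x - f^`()%classic x * (y - x)| <= e * `|y - x|.
Proof.
move=> df e0.
have /cvgrPdist_le/(_ _ e0) : h^-1 *: (f (h *: 1 + x) - f x) @[h --> 0^'] --> f^`()%classic x.
  by rewrite derive1E; exact: df.
move=> [dl/= dl0 hd]; exists (dl / 2); first by rewrite divr_gt0.
move=> y yx; have [->|nxy] := eqVneq y x; first by rewrite !subrr mulr0 subrr normr0 mulr0.
have yx0 : y - x != 0 by rewrite subr_eq0.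
have yxb : ball_ [eta Num.norm] 0 dl (y - x).
  by rewrite /ball_/= sub0r normrN (le_lt_trans yx)//; lra.
have := hd _ yxb yx0; rewrite /GRing.scale/= mulr1 subrK => h.
have h2 : `|f y - f x - f^`()%classic x * (y - x)| =
    `|f^`()%classic x - (y - x)^-1 * (f y - f x)| * `|y - x|.
  by rewrite -normrM mulrBl mulrAC mulVf// mul1r distrC.
by rewrite h2 ler_wpM2r.
Qed.

Section last_crossing.
Context {R : realType} (q muA pi1 rho1 w : R).
Hypotheses (hq : 0 < q < 1) (hpi1 : 0 < pi1 < 1).

Local Notation g := (G muA pi1 rho1 w).
Local Notation tau := (tau_star q muA pi1 rho1 w).
Local Notation slack := (1 / q - g^`()%classic tau).

Hypotheses (tau_gt0 : 0 < tau) (slack_neq0 : slack != 0).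

Let q_gt0 : 0 < q. Proof. by case/andP: hq. Qed.

Let S : set R := [set t | 0 < t < 1 /\ t / q <= g t].

Let g_lt1 t : g t < 1.
Proof.
have /andP[_ h0] := gamma_itv muA rho1 w false t.
have /andP[_ h1] := gamma_itv muA rho1 w true t.
have /andP[p0 p1] := hpi1.
have h : g t < (1 - pi1) * 1 + pi1 * 1.
  by rewrite /G ltrD// ltr_pM2l// subr_gt0.
by apply: lt_le_trans h _; rewrite !mulr1 subrK.
Qed.

(** [G] is below 1, so t / q <= G t forces t < q; this keeps the crossings away from 1. *)
Let S_le_q : ubound S q.
Proof.
move=> t [_ h]; have := le_lt_trans h (g_lt1 t).
by rewrite ltr_pdivrMr// mul1r => /ltW.
Qed.

Let S_neq0 : S !=set0.
Proof.
apply/set0P/negP => /eqP S0; have := tau_gt0; rewrite /tau_star -/S S0 sup0.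
by rewrite ltxx.
Qed.

Let S_sup : has_sup S.
Proof. by split; [exact: S_neq0|exists q; exact: S_le_q]. Qed.

Lemma tau_star_le : tau <= q.
Proof. by apply: ge_sup; [exact: S_neq0|exact: S_le_q]. Qed.

Lemma tau_star_itv : 0 < tau < 1.
Proof. by rewrite tau_gt0 (le_lt_trans tau_star_le)//; case/andP: hq. Qed.

Let above_tau t : tau < t -> t < 1 -> g t < t / q.
Proof.
move=> tt t1; rewrite ltNge; apply/negP => h.
have St : S t by split => //; rewrite (lt_trans tau_gt0).
by have := sup_upper_bound S_sup St; rewrite leNgt tt.
Qed.

Let continuous_g t : 0 < t < 1 -> {for t, continuous g}.
Proof.
move=> t01; apply: differentiable_continuous; apply/derivable1_diffP.
exact: derivable_G.
Qed.

(** By continuity, a value above the diagonal would put points to the right of the supremum into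
    [S], and a value below would clear a left neighbourhood of the supremum of points of [S]. *)
Lemma G_tau_star : g tau = tau / q.
Proof.
have cg : {for tau, continuous (fun t => g t - t / q)}.
  apply: cvgB; first exact: continuous_g tau_star_itv.
  by apply: cvgMl; exact: cvg_id.
have /andP[t0 t1] := tau_star_itv.
apply/eqP; rewrite -subr_eq0 eq_le; apply/andP; split; rewrite leNgt; apply/negP => h.
  move/cvgrPdist_lt : cg => /(_ _ h) [dl /= dl0 hd].
  pose t := tau + Num.min (dl / 2) ((1 - tau) / 2).
  have m1 : Num.min (dl / 2) ((1 - tau) / 2) <= dl / 2 by rewrite ge_min lexx.
  have m2 : Num.min (dl / 2) ((1 - tau) / 2) <= (1 - tau) / 2 by rewrite ge_min lexx orbT.
  have m3 : 0 < Num.min (dl / 2) ((1 - tau) / 2) by rewrite lt_min; apply/andP; split; lra.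
  have tt : tau < t by rewrite /t; lra.
  have tt1 : t < 1 by rewrite /t; lra.
  have tb : `|tau - t| < dl by rewrite ltr0_norm; rewrite /t; lra.
  have := hd t tb; have := above_tau tt tt1.
  by rewrite ltr_norml => ? /andP[_ ?]; lra.
have h' : 0 < - (g tau - tau / q) by lra.
move/cvgrPdist_lt : cg => /(_ _ h') [dl /= dl0 hd].
have [t [t01 St] ht] := sup_adherent dl0 S_sup.
have ttau : t <= tau by apply: sup_upper_bound.
have tb : `|tau - t| < dl.
  by rewrite ger0_norm ?subr_ge0//; move: ht; rewrite -/(tau_star q muA pi1 rho1 w); lra.
have := hd t tb; rewrite ltr_norml => /andP[? _]; lra.
Qed.

(** With a negative slack [G] would rise above t / q immediately to the right of its last
    crossing. *)
Lemma slack_gt0 : 0 < slack.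
Proof.
rewrite lt_neqAle eq_sym slack_neq0/= leNgt; apply/negP => sl0.
have /andP[t0 t1] := tau_star_itv.
have e0 : 0 < - slack / 2 by lra.
have [dl dl0 hd] := derivable_expansion (@derivable_G R muA pi1 rho1 w tau tau_star_itv) e0.
pose e := Num.min dl ((1 - tau) / 2).
have m1 : e <= dl by rewrite ge_min lexx.
have m2 : e <= (1 - tau) / 2 by rewrite ge_min lexx orbT.
have m3 : 0 < e by rewrite lt_min; apply/andP; split; lra.
have := hd (tau + e); rewrite addrAC subrr add0r gtr0_norm// => /(_ m1).
rewrite G_tau_star ler_norml => /andP[h _].
have := @above_tau (tau + e); rewrite ltrDl => /(_ m3) h2.
have h3 : g (tau + e) < (tau + e) / q by apply: h2; lra.
have se : 0 < - slack * e by rewrite mulr_gt0//; lra.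
rewrite mulrDl in h3.
clearbody e; move: h h3 se; rewrite div1r.
by move: q^-1 (g (tau + e)) (g^`()%classic tau) => iq ge g'; lra.
Qed.

(** Near the crossing the derivative gives the margin with half the slack; farther right, [G] stays
    strictly below t / q on a compact interval. The end (1 + q) / 2 leaves room for rounding the
    threshold, which is at most q, up to a grid point. *)
Lemma crossing_margin : exists c, [/\ 0 < c,
  (forall t, tau <= t <= (1 + q) / 2 -> c * (t - tau) <= t / q - g t) &
  exists2 dl, 0 < dl & forall t, tau - dl <= t <= tau -> t / q - g t <= - (c * (tau - t))].
Proof.
have sl0 := slack_gt0; have s20 : 0 < slack / 2 by rewrite divr_gt0.
have /andP[t0 t1] := tau_star_itv.
have [dl dl0 hd] := derivable_expansion (@derivable_G R muA pi1 rho1 w tau tau_star_itv) s20.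
have near_right t : tau <= t -> t <= tau + dl -> slack / 2 * (t - tau) <= t / q - g t.
  move=> h1 h2; have tt : 0 <= t - tau by rewrite subr_ge0.
  have := hd t; rewrite (ger0_norm tt) => hdt; have tdl : t - tau <= dl by lra.
  move: (hdt tdl) => {hdt}.
  rewrite /= G_tau_star ler_norml => /andP[_ h].
  by move: h; rewrite !mulrBl mul1r; lra.
have near_left t : tau - dl <= t <= tau -> t / q - g t <= - (slack / 2 * (tau - t)).
  move=> /andP[h1 h2]; have tt : t - tau <= 0 by rewrite subr_le0.
  have := hd t; rewrite (ler0_norm tt) => hdt; have tdl : - (t - tau) <= dl by lra.
  move: (hdt tdl) => {hdt}.
  rewrite G_tau_star ler_norml => /andP[h _].
  by move: h; rewrite !mulrBl mul1r; lra.
have [far|near] := leP (tau + dl) ((1 + q) / 2); last first.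
  exists (slack / 2); split => //; last by exists dl.
  by move=> t /andP[h1 h2]; apply: near_right => //; lra.
have cf : {within `[tau + dl, (1 + q) / 2], continuous (fun t => t / q - g t)}.
  apply/continuous_in_subspaceT => t; rewrite inE/= in_itv/= => /andP[h1 h2].
  apply: cvgB; first by apply: cvgMl; exact: cvg_id.
  by apply: continuous_g; case/andP: hq => *; apply/andP; split; lra.
have [t' ht' min] := EVT_min far cf.
(* Distances from [tau] are below 1, so a constant lower bound far from [tau] is also a linear
   one. *)
pose c := Num.min (slack / 2) (t' / q - g t').
have /andP[q0' q1'] := hq.
move: ht'; rewrite in_itv/= => /andP[ht1 ht2].
have pos : 0 < t' / q - g t' by rewrite subr_gt0; apply: above_tau; lra.
have c0 : 0 < c by rewrite lt_min s20.
have c1 : c <= slack / 2 by rewrite ge_min lexx.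
have c2 : c <= t' / q - g t' by rewrite ge_min lexx orbT.
exists c; split; first exact: c0.
  move=> t /andP[h1 h2]; have tt : 0 <= t - tau by rewrite subr_ge0.
  have [h3|h3] := leP t (tau + dl).
    by rewrite (le_trans _ (near_right _ h1 h3))// ler_wpM2r.
  apply: (@le_trans _ _ c); first by rewrite ler_piMr ?(ltW c0)//; lra.
  by apply: (le_trans c2); apply: min; rewrite in_itv/= (ltW h3).
exists dl; first exact: dl0.
move=> t ht; apply: (le_trans (near_left _ ht)); rewrite lerN2 ler_wpM2r//.
by rewrite subr_ge0; case/andP: ht.
Qed.

End last_crossing.

(** * Gaussian vectors *)

Section laws_and_expectations.
Context d (T : measurableType d) (R : realType) (P : probability T R).

Lemma Ex_law (Y : T -> R) (nu : probability (measurableTypeR R) R) (f : R -> R) :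
  measurable_fun [set: T] Y ->
  (forall B : set R, measurable B -> P (Y @^-1` B) = nu B) ->
  bmf (T := measurableTypeR R) f -> Ex P (f \o Y) = Ex nu f.
Proof.
move=> mY PY bf; rewrite /Ex /Rintegral; congr fine.
have bfY : bmf (f \o Y).
  split; first exact: (measurableT_comp bf.1 mY).
  by have [M fM] := bf.2; exists M => x; exact: fM.
have := @integral_pushforward _ _ T (measurableTypeR R) R Y mY P setT (EFin \o f) _ _ measurableT.
rewrite preimage_setT => <-.
- by apply: eq_measure_integral => A mA _; exact: PY.
- by apply/measurable_EFinP; exact: bf.1.
- exact: bmf_integrable.
Qed.

End laws_and_expectations.

Section cosine_transform.
Context d (T : measurableType d) (R : realType) (P : probability T R).

(** The characteristic function of a centered Gaussian family in real form. An arbitrary index type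
    permits selecting, renaming and repeating coordinates. *)
Definition gaussian_cosines (J : Type) (X : J -> T -> R) (C : J -> J -> R) :=
  forall (s : seq J) (a : J -> R) (b : R),
    Ex P (fun x => cos (\sum_(j <- s) a j * X j x + b)) =
    cos b * expR (- (\sum_(j <- s) \sum_(k <- s) a j * a k * C j k) / 2).

Variables (n : nat) (X : 'I_n -> {RV P >-> R}) (S : 'M[R]_n).
Hypothesis gX : is_gaussian_vector X S.

(** The square root of a negative number is 0, and [normal_pdf] with deviation 0 is the indicator of
    [0, 1]. *)
Lemma normal_law_neg (v : R) (V : set R) : v < 0 -> measurable V ->
  normal_law v V = lebesgue_measure (`[0, 1] `&` V).
Proof.
move=> v0 mV; rewrite /normal_law lt_eqF// ler0_sqrtr ?ltW//.
rewrite /normal_prob /normal_pdf eqxx integral_indic//.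
Qed.

(* For v < 0, [normal_law v] is by junk values uniform on [0, 1], which cannot be the
   law of both Y and - Y. *)
Lemma gaussian_variance_ge0 (a : 'rV[R]_n) : 0 <= (a *m S *m a^T) ord0 ord0.
Proof.
rewrite leNgt; apply/negP => v0.
have m01 : measurable ([set` `[0, 1]] : set R) by exact: measurable_itv.
have mN10 : measurable ([set` `[-1, 0]] : set R) by exact: measurable_itv.
have := gX a mN10; have := gX (- a) m01.
have -> : (- a *m S *m (- a)^T) ord0 ord0 = (a *m S *m a^T) ord0 ord0.
  by rewrite linearN/= mulmxN !mulNmx opprK.
have -> : [set x | [set` `[0, 1]] (\sum_i (- a) ord0 i * X i x)] =
    [set x | [set` `[-1, 0]] (\sum_i a ord0 i * X i x)].
  have sE x : \sum_i (- a) ord0 i * X i x = - \sum_i a ord0 i * X i x.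
    by rewrite -sumrN; apply: eq_bigr => i _; rewrite mxE mulNr.
  by apply/seteqP; split => x /=; rewrite sE !in_itv/=; lra.
move=> ->; rewrite !normal_law_neg// setIid.
have -> : [set` `[0, 1]] `&` [set` `[-1, 0]] = [set (0 : R)].
  apply/seteqP; split => x /=; rewrite !in_itv/=; first by lra.
  by move=> ->; rewrite lexx ler01 lerN10.
rewrite lebesgue_measure_set1 lebesgue_measure_itv/= lte01 oppr0 adde0.
by move=> /eqP; rewrite onee_eq0.
Qed.

Lemma measurable_sum_coef (J : Type) (s : seq J) (Y : J -> T -> R) (a : J -> R) b :
  (forall j, measurable_fun [set: T] (Y j)) ->
  measurable_fun [set: T] (fun x => \sum_(j <- s) a j * Y j x + b).
Proof.
move=> mY; apply: measurable_funD => //; apply: measurable_sum => i.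
exact: measurable_funM.
Qed.

Lemma Ex_cos_gaussian (a : 'rV[R]_n) (b : R) :
  Ex P (fun x => cos (\sum_i a ord0 i * X i x + b)) =
  cos b * expR (- (a *m S *m a^T) ord0 ord0 / 2).
Proof.
have v0 := gaussian_variance_ge0 a; set v := (_ *m _) ord0 ord0 in v0 *.
pose Y x := \sum_i a ord0 i * X i x.
have mY : measurable_fun [set: T] Y.
  by apply: measurable_sum => i; apply: measurable_funM.
pose f y : R := cos (1 * y + b).
have bf : bmf (T := measurableTypeR R) f.
  by split; [exact: measurable_cos_affine | exists 1 => x; exact: cos_max].
have -> : (fun x => cos (\sum_i a ord0 i * X i x + b)) = f \o Y.
  by apply/funext => x; rewrite /f/= mul1r.
have law B : measurable B -> P (Y @^-1` B) = normal_law v B by exact: gX.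
have [e0|vn0] := eqVneq v 0.
  rewrite e0 oppr0 mul0r expR0 mulr1.
  rewrite (@Ex_law _ _ _ _ Y (@dirac _ (measurableTypeR R) (0 : R) R))//.
    rewrite /Ex /Rintegral integral_dirac//; last first.
      by apply/measurable_EFinP; exact: bf.1.
    by rewrite diracT mul1e /f mulr0 add0r.
  by move=> B mB; rewrite law// /normal_law e0 eqxx.
rewrite (@Ex_law _ _ _ _ Y (normal_prob 0 (Num.sqrt v)))//.
  rewrite Ex_cos_normal; last by rewrite sqrtr_eq0 -ltNge lt_neqAle eq_sym vn0.
  by rewrite sqr_sqrtr// expr1n mulr1 mulNr.
by move=> B mB; rewrite law// /normal_law (negbTE vn0).
Qed.

Lemma gaussian_vector_cosines (J : Type) (f : J -> 'I_n) :
  gaussian_cosines (fun j => X (f j)) (fun j k => S (f j) (f k)).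
Proof.
(* Coefficients of indices sent by [f] to the same coordinate add up. *)
move=> s a b; pose u : 'rV[R]_n := \sum_(j <- s) a j *: delta_mx ord0 (f j).
have uE (F : 'I_n -> R) : \sum_i u ord0 i * F i = \sum_(j <- s) a j * F (f j).
  under eq_bigr do rewrite /u summxE mulr_suml.
  rewrite exchange_big/=; apply: eq_bigr => j _.
  rewrite (bigD1 (f j))//= big1 ?addr0; last first.
    by move=> i ij; rewrite !mxE eqxx (negbTE ij) mulr0 mul0r.
  by rewrite !mxE !eqxx mulr1.
under eq_Ex do rewrite -(uE (fun i => X i _)).
rewrite Ex_cos_gaussian; congr (_ * expR (- _ / 2)).
rewrite mxE; under eq_bigr do rewrite [X in X * _]mxE uE mxE mulrC.
rewrite uE; under eq_bigr do rewrite mulr_sumr.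
rewrite exchange_big/=; apply: eq_bigr => j _; apply: eq_bigr => k _.
by rewrite mulrA (mulrC (a k)).
Qed.

End cosine_transform.

Section gaussian_uniqueness.
Context d d' (T : measurableType d) (T' : measurableType d') (R : realType).
Variables (P : probability T R) (P' : probability T' R).

Lemma gaussian_same_law (J : eqType) (s : seq J) (X : J -> T -> R)
    (X' : J -> T' -> R) (C : J -> J -> R) (g : J -> R -> R) :
  uniq s -> (forall j, measurable_fun [set: T] (X j)) ->
  (forall j, measurable_fun [set: T'] (X' j)) ->
  gaussian_cosines P X C -> gaussian_cosines P' X' C ->
  (forall j, stepf (g j)) ->
  Ex P (fun x => \prod_(j <- s) g j (X j x)) =
  Ex P' (fun x => \prod_(j <- s) g j (X' j x)).
Proof.
move=> us mX mX' gX gX' sg.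
have := @eq_Ex_prod_stepf _ _ T T' R P P' J s X X' g (fun=> 1) (fun=> 1) us
  (bmf_cst T 1) (bmf_cst T' 1) mX mX' sg.
under eq_Ex do rewrite mul1r; under [in RHS]eq_Ex do rewrite mul1r.
apply.
by move=> a b; under eq_Ex do rewrite mul1r; under [in RHS]eq_Ex do rewrite mul1r;
  rewrite gX gX'.
Qed.

End gaussian_uniqueness.

Section gaussian_independence.
Context d (T : measurableType d) (R : realType) (P : probability T R).

(** Without cross covariances the quadratic form splits, so expectations of products of cosines
    factor. Cosines become step functions first on [s1], with the cosine in [s2] as weight, then on
    [s2], with the product over [s1] as weight. *)
Lemma gaussian_independence (J : eqType) (s1 s2 : seq J) (X : J -> T -> R)
    (C : J -> J -> R) (g : J -> R -> R) :
  uniq (s1 ++ s2) -> (forall j, measurable_fun [set: T] (X j)) ->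
  gaussian_cosines P X C ->
  {in s1 & s2, forall j k, C j k = 0 /\ C k j = 0} ->
  (forall j, stepf (g j)) ->
  Ex P (fun x => (\prod_(j <- s1) g j (X j x)) * \prod_(j <- s2) g j (X j x)) =
  Ex P (fun x => \prod_(j <- s1) g j (X j x)) *
  Ex P (fun x => \prod_(j <- s2) g j (X j x)).
Proof.
move=> us mX gX C0 sg.
have /and3P[us1 /hasPn s12 us2] : [&& uniq s1, ~~ has [in s1] s2 & uniq s2].
  by rewrite -cat_uniq.
have bcos s a b : bmf (fun x => cos (\sum_(j <- s) a j * X j x + b)).
  by apply: bmf_cos; exact: measurable_sum_coef.
have bprod s : bmf (fun x => \prod_(j <- s) g j (X j x)).
  by apply: bmf_prod => j _; exact: (bmf_stepf (mX j) (sg j)).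
have cos2 a1 b1 a2 b2 :
    Ex P (fun x => cos (\sum_(j <- s2) a2 j * X j x + b2) *
                   cos (\sum_(j <- s1) a1 j * X j x + b1)) =
    Ex P (fun x => cos (\sum_(j <- s2) a2 j * X j x + b2)) *
    Ex P (fun x => cos (\sum_(j <- s1) a1 j * X j x + b1)).
  (* The signs e = 1 and e = -1 give the sum and the difference in the product formula. *)
  pose c e j := if j \in s1 then a1 j else e * a2 j.
  have c1 e : {in s1, c e =1 a1} by move=> j js; rewrite /c js.
  have c2 e : {in s2, forall j, c e j = e * a2 j}.
    by move=> j js; rewrite /c ifN// s12.
  have sE e x b : \sum_(j <- s1 ++ s2) c e j * X j x + b =
      \sum_(j <- s1) a1 j * X j x + e * (\sum_(j <- s2) a2 j * X j x) + b.
    rewrite big_cat/=; congr (_ + _ + _).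
      by rewrite !big_seq; apply: eq_bigr => j js; rewrite c1.
    by rewrite mulr_sumr !big_seq; apply: eq_bigr => j js; rewrite c2// mulrA.
  pose Q s (a : J -> R) := \sum_(j <- s) \sum_(k <- s) a j * a k * C j k.
  have QE e : e ^+ 2 = 1 -> Q (s1 ++ s2) (c e) = Q s1 a1 + Q s2 a2.
    move=> e1; rewrite /Q big_cat/=; congr (_ + _).
      rewrite !big_seq; apply: eq_bigr => j js; rewrite big_cat/= [X in _ + X]big_seq.
      rewrite [X in _ + X]big1 ?addr0; last by move=> k ks; rewrite (C0 _ _ js ks).1 mulr0.
      by rewrite !big_seq; apply: eq_bigr => k ks; rewrite !c1.
    rewrite !big_seq; apply: eq_bigr => j js; rewrite big_cat/= [X in X + _]big_seq.
    rewrite [X in X + _]big1 ?add0r; last by move=> k ks; rewrite (C0 _ _ ks js).2 mulr0.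
    rewrite !big_seq; apply: eq_bigr => k ks; rewrite !c2//.
    by rewrite -[RHS]mul1r -e1; ring.
  have bc e b : Ex P (fun x => cos (\sum_(j <- s1) a1 j * X j x +
      e * (\sum_(j <- s2) a2 j * X j x) + b)) =
      Ex P (fun x => cos (\sum_(j <- s1 ++ s2) c e j * X j x + b)).
    by apply: eq_Ex => x; rewrite sE.
  transitivity (2^-1 * (Ex P (fun x => cos (\sum_(j <- s1 ++ s2) c 1 j * X j x + (b1 + b2)))
    + Ex P (fun x => cos (\sum_(j <- s1 ++ s2) c (-1) j * X j x + (b1 - b2))))).
    rewrite -ExD// -ExZ; last exact: bmfD.
    apply: eq_Ex => x; rewrite mulrC mulr_cos !sE.
    by congr (_ * (cos _ + cos _)); ring.
  have q1 := QE 1 (expr1n _ _); have q2 : (-1) ^+ 2 = 1 :> R by rewrite sqrrN expr1n.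
  have {}q2 := QE _ q2.
  rewrite !gX -/(Q (s1 ++ s2) (c 1)) -/(Q (s1 ++ s2) (c (-1))) -/(Q s1 a1) -/(Q s2 a2).
  rewrite q1 q2 opprD mulrDl expRD -mulrDl cosD cosB.
  by field.
have step1 a2 b2 :
    Ex P (fun x => cos (\sum_(j <- s2) a2 j * X j x + b2) *
                   \prod_(j <- s1) g j (X j x)) =
    Ex P (fun x => cos (\sum_(j <- s2) a2 j * X j x + b2)) *
    Ex P (fun x => \prod_(j <- s1) g j (X j x)).
  (* Independence is read as equality of two weighted expectations, the second weight being the
     constant mean of the first. *)
  rewrite -ExZ//; apply: (@eq_Ex_prod_stepf _ _ T T R P P J s1 X X g) => //.
    exact: bmf_cst.
  by move=> a1 b1; rewrite ExZ// cos2.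
rewrite -ExZ//; apply: (@eq_Ex_prod_stepf _ _ T T R P P J s2 X X g) => //.
  exact: bmf_cst.
by move=> a2 b2; rewrite ExZ// mulrC -step1; apply: eq_Ex => x; rewrite mulrC.
Qed.

End gaussian_independence.

(** * Bivariate normal pairs *)

Section bivariate_normal.
Context {R : realType}.
Local Notation N2 := ((normal_prob (0 : R) 1 \x normal_prob (0 : R) 1)%E).
Local Notation R2 := (measurableTypeR R * measurableTypeR R)%type.

Lemma Ex_prod_mul d1 d2 (T1 : measurableType d1) (T2 : measurableType d2)
    (P1 : probability T1 R) (P2 : probability T2 R) (f : T1 -> R) (g : T2 -> R) :
  bmf f -> bmf g ->
  Ex (P1 \x P2)%E (fun z => f z.1 * g z.2) = Ex P1 f * Ex P2 g.
Proof.
move=> bf bg.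
have bfg : bmf (fun z : T1 * T2 => f z.1 * g z.2).
  by apply: bmfM; split; [exact: (measurableT_comp bf.1)|
     have [M h] := bf.2; exists M => z; exact: h|
     exact: (measurableT_comp bg.1)|have [M h] := bg.2; exists M => z; exact: h].
rewrite /Ex {1}/Rintegral -integral12_prod_meas1; last exact: bmf_integrable.
rewrite -[RHS]/(_ * _).
transitivity (Ex P1 (fun x => f x * Ex P2 g)).
  rewrite /Ex /Rintegral; congr fine; apply: eq_integral => x _.
  rewrite /fubini_F/=; under eq_integral do rewrite EFinM.
  rewrite integralZl//; last exact: bmf_integrable.
  by rewrite EFinM fineK//; apply: integrable_fin_num => //; exact: bmf_integrable.
under eq_Ex do rewrite mulrC.
by rewrite ExZ// mulrC.
Qed.

(** Addition formula and independence of the coordinates; the product of sines drops out because the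
    sine transform of a centered normal law vanishes. *)
Lemma Ex_cos_N2 (a1 a2 b : R) :
  Ex N2 (fun z : R2 => cos (a1 * z.1 + a2 * z.2 + b)) =
  cos b * expR (- (a1 ^+ 2 + a2 ^+ 2) / 2).
Proof.
have n1 : (1 : R) != 0 by exact: oner_neq0.
have bc u v : bmf (T := measurableTypeR R) (fun x => cos (u * x + v)).
  by split; [exact: measurable_cos_affine | exists 1 => x; exact: cos_max].
have sE (u : R) : sin u = cos (u - pi / 2).
  by rewrite -{1}(subrK (pi / 2) u) sinDpihalf.
have bp u v u' v' : bmf (T := R2) (fun z => cos (u * z.1 + v) * cos (u' * z.2 + v')).
  by apply: bmfM; split; [exact: (measurableT_comp (bc u v).1)|
     exists 1 => z; exact: cos_max|
     exact: (measurableT_comp (bc u' v').1)| exists 1 => z; exact: cos_max].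
transitivity (Ex N2 (fun z : R2 => cos (a1 * z.1 + 0) * cos (a2 * z.2 + b)) -
   Ex N2 (fun z : R2 => cos (a1 * z.1 + - (pi / 2)) * cos (a2 * z.2 + (b - pi / 2)))).
  rewrite -ExB//; apply: eq_Ex => z.
  by rewrite -addrA cosD addr0 !sE addrA.
have h u v u' v' : Ex N2 (fun z : R2 => cos (u * z.1 + v) * cos (u' * z.2 + v')) =
    Ex (normal_prob 0 1) (fun x => cos (u * x + v)) *
    Ex (normal_prob 0 1) (fun x => cos (u' * x + v')).
  exact: (Ex_prod_mul (normal_prob 0 1) (normal_prob 0 1) (bc u v) (bc u' v')).
rewrite !h.
rewrite !Ex_cos_normal// cosN cos_pihalf !mul0r subr0 cos0 expr1n !mul1r.
by rewrite mulrCA -expRD; congr (_ * expR _); field.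
Qed.

Lemma bivariate_gaussian_cosines (rho : R) : -1 <= rho <= 1 ->
  gaussian_cosines N2
    (fun (j : bool) (z : R2) => if j then rho * z.1 + Num.sqrt (1 - rho ^+ 2) * z.2
                                else z.1)
    (fun j k => if j == k then 1 else rho).
Proof.
move=> rho1 s a b; set r := Num.sqrt _.
have r2 : r ^+ 2 = 1 - rho ^+ 2 by rewrite sqr_sqrtr//; nra.
pose A0 := \sum_(j <- s | ~~ j) a j; pose A1 := \sum_(j <- s | j) a j.
have sE (F : bool -> R) : \sum_(j <- s) a j * F j = A0 * F false + A1 * F true.
  rewrite (bigID id)/= addrC /A0 /A1 !mulr_suml; congr (_ + _).
    by apply: eq_bigr => -[].
  by apply: eq_bigr => -[].
rewrite (@eq_Ex _ _ _ _ _ (fun z : R2 => cos ((A0 + A1 * rho) * z.1 + (A1 * r) * z.2 + b))).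
  rewrite Ex_cos_N2; congr (_ * expR (- _ / 2)).
  transitivity (\sum_(j <- s) a j * (A0 * (if j == false then 1 else rho) +
      A1 * (if j == true then 1 else rho))).
    by rewrite sE /= exprMn r2; ring.
  apply: eq_bigr => j _; under [RHS]eq_bigr do rewrite -mulrA.
  by rewrite -mulr_sumr (sE (fun k => if j == k then 1 else rho)).
move=> z; congr cos; rewrite (sE (fun j => if j then _ else _))/=; ring.
Qed.

Lemma rho_tilde_stepf (c0 c1 rho : R) :
  rho_tilde (Phibar c0) (Phibar c1) rho =
  Ex N2 (fun z : R2 => (1 - (z.1 < c0)%R%:R) *
      (1 - (rho * z.1 + Num.sqrt (1 - rho ^+ 2) * z.2 < c1)%R%:R))
  - Phibar c0 * Phibar c1.
Proof.
rewrite /rho_tilde !PhibarK; congr (_ - _).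
set r := Num.sqrt _.
have m1 : measurable_fun [set: R2] (fun z : R2 => z.1) by exact: measurable_fst.
have m2 : measurable_fun [set: R2] (fun z : R2 => rho * z.1 + r * z.2).
  by apply: measurable_funD; apply: measurable_funM => //; exact: measurable_snd.
pose B (z : R2) := (c0 <= z.1) && (c1 <= rho * z.1 + r * z.2).
have mB : measurable [set z | B z].
  have -> : [set z | B z] = ~` ((fun z : R2 => z.1) @^-1` `]-oo, c0[ `|`
      (fun z : R2 => rho * z.1 + r * z.2) @^-1` `]-oo, c1[).
    apply/seteqP; split => z /=; rewrite /B !in_itv/= !ltNge => h.
      by move=> [|] /negP; case/andP: h.
    by apply/andP; split; apply/negPn/negP => hn; apply: h; [left|right].
  apply: measurableC; apply: measurableU.
    by rewrite -[_ @^-1` _]setTI; apply: m1.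
  by rewrite -[_ @^-1` _]setTI; apply: m2.
transitivity (Ex N2 (fun z : R2 => (B z)%:R)).
  rewrite (Ex_ind N2 mB) (_ : [set z : R * R | _ /\ _] = [set z | B z]); first by [].
  by apply/seteqP; split => z /=; rewrite /B !lee_fin => /andP.
apply: eq_Ex => z.
by rewrite /B !ltNge; do 2 case: (_ <= _); rewrite /= ?subr0 ?subrr ?mulr0 ?mul0r ?mulr1.
Qed.

End bivariate_normal.

(** * A central limit theorem for iid finite-valued variables *)

Section taylor_bounds.
Context {R : realType}.

(** Each Taylor bound for sine and cosine below follows from the previous one by this form of the
    mean value theorem: the exponent rises by one and the factorials are given up. *)
Lemma mvt_origin (f f' : R -> R) (u : R) : (forall x : R, is_derive x 1 f (f' x)) ->
  exists2 c, `|c| <= `|u| & f u - f 0 = f' c * u.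
Proof.
move=> df.
have cf : continuous f.
  move=> x; apply: differentiable_continuous; apply/derivable1_diffP.
  by have := df x => -[].
have [u0|u0] := leP 0 u.
  have [|c /=] := MVT_segment u0 (fun x _ => df x).
    exact: continuous_subspaceT.
  rewrite in_itv/= subr0 => /andP[c0 cu] e; exists c => //.
  by rewrite !ger0_norm.
have [|c /=] := MVT_segment (ltW u0) (fun x _ => df x).
  exact: continuous_subspaceT.
rewrite in_itv/= sub0r => /andP[cu c0] e; exists c.
  by rewrite !ler0_norm ?lerN2// ltW.
by rewrite -opprB e mulrN opprK.
Qed.

Lemma norm_sin_le (u : R) : `|sin u| <= `|u|.
Proof.
have [c _] := mvt_origin u (fun x => is_derive_sin x).
by rewrite sin0 subr0 => ->; rewrite normrM ler_piMl// cos_max.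
Qed.

Lemma norm_cos_sub1_le (u : R) : `|cos u - 1| <= `|u| ^+ 2.
Proof.
have [c cu] := mvt_origin u (fun x => is_derive_cos x).
rewrite cos0 => ->; rewrite normrM normrN expr2 ler_wpM2r//.
exact: le_trans (norm_sin_le c) cu.
Qed.

Lemma norm_sin_sub_le (u : R) : `|sin u - u| <= `|u| ^+ 3.
Proof.
have d (x : R) : is_derive x 1 (fun x => sin x - x) (cos x - 1).
  exact: is_derive_eq.
have [c cu] := mvt_origin u d.
rewrite sin0 !subr0 => ->; rewrite normrM exprSr ler_wpM2r//.
rewrite (le_trans (norm_cos_sub1_le c))//.
by rewrite lerXn2r ?nnegrE.
Qed.

Lemma norm_cos_taylor2_le (u : R) : `|cos u - 1 + u ^+ 2 / 2| <= `|u| ^+ 4.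
Proof.
have d (x : R) : is_derive x 1 (fun x => cos x + x ^+ 2 / 2) (x - sin x).
  by apply: is_derive_eq; rewrite /GRing.scale/=; field.
have [c cu] := mvt_origin u d.
rewrite cos0 expr0n/= mul0r addr0 => e.
rewrite addrAC e normrM exprSr ler_wpM2r// distrC.
rewrite (le_trans (norm_sin_sub_le c))//.
by rewrite lerXn2r ?nnegrE.
Qed.

Lemma expRN_taylor1 (x : R) : 0 <= x -> `|expR (- x) - 1 + x| <= x ^+ 2.
Proof.
move=> x0; have h1 := expR_ge1Dx (- x); have h2 := expR_ge1Dx x.
have x1 : 0 < 1 + x by lra.
have h3 : expR (- x) <= (1 + x)^-1 by rewrite expRN lef_pV2 ?posrE// expR_gt0.
rewrite ler_norml; apply/andP; split; first by nra.
(* Since (1 + x) (1 - x + x^2) = 1 + x^3. *)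
have h4 : (1 + x)^-1 <= 1 - x + x ^+ 2.
  rewrite -[leLHS]mul1r ler_pdivrMr//.
  have := exprn_ge0 3 x0; rewrite !exprS expr0; nra.
by lra.
Qed.

End taylor_bounds.

Section iid_characteristic_function.
Import complex.
Import Normc.
Context {R : realType} (B : finType) (p Y : B -> R).
Hypotheses (p0 : forall b, 0 <= p b) (p1 : \sum_b p b = 1)
  (meanY : \sum_b p b * Y b = 0).

(** Complex numbers are used only in this section: for k independent copies the transform is a k-th
    power only in complex form. *)
Let e (u : R) : complex.complex R := Complex (cos u) (sin u).

Let eD u v : e (u + v) = e u * e v.
Proof. by rewrite /e cosD sinD; apply/eqP; rewrite eq_complex/= addrC (addrC (sin u * _)) eqxx/= ; apply/eqP; ring. Qed.

Let e0 : e 0 = 1.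
Proof. by rewrite /e cos0 sin0. Qed.

Let e_sum (I : Type) (s : seq I) (F : I -> R) :
  e (\sum_(i <- s) F i) = \prod_(i <- s) e (F i).
Proof. by apply: big_morph; [exact: eD|exact: e0]. Qed.

Let normc_e u : normc (e u) = 1.
Proof. by rewrite /e /= cos2Dsin2 sqrtr1. Qed.

Let rc (x : R) : complex.complex R := Complex x 0.

Let normc_rc x : normc (rc x) = `|x|.
Proof. by rewrite /rc/= expr0n/= addr0 sqrtr_sqr. Qed.

Let normc_le (x y : R) : normc (Complex x y) <= `|x| + `|y|.
Proof.
rewrite /= -[leRHS]ger0_norm ?addr_ge0// -sqrtr_sqr ler_wsqrtr//.
rewrite sqrrD !real_normK ?num_real// addrAC lerDl mulrn_wge0// mulr_ge0//.
Qed.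

Let normc_sum (I : Type) (s : seq I) (F : I -> complex.complex R) :
  normc (\sum_(i <- s) F i) <= \sum_(i <- s) normc (F i).
Proof.
elim: s => [|i s IH]; first by rewrite !big_nil normc0.
by rewrite !big_cons (le_trans (le_normcD _ _))// lerD2l.
Qed.

(** Telescoping inside the unit disc; it reduces the comparison of k-fold transforms to a single
    factor. *)
Let pow_sub (a b : complex.complex R) k : normc a <= 1 -> normc b <= 1 ->
  normc (a ^+ k - b ^+ k) <= k%:R * normc (a - b).
Proof.
move=> a1 b1; elim: k => [|k IH]; first by rewrite subrr normc0 mul0r.
have -> : a ^+ k.+1 - b ^+ k.+1 = a * (a ^+ k - b ^+ k) + (a - b) * b ^+ k.
  by rewrite !exprS; ring.
rewrite (le_trans (le_normcD _ _))// !normcM -natr1 mulrDl mul1r lerD//.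
  rewrite (le_trans _ IH)// ler_piMl//.
  by case: (_ - _) => x y /=; exact: sqrtr_ge0.
rewrite ler_piMr//; first by case: (_ - _) => x y /=; exact: sqrtr_ge0.
elim: k {IH} => [|k IH]; first by rewrite expr0 normc1.
rewrite exprS normcM mulr_ile1//; first by case: (b) => x y; exact: sqrtr_ge0.
by case: (_ ^+ _) => x y; exact: sqrtr_ge0.
Qed.

Let ReD (x y : complex.complex R) : Re (x + y) = Re x + Re y.
Proof. by case: x; case: y. Qed.

Let Re_rcM (x : R) z : Re (rc x * z) = x * Re z.
Proof. by case: z => u v /=; rewrite mul0r subr0. Qed.

Let Re_sum (I : Type) (s : seq I) (F : I -> complex.complex R) :
  Re (\sum_(i <- s) F i) = \sum_(i <- s) Re (F i).
Proof. by elim: s => [|i s IH]; rewrite ?big_nil// !big_cons ReD IH. Qed.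

Let rcM x y : rc (x * y) = rc x * rc y.
Proof. by apply/eqP; rewrite eq_complex/= !mulr0 !mul0r subr0 addr0 !eqxx. Qed.

Let rc_prod (I : Type) (s : seq I) (F : I -> R) :
  rc (\prod_(i <- s) F i) = \prod_(i <- s) rc (F i).
Proof. by apply: big_morph => //; exact: rcM. Qed.

Let phi t := \sum_b rc (p b) * e (t * Y b).

Lemma iid_cos_sum k (t be : R) :
  \sum_(f : {ffun 'I_k -> B}) (\prod_i p (f i)) * cos (t * (\sum_i Y (f i)) + be) =
  Re (e be * phi t ^+ k).
Proof.
have -> : phi t ^+ k = \prod_(i < k) phi t by rewrite prodr_const card_ord.
rewrite /phi bigA_distr_bigA/= mulr_sumr Re_sum; apply: eq_bigr => f _.
rewrite big_split/= -rc_prod -e_sum -mulr_sumr mulrCA Re_rcM -eD.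
by rewrite addrC.
Qed.

(** The one-copy transform and the Gaussian factor agree to second order, so they differ by
    O(|t|^3). The error is explicit and uniform in k, since k and t will both depend on m; with k of
    order m and t of order 1 / sqrt m it is O(1 / sqrt m). *)
Lemma iid_cos_clt : exists K, 0 <= K /\ forall k (t be : R), `|t| <= 1 ->
  `| \sum_(f : {ffun 'I_k -> B}) (\prod_i p (f i)) * cos (t * (\sum_i Y (f i)) + be)
     - cos be * expR (- (k%:R * t ^+ 2 * (\sum_b p b * Y b ^+ 2) / 2)) |
  <= k%:R * K * `|t| ^+ 3.
Proof.
pose v := \sum_b p b * Y b ^+ 2.
have v0 : 0 <= v by apply: sumr_ge0 => b _; rewrite mulr_ge0// sqr_ge0.
(* Third-order error of the sine and fourth-order error of the cosine; the term [v ^+ 2] of the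
   constant comes from the exponential. *)
pose M := \sum_b p b * (`|Y b| ^+ 3 + `|Y b| ^+ 4).
have M0 : 0 <= M.
  by apply: sumr_ge0 => b _; rewrite mulr_ge0// addr_ge0 ?exprn_ge0.
exists (M + v ^+ 2); split; first by rewrite addr_ge0 ?sqr_ge0.
move=> k t be t1; rewrite iid_cos_sum -/v.
pose psi := expR (- (t ^+ 2 * v / 2)).
have psi0 : 0 <= psi by exact: expR_ge0.
have psi1 : psi <= 1.
  by rewrite -expR0 ler_expR oppr_le0 divr_ge0// mulr_ge0// sqr_ge0.
have -> : cos be * expR (- (k%:R * t ^+ 2 * v / 2)) = Re (e be * rc psi ^+ k).
  have -> : rc psi ^+ k = rc (psi ^+ k).
    elim: k => [|k IH]; first by rewrite !expr0.
    by rewrite !exprS rcM IH.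
  have -> : expR (- (k%:R * t ^+ 2 * v / 2)) = psi ^+ k.
    by rewrite /psi -expRM_natl; congr expR; ring.
  by rewrite [e be * _]mulrC Re_rcM mulrC.
have Re_norm (z : complex.complex R) : `|Re z| <= normc z.
  by case: z => x y /=; rewrite -sqrtr_sqr ler_wsqrtr// lerDl sqr_ge0.
have -> : Re (e be * phi t ^+ k) - Re (e be * rc psi ^+ k) =
    Re (e be * (phi t ^+ k - rc psi ^+ k)).
  rewrite mulrBr; move: (_ * _) (_ * _) => [x1 y1] [x2 y2] //.
rewrite (le_trans (Re_norm _))// normcM normc_e mul1r.
have phi1 : normc (phi t) <= 1.
  rewrite (le_trans (normc_sum _ _))// -p1 ler_sum// => b _.
  by rewrite normcM normc_rc normc_e mulr1 ger0_norm.
rewrite (le_trans (pow_sub _ phi1 _))//; first by rewrite normc_rc ger0_norm.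
rewrite -mulrA ler_wpM2l//.
(* Both second-order parts equal 1 - t^2 v / 2, the linear one being zero by [meanY], so only Taylor
   remainders are left. *)
have -> : phi t - rc psi = \sum_b rc (p b) * Complex
    (cos (t * Y b) - 1 + (t * Y b) ^+ 2 / 2) (sin (t * Y b) - t * Y b)
    - rc (psi - 1 + t ^+ 2 * v / 2).
  have -> : \sum_b rc (p b) * Complex
    (cos (t * Y b) - 1 + (t * Y b) ^+ 2 / 2) (sin (t * Y b) - t * Y b) =
    phi t + \sum_b rc (p b) * Complex (- 1 + (t * Y b) ^+ 2 / 2) (- (t * Y b)).
    rewrite /phi -big_split/=; apply: eq_bigr => b _; rewrite -mulrDr; congr (_ * _).
    by rewrite /e; apply/eqP; rewrite eq_complex/= addrA !eqxx.
  have -> : \sum_b rc (p b) * Complex (- 1 + (t * Y b) ^+ 2 / 2) (- (t * Y b)) =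
      rc (- 1 + t ^+ 2 * v / 2).
    have cE (F1 F2 : B -> R) : \sum_b Complex (F1 b) (F2 b) =
        Complex (\sum_b F1 b) (\sum_b F2 b).
      elim/big_ind3 : _ => // x1 x2 [x3 x4] y1 y2 [y3 y4] [-> ->] [-> ->] //.
    transitivity (\sum_b Complex (p b * (-1 + (t * Y b) ^+ 2 / 2)) (p b * - (t * Y b))).
      apply: eq_bigr => b _; apply/eqP; rewrite eq_complex/= !mul0r subr0 addr0 !eqxx//.
    rewrite cE /rc; congr Complex.
      transitivity (\sum_b (- p b + t ^+ 2 / 2 * (p b * Y b ^+ 2))).
        by apply: eq_bigr => b _; rewrite exprMn; ring.
      by rewrite big_split/= sumrN p1 -mulr_sumr -/v; ring.
    transitivity (\sum_b (- t) * (p b * Y b)); first by apply: eq_bigr => b _; ring.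
    by rewrite -mulr_sumr meanY mulr0.
  move: (phi t) => [x y]; apply/eqP; rewrite eq_complex/=.
  by apply/andP; split; apply/eqP; ring.
rewrite (le_trans (le_normcD _ _))// normcN mulrDl lerD//.
  rewrite (le_trans (normc_sum _ _))// /M mulr_suml ler_sum// => b _.
  rewrite normcM normc_rc (ger0_norm (p0 b)) -[leRHS]mulrA; apply: ler_wpM2l => //.
  apply: (le_trans (normc_le _ _)).
  rewrite (le_trans (lerD (norm_cos_taylor2_le _) (norm_sin_sub_le _)))//.
  rewrite !normrM !exprMn mulrDl addrC lerD//; first by rewrite mulrC.
  rewrite mulrC ler_wpM2l ?exprn_ge0// exprS ler_piMl// exprn_ge0//.
rewrite normc_rc.
have x0 : 0 <= t ^+ 2 * v / 2 by rewrite divr_ge0// mulr_ge0// sqr_ge0.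
rewrite (le_trans (expRN_taylor1 x0))//.
rewrite -mulrA exprMn expr_div_n mulrC.
have t4 : (t ^+ 2) ^+ 2 <= `|t| ^+ 3.
  by rewrite -[t ^+ 2]real_normK ?num_real// -exprM exprS ler_piMl// exprn_ge0.
rewrite ler_pM ?divr_ge0 ?sqr_ge0//.
by rewrite ler_pdivrMr ?exprn_gt0// ler_peMr ?sqr_ge0//; lra.
Qed.

End iid_characteristic_function.

Lemma norm_cos_sub_le (R : realType) (a b : R) : `|cos a - cos b| <= `|a - b|.
Proof.
have df (x : R) : is_derive x 1 (fun x : R => cos (x + b)) (- sin (x + b)).
  have d1 : is_derive x 1 (fun x : R => x + b) 1 by apply: is_derive_eq; rewrite addr0.
  have d2 := is_derive_cos (x + b).
  have := @is_derive1_comp _ cos (fun x : R => x + b) x _ _ d2 d1.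
  by rewrite mulr1.
have [c _] := mvt_origin (a - b) df.
rewrite subrK add0r => ->; rewrite normrM normrN ler_piMl//.
by rewrite ler_norml sin_geN1 sin_le1.
Qed.

Lemma near_sqrt_ge (R : realType) (A : R) : \forall m \near \oo, A <= Num.sqrt m%:R.
Proof.
near=> m; have [A0|A0] := leP A 0; first exact: le_trans A0 (sqrtr_ge0 _).
rewrite -[A]ger0_norm; last exact: ltW.
rewrite -sqrtr_sqr ler_wsqrtr//.
by near: m; exact: nbhs_infty_ger.
Unshelve. all: end_near. Qed.

(** * Events of high probability *)

Section high_probability.
Context d (T : measurableType d) (R : realType) (Q : probability T R).
Implicit Types (E : nat -> T -> Prop) (e : R).

(* E need not be measurable: it only has to hold outside a small event. *)
Definition holds_outside e (E : T -> Prop) := exists b : T -> bool,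
  [/\ measurable [set x | b x], fine (Q [set x | b x]) <= e & forall x, ~~ b x -> E x].

Definition whp e E := \forall n \near \oo, holds_outside e (E n).

Lemma whpS e E E' : (\forall n \near \oo, forall x, E n x -> E' n x) ->
  whp e E -> whp e E'.
Proof.
move=> EE' hE; near=> n.
have [b [mb Qb hb]] : holds_outside e (E n) by near: n; exact: hE.
exists b; split => // x /hb; move: x; near: n; exact: EE'.
Unshelve. all: end_near. Qed.

Lemma whp_le e e' E : e <= e' -> whp e E -> whp e' E.
Proof.
move=> ee' hE; near=> n.
have [b [mb Qb hb]] : holds_outside e (E n) by near: n; exact: hE.
by exists b; split => //; exact: le_trans ee'.
Unshelve. all: end_near. Qed.

Lemma fine_measureU (A B : set T) : measurable A -> measurable B ->
  fine (Q (A `|` B)) <= fine (Q A) + fine (Q B).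
Proof.
move=> mA mB; rewrite -fineD ?fin_num_measure//.
apply: fine_le; rewrite ?fin_numD ?fin_num_measure//; first exact: measurableU.
exact: measureU2.
Qed.

Lemma whpI e e' E E' : whp e E -> whp e' E' -> whp (e + e') (fun n x => E n x /\ E' n x).
Proof.
move=> hE hE'; near=> n.
have [b [mb Qb hb]] : holds_outside e (E n) by near: n; exact: hE.
have [b' [mb' Qb' hb']] : holds_outside e' (E' n) by near: n; exact: hE'.
have bb : [set x | b x || b' x] = [set x | b x] `|` [set x | b' x].
  by apply/seteqP; split => x /=; [move=> /orP[]; [left|right]|move=> [->//|->]; rewrite ?orbT].
exists (fun x => b x || b' x); split.
- by rewrite bb; exact: measurableU.
- by rewrite bb (le_trans (fine_measureU _ _))// lerD.
- by move=> x; rewrite negb_or => /andP[/hb ? /hb' ?].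
Unshelve. all: end_near. Qed.

(** The list does not grow with n; the allowed probability is halved at each element. *)
Lemma whp_all (I : Type) (s : seq I) (F : I -> nat -> T -> Prop) :
  (forall i e, 0 < e -> whp e (F i)) ->
  forall e, 0 < e -> whp e (fun n x => foldr (fun i => and (F i n x)) True s).
Proof.
move=> hF; elim: s => [|i s IH] e e0 /=.
  near=> n; exists (fun=> false); split => //=.
    have -> : [set _ : T | false] = set0 by apply/seteqP; split.
    by [].
  have -> : [set _ : T | false] = set0 by apply/seteqP; split.
  by rewrite measure0/= ltW.
rewrite [e]splitr; apply: whpI; [apply: hF|apply: IH]; exact: divr_gt0.
Unshelve. all: end_near. Qed.

End high_probability.

Lemma prob_has_le d (T : measurableType d) (R : realType) (Q : probability T R)
    (I : Type) (s : seq I) (b : I -> T -> bool) :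
  (forall i, measurable [set x | b i x]) ->
  measurable [set x | has (b^~ x) s] /\
  fine (Q [set x | has (b^~ x) s]) <= \sum_(i <- s) fine (Q [set x | b i x]).
Proof.
move=> mb; elim: s => [|i s [ms IH]].
  have e0 : [set x | has (b^~ x) [::]] = set0 by apply/seteqP; split.
  by rewrite e0 big_nil measure0; split => //; exact: measurable0.
have -> : [set x | has (b^~ x) (i :: s)] = [set x | b i x] `|` [set x | has (b^~ x) s].
  by apply/seteqP; split => x /=; [move=> /orP[]; [left|right]|move=> [->//|->]; rewrite orbT].
split; first exact: measurableU.
by rewrite big_cons (le_trans (fine_measureU _ _ _))// lerD2l.
Qed.

(** Comparison with the telescoping terms 1 / l - 1 / (l + 1). *)
Lemma sum_inv_sqr_le (R : realType) (L n : nat) : (0 < L)%N -> (L <= n)%N ->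
  \sum_(L <= l < n) (l.+1%:R ^+ 2)^-1 <= L%:R^-1 :> R.
Proof.
move=> L0 Ln; apply: (@le_trans _ _ (\sum_(L <= l < n) ((- l.+1%:R^-1) - (- l%:R^-1)))).
  rewrite big_nat [leRHS]big_nat; apply: ler_sum => l /andP[Ll _].
  have l0 : 0 < l%:R :> R by rewrite ltr0n (leq_trans L0).
  have l10 : 0 < l.+1%:R :> R by rewrite ltr0n.
  rewrite opprK addrC -[leRHS](_ : (l%:R * l.+1%:R)^-1 = _).
    by rewrite lef_pV2 ?posrE ?mulr_gt0 ?exprn_gt0// expr2 ler_pM2r// ler_nat.
  rewrite mulrS; field; rewrite -mulrS.
  by rewrite !gt_eqF.
rewrite telescope_sumr// opprK addrC gerBl.
by rewrite invr_ge0.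
Qed.

(** * Replacing a sequence by an asymptotically equivalent one *)

Section slutsky.
Context d (T : measurableType d) (R : realType) (Q : probability T R).
Variables X Z : nat -> T -> R.
Hypotheses (mX : forall n, measurable_fun [set: T] (X n))
  (mZ : forall n, measurable_fun [set: T] (Z n)).
Hypothesis XZ : forall e : R, 0 < e -> whp Q e (fun n x => `|X n x - Z n x| <= e).

Let mcos (Y : T -> R) (a be : R) : measurable_fun [set: T] Y ->
  bmf (fun x => cos (a * Y x + be)).
Proof.
by move=> mY; apply: bmf_cos; apply: measurable_funD => //; apply: measurable_funM.
Qed.

Lemma slutsky_cos a be (l : R) :
  Ex Q (fun x => cos (a * Z n x + be)) @[n --> \oo] --> l ->
  Ex Q (fun x => cos (a * X n x + be)) @[n --> \oo] --> l.
Proof.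
move=> /cvgrPdist_le Zl; apply/cvgrPdist_le => e e0.
(* Cosine is 1-Lipschitz, which costs [|a| * dl]; on the exceptional event, of probability at most
   [dl], the difference is at most 2. *)
pose dl := e / 2 / (`|a| + 2).
have a2 : 0 < `|a| + 2 by rewrite ltr_wpDl.
have e2 : 0 < e / 2 by rewrite divr_gt0.
have dl0 : 0 < dl by rewrite divr_gt0.
have de : (`|a| + 2) * dl = e / 2 by rewrite /dl mulrC divfK// gt_eqF.
near=> n.
have [b [mb Qb hb]] : holds_outside Q dl (fun x => `|X n x - Z n x| <= dl).
  by near: n; exact: XZ.
have hZ : `|l - Ex Q (fun x => cos (a * Z n x + be))| <= e / 2 by near: n; exact: Zl.
have hX : `|Ex Q (fun x => cos (a * Z n x + be)) - Ex Q (fun x => cos (a * X n x + be))| <= e / 2.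
  pose D x := cos (a * Z n x + be) - cos (a * X n x + be).
  pose bd x : R := `|a| * dl + 2 * (b x)%:R.
  have bD : bmf D by apply: bmfB; exact: mcos.
  have b1 : bmf (fun x => (b x)%:R : R) by exact: bmf_ind.
  have b2 : bmf (fun x => 2 * (b x)%:R : R) by apply: bmfM => //; exact: bmf_cst.
  have bbd : bmf bd by apply: bmfD => //; exact: bmf_cst.
  have Dle x : `|D x| <= bd x.
    rewrite /bd /D; have [bx|/negP nb] := boolP (b x).
      have adl : 0 <= `|a| * dl by apply: mulr_ge0 => //; exact: ltW dl0.
      have h := ler_normB (cos (a * Z n x + be)) (cos (a * X n x + be)).
      have h1 := cos_max (a * Z n x + be); have h2 := cos_max (a * X n x + be).
      by rewrite mulr1; lra.
    rewrite mulr0 addr0 (le_trans (norm_cos_sub_le _ _))// opprD addrACA subrr addr0.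
    rewrite -mulrBr normrM ler_wpM2l// distrC hb//; exact/negP.
  have Ebd : Ex Q bd <= e / 2.
    rewrite ExD//; last exact: bmf_cst.
    have -> : e / 2 = `|a| * dl + 2 * dl by rewrite -mulrDl.
    by rewrite Ex_cst ExZ// Ex_ind// lerD2l ler_wpM2l.
  rewrite -ExB; [|exact: mcos|exact: mcos]; rewrite ler_norml; apply/andP; split.
    rewrite (@le_trans _ _ (- Ex Q bd)) ?lerN2//.
    rewrite -mulN1r -ExZ//; apply: le_Ex => //.
      by apply: bmfM => //; exact: bmf_cst.
    by move=> x; rewrite mulN1r; have := Dle x; rewrite ler_norml => /andP[].
  rewrite (@le_trans _ _ (Ex Q bd))//; apply: le_Ex => // x.
  by have := Dle x; rewrite ler_norml => /andP[].
rewrite -(subrK (Ex Q (fun x => cos (a * Z n x + be))) l) -addrA.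
by rewrite (le_trans (ler_normD _ _))// [leRHS](splitr e) lerD.
Unshelve. all: end_near. Qed.

Lemma slutsky_tight :
  (forall e : R, 0 < e -> exists L : R, \forall n \near \oo,
     fine (Q [set x | L < `|Z n x|]) <= e) ->
  (forall e : R, 0 < e -> exists L : R, \forall n \near \oo,
     fine (Q [set x | L < `|X n x|]) <= e).
Proof.
move=> Zt e e0; have e2 : 0 < e / 2 by rewrite divr_gt0.
have [L hL] := Zt _ e2; exists (L + e / 2); near=> n.
have [b [mb Qb hb]] : holds_outside Q (e / 2) (fun x => `|X n x - Z n x| <= e / 2).
  by near: n; exact: XZ.
have mn (Y : T -> R) c : measurable_fun [set: T] Y -> measurable [set x | c < `|Y x|].
  move=> mY; apply: (measurable_gtr_preimage c (X := fun x => `|Y x|)).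
  exact: measurableT_comp.
rewrite (@le_trans _ _ (fine (Q ([set x | b x] `|` [set x | L < `|Z n x|]))))//.
  apply: fine_le; rewrite ?fin_num_measure//; [exact: mn| |].
    by apply: measurableU => //; exact: mn.
  apply: le_measure; rewrite ?inE//; [exact: mn| |].
    by apply: measurableU => //; exact: mn.
  move=> x /= h; have [bx|nb] := boolP (b x); [by left|right].
  have := hb x nb; have := ler_normD (X n x - Z n x) (Z n x); rewrite subrK => h1 h2.
  by lra.
have mZn := mn _ L (mZ n).
rewrite (le_trans (fine_measureU _ _ _))// [leRHS](splitr e) lerD//.
by near: n.
Unshelve. all: end_near. Qed.

Lemma slutsky_cvg_normal (v x0 : R) : 0 <= v -> normal_law v [set x0] = 0%E ->
  (forall a be, Ex Q (fun x => cos (a * Z n x + be)) @[n --> \oo] -->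
     cos be * expR (- (a ^+ 2 * v / 2))) ->
  (forall e : R, 0 < e -> exists L : R, \forall n \near \oo,
     fine (Q [set x | L < `|Z n x|]) <= e) ->
  fine (Q [set x | X n x <= x0]) @[n --> \oo] --> fine (normal_law v [set` `]-oo, x0]]).
Proof.
move=> v0; rewrite /normal_law; case: eqP => [->|/eqP vn0] hx0 cZ tZ.
  apply: (@levy_cvg_cdf _ _ _ (fun=> Q) X (@dirac _ (measurableTypeR R) (0 : R) R)) => //.
    move=> a be; rewrite [X in _ --> X](_ : _ = cos be * expR (- (a ^+ 2 * 0 / 2))).
      exact: slutsky_cos.
    rewrite mulr0 mul0r oppr0 expR0 mulr1 /Ex /Rintegral integral_dirac//=.
      by rewrite indicE in_setT mul1r mulr0 add0r.
    apply/measurable_EFinP; exact: measurable_cos_affine.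
  exact: slutsky_tight.
apply: (@levy_cvg_cdf _ _ _ (fun=> Q) X (normal_prob 0 (Num.sqrt v))) => //.
  move=> a be; rewrite Ex_cos_normal; last first.
    by rewrite sqrtr_eq0 -ltNge lt_neqAle eq_sym vn0.
  rewrite [X in cos be * expR (- (X / 2))](_ : _ = a ^+ 2 * v); last by rewrite sqr_sqrtr// mulrC.
  exact: slutsky_cos.
exact: slutsky_tight.
Qed.

End slutsky.

(** * The Benjamini-Hochberg procedure *)

Section benjamini_hochberg_counts.
Context {R : realType} (q : R) (m : nat) (p : 'I_m -> R).
Hypotheses (q0 : 0 < q) (m0 : (0 < m)%N).

Definition count_le (t : R) : nat := #|[pred i | p i <= t]|.

Local Notation crit j := (j%:R * q / m%:R).
Local Notation rejections := (BH_R q p).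

Lemma count_le_max t : (count_le t <= m)%N.
Proof. by rewrite -[leqRHS]card_ord max_card. Qed.

Lemma count_le_homo s t : s <= t -> (count_le s <= count_le t)%N.
Proof.
by move=> st; apply/subset_leq_card/fintype.subsetP => i; rewrite !inE => /le_trans; exact.
Qed.

Lemma order_stat_le j t : (0 < j <= m)%N -> (order_stat p j <= t) = (j <= count_le t)%N.
Proof.
case: j => // j /= jm; rewrite /order_stat/=.
set s := [seq p i | i <- enum 'I_m].
have sz : size (sort <=%R s) = m by rewrite size_sort size_map size_enum_ord.
have -> : count_le t = count (<= t) (sort <=%R s).
  rewrite (permP (_ : perm_eq (sort <=%R s) s)) ?perm_sort// count_map -size_filter.
  rewrite /count_le cardE; congr size; rewrite enumT; apply: eq_filter => i.
  by rewrite inE.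
have ss : sorted <=%R (sort <=%R s) by apply: sort_sorted; exact: le_total.
apply/idP/idP => [|h]; last exact: nth_count_le.
apply: contraTT; rewrite -leqNgt -ltNge => h; apply: nth_count_gt => //.
by rewrite h sz.
Qed.

Lemma le_crit j k : (j <= k)%N -> crit j <= crit k.
Proof.
by move=> jk; rewrite ler_wpM2r ?invr_ge0// ler_wpM2r ?ler_nat// ltW.
Qed.

Lemma BH_R_max : (rejections <= m)%N.
Proof. by apply/bigmax_leqP => j _; rewrite -ltnS. Qed.

Lemma BH_R_ge j : (j <= m)%N -> (j <= count_le (crit j))%N -> (j <= rejections)%N.
Proof.
case: j => // j jm h; have jm' : (j.+1 < m.+1)%N by [].
apply: (@leq_bigmax_cond _ (fun j : 'I_m.+1 => (order_stat p j <= crit j)%R) (fun j : 'I_m.+1 => (j : nat)) (Ordinal jm')).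
by rewrite /= order_stat_le.
Qed.

Lemma BH_R_attained : order_stat p rejections <= crit rejections.
Proof.
have h0 : (0 < #|[pred j : 'I_m.+1 | (order_stat p j <= crit j)%R]|)%N.
  by apply/card_gt0P; exists ord0; rewrite inE /order_stat/= !mul0r.
have [j] := eq_bigmax_cond (fun j : 'I_m.+1 => (j : nat)) h0.
by rewrite inE => hj; rewrite /BH_R => ->.
Qed.

(** The number of p-values below [crit rejections] is itself an admissible j, since critical values
    increase with j; maximality of the number of rejections then excludes a strict inequality. *)
Lemma count_le_BH_R : count_le (crit rejections) = rejections.
Proof.
have le1 : (rejections <= count_le (crit rejections))%N.
  have [->//|R0] := posnP rejections.
  by rewrite -order_stat_le ?BH_R_attained// R0 BH_R_max.
apply/eqP; rewrite eqn_leq le1 andbT; apply: BH_R_ge; first exact: count_le_max.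
by apply: count_le_homo; exact: le_crit.
Qed.

(** With j the count at [t], the assumption says t <= crit j, so j is admissible and at most the
    number of rejections. *)
Lemma le_crit_BH_R t : m%:R * (t / q) <= (count_le t)%:R -> t <= crit rejections.
Proof.
move=> h; have tc : t <= crit (count_le t).
  rewrite ler_pdivlMr ?ltr0n// -ler_pdivrMr//.
  by apply: le_trans h; rewrite mulrA [m%:R * t]mulrC.
apply: (le_trans tc); apply: le_crit; apply: BH_R_ge; first exact: count_le_max.
exact: count_le_homo.
Qed.

(** The procedure cuts at the largest rejected p-value, the asymptotic analysis at the critical
    value. The two rejection sets are nested and have the same cardinality, hence coincide. *)
Lemma BH_V_crit (H : 'I_m -> bool) :
  BH_V q p H = #|[pred i | (p i <= crit rejections) && ~~ H i]|.
Proof.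
suff h i : (p i <= BH_tau q p) = (p i <= crit rejections).
  by apply: eq_card => i; rewrite !inE h.
rewrite /BH_tau; have [R0|R0] := posnP rejections.
  by rewrite R0 /order_stat/= !mul0r.
have Rm : (0 < rejections <= m)%N by rewrite R0 BH_R_max.
have sub : [pred i | p i <= order_stat p rejections] \subset
    [pred i | p i <= crit rejections].
  by apply/fintype.subsetP => k; rewrite !inE => /le_trans; apply; exact: BH_R_attained.
have c1 : (rejections <= count_le (order_stat p rejections))%N by rewrite -order_stat_le.
have ec : #|[pred i | p i <= order_stat p rejections]| = #|[pred i | p i <= crit rejections]|.
  by apply/eqP; rewrite eqn_leq subset_leq_card//= -/(count_le _) count_le_BH_R.
have := subset_cardP ec sub => /(_ i).
by rewrite !inE.
Qed.

End benjamini_hochberg_counts.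

(** Only finitely many comparisons of p-values with critical values enter the procedure, which is
    what makes it measurable without any study of sorting. *)
Lemma FDP_congr (R : realType) (q : R) (m : nat) (p p' : 'I_m -> R) (H H' : 'I_m -> bool) :
  0 < q -> (0 < m)%N ->
  (forall (j : 'I_m.+1) i, (p i <= j%:R * q / m%:R) = (p' i <= j%:R * q / m%:R)) ->
  H =1 H' -> FDP q p H = FDP q p' H'.
Proof.
move=> q0 m0 pp' HH'.
have cc (j : 'I_m.+1) : count_le p (j%:R * q / m%:R) = count_le p' (j%:R * q / m%:R).
  by apply: eq_card => i; rewrite !inE pp'.
have RR : BH_R q p = BH_R q p'.
  apply: eq_bigl => j; case: j (cc j) => -[|j] jm /= ccj; first by rewrite /order_stat/= !mul0r.
  by rewrite !order_stat_le// ccj.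
rewrite /FDP RR !BH_V_crit// RR; congr (_%:R / _); apply: eq_card => i; rewrite !inE HH'.
have Rm : (BH_R q p' < m.+1)%N by rewrite ltnS BH_R_max.
by rewrite (pp' (Ordinal Rm)).
Qed.

(** * Measurability of the false discovery proportion *)

Section measurability.
Context d (T : measurableType d) (R : realType).

Lemma measurable_finite_code (D : finType) (code : T -> D) (f : T -> R) :
  (forall u, measurable [set x | code x == u]) ->
  (forall x y, code x = code y -> f x = f y) -> measurable_fun [set: T] f.
Proof.
move=> mcode fcode; pose F u := f (xget point [set x | code x = u]).
have fE : f = fun x => \sum_u F u * (code x == u)%:R.
  apply/funext => x; rewrite (bigD1 (code x))//= eqxx mulr1 big1 ?addr0.
    have h : [set y | code y = code x] (xget point [set y | code y = code x]).
      by apply: xgetPex; exists x.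
    by rewrite /F; apply: fcode; exact: esym h.
  by move=> u; rewrite eq_sym => /negbTE ->; rewrite mulr0.
rewrite fE; apply: measurable_sum => u; apply: measurable_funM => //.
exact: (@bmf_ind _ _ R (fun x => code x == u) (mcode u)).1.
Qed.

Lemma measurable_FDP (q : R) (m : nat) (p : T -> 'I_m -> R) (H : T -> 'I_m -> bool) :
  0 < q -> (forall i, measurable_fun [set: T] (p^~ i)) ->
  (forall i, measurable [set x | H x i]) ->
  measurable_fun [set: T] (fun x => FDP q (p x) (H x)).
Proof.
move=> q0 mp mH; have [m0|m0] := posnP m.
  subst m; rewrite (_ : (fun x => _) = fun=> FDP q (p point) (H point)).
    exact: measurable_cst.
  by apply/funext => x; congr (FDP q _ _); apply/funext => -[].
pose J := (('I_m.+1 * 'I_m) + 'I_m)%type.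
pose bit (k : J) x : bool := match k with
  | inl ji => p x ji.2 <= ji.1%:R * q / m%:R | inr i => H x i end.
pose code x : {ffun J -> bool} := [ffun k => bit k x].
have mbit k : measurable [set x | bit k x].
  by case: k => [[j i]|i]; [exact: measurable_ler_preimage|exact: mH].
apply: (@measurable_finite_code _ code).
  move=> u; rewrite (_ : [set x | _] = \bigcap_k [set x | bit k x = u k]).
    apply: fin_bigcap_measurable => [|k _]; first exact: finite_finset.
    case: (u k); first exact: mbit.
    rewrite (_ : [set x | _] = ~` [set x | bit k x]); first exact: measurableC.
    by apply/seteqP; split => x /=; [move=> ->|move=> /negP/negbTE].
  apply/seteqP; split => x /=; first by move=> /eqP <- k _ /=; rewrite ffunE.
  by move=> h; apply/eqP/ffunP => k; rewrite ffunE; exact: (h k I).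
move=> x y xy; have bxy k : bit k x = bit k y.
  by move/ffunP : xy => /(_ k); rewrite !ffunE.
apply: FDP_congr => // [j i|i]; first exact: (bxy (inl (j, i))).
exact: (bxy (inr i)).
Qed.

End measurability.

(* With Y = (1 + a) A0 + a A1, the fluctuation of the FDP is Y q / tau up to
   errors: summing the two expansions and using V0 + V1 = m t / q eliminates
   t - tau. *)
Lemma fdp_linearization (R : realType) (q tau t s v0 v1 v0' v1' A0 A1 E0 E1 V0 V1 k : R) :
  0 < q -> 0 < tau -> 0 < t -> 0 < s -> k = 1 / q - (v0' + v1') -> k != 0 ->
  v0 + v1 = tau / q ->
  V0 = s ^+ 2 * v0 + A0 + E0 + s ^+ 2 * v0' * (t - tau) ->
  V1 = s ^+ 2 * v1 + A1 + E1 + s ^+ 2 * v1' * (t - tau) ->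
  V0 + V1 = s ^+ 2 * (t / q) ->
  let a := (v0' - v0 / tau) / k in
  let Y := (1 + a) * A0 + a * A1 in
  s * (V0 / (s ^+ 2 * (t / q)) - q * v0 / tau) - q / tau * Y / s =
  q / s * (((1 + a) * E0 + a * E1) / t - (t - tau) / (t * tau) * Y).
Proof.
move=> q0 tau0 t0 s0 kE k0 vv hV0 hV1 hV a Y.
have sumE : A0 + A1 + E0 + E1 = s ^+ 2 * k * (t - tau).
  have -> : A0 + A1 + E0 + E1 = s ^+ 2 * (t / q) - s ^+ 2 * (v0 + v1)
      - s ^+ 2 * (v0' + v1') * (t - tau) by rewrite -hV hV0 hV1; ring.
  by rewrite vv kE; field; rewrite gt_eqF.
have key : (1 + a) * E0 + a * E1 =
    A0 + E0 + s ^+ 2 * (t - tau) * (v0' - v0 / tau) - Y.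
  have aE : a * (A0 + A1 + E0 + E1) = s ^+ 2 * (t - tau) * (v0' - v0 / tau).
    by rewrite sumE /a; field; rewrite k0 gt_eqF.
  by rewrite -aE /Y; ring.
rewrite key; clearbody Y; rewrite hV0; field.
by rewrite !gt_eqF.
Qed.

(** * Laws of the counts given W = w *)

Section conditional_model.
Context d (T : measurableType d) (R : realType) (P : probability T R).
Variables (pi1 rho1 rho2 : R) (sB : nat).
Hypotheses (hpi1 : 0 < pi1 < 1) (hsB : (0 < sB)%N) (hrho2 : -1 <= rho2 <= 1).
Variables (H : forall m, 'I_m -> {RV P >-> bool}) (W : {RV P >-> R})
  (eps : forall m, 'I_m -> {RV P >-> R}).
Hypothesis hmodel : one_factor_model H W eps pi1 sB rho2.
Variables (Q : probability T R).
Hypothesis hQ : forall m (A : 'I_m -> set bool) (B : 'I_m -> set R),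
  (forall i, measurable (A i)) -> (forall i, measurable (B i)) ->
  Q (noise_event H eps A B) = P (noise_event H eps A B).

Local Notation pr r := (pi_ pi1 r).

Lemma pi_ge0 r : 0 <= pr r.
Proof. by case/andP: hpi1 => /ltW ? /ltW ?; rewrite /pi_; case: r => //; lra. Qed.

Lemma pi_le1 r : pr r <= 1.
Proof. by case/andP: hpi1 => /ltW ? /ltW ?; rewrite /pi_; case: r => //; lra. Qed.

Lemma prob_H_eq m (i : 'I_m) r : P (H i @^-1` [set r]) = (pr r)%:E.
Proof.
have := model_H_law hmodel i [set r]; rewrite /distribution /pushforward => ->.
have h01 : 0 <= pi1 <= 1 by case/andP: hpi1 => /ltW -> /ltW ->.
rewrite bernoulli_probE// /pi_ /unstable.onem; case: r.
  by rewrite !diracE mem_set// memNset//= mule1 mule0 adde0.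
by rewrite !diracE memNset// mem_set//= mule1 mule0 add0e.
Qed.

Lemma prob_noise_event m (A : 'I_m -> set bool) (B : 'I_m -> set R) :
  (forall i, measurable (A i)) -> (forall i, measurable (B i)) ->
  Q (noise_event H eps A B) =
  ((\prod_i P (H i @^-1` A i)) * P [set x | forall i, B i (eps i x)])%E.
Proof.
move=> mA mB; rewrite hQ//.
have := model_indep hmodel mA mB (@measurableT _ R).
rewrite preimage_setT setIT => ->.
rewrite [X in (_ * _ * X)%E](_ : _ = 1%E); last exact: probability_setT.
by rewrite mule1 (model_H_indep hmodel).
Qed.

Lemma measurable_H m (i : 'I_m) (B : set bool) : measurable (H i @^-1` B).
Proof. by rewrite -[_ @^-1` _]setTI; apply: (measurable_funPT (H i)). Qed.

Lemma measurable_eps m (i : 'I_m) (b : R -> bool) :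
  measurable [set e | b e] -> measurable [set x | b (eps i x)].
Proof.
move=> mb; rewrite (_ : [set x | b (eps i x)] = eps i @^-1` [set e | b e])//.
by rewrite -[_ @^-1` _]setTI; apply: (measurable_funPT (eps i)).
Qed.

Lemma measurable_cell m (i : 'I_m) r (b : R -> bool) : measurable [set e | b e] ->
  measurable [set x | (H i x == r) && b (eps i x)].
Proof.
move=> mb; rewrite (_ : [set x | _] = (H i @^-1` [set r]) `&` [set x | b (eps i x)]).
  by apply: measurableI; [exact: measurable_H|exact: measurable_eps].
apply/seteqP; split => x /=; first by move=> /andP[/eqP].
by move=> [-> ->]; rewrite eqxx.
Qed.

Lemma bmf_cell m (i : 'I_m) r (b : R -> bool) : measurable [set e | b e] ->
  bmf (fun x => ((H i x == r) && b (eps i x))%:R : R).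
Proof. by move=> mb; apply: bmf_ind; exact: measurable_cell. Qed.

(** The passage from [Q] to [P]: the event is a [noise_event], whose probability factors into the
    Bernoulli weights and a purely Gaussian expectation. *)
Lemma Ex_prod_cells m (s : seq 'I_m) (r : 'I_m -> bool) (b : 'I_m -> R -> bool) :
  uniq s -> (forall i, measurable [set e | b i e]) ->
  Ex Q (fun x => \prod_(i <- s) ((H i x == r i) && b i (eps i x))%:R) =
  (\prod_(i <- s) pr (r i)) * Ex P (fun x => \prod_(i <- s) (b i (eps i x))%:R).
Proof.
move=> us mb.
(* Indices outside [s] are left unconstrained, so that the product rule over all indices applies. *)
pose A i : set bool := if i \in s then [set r i] else setT.
pose B i : set R := if i \in s then [set e | b i e] else setT.
have mA i : measurable (A i) by [].
have mB i : measurable (B i) by rewrite /B; case: ifP.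
have prod_all (F : 'I_m -> bool) : \prod_(i <- s) (F i)%:R = (all F s)%:R :> R.
  elim: {us A B mA mB} s => [|i s IH]; first by rewrite big_nil.
  by rewrite big_cons IH -natrM mulnb.
have mall (Q' : probability T R) (F : 'I_m -> T -> bool) :
    (forall i, measurable [set x | F i x]) -> measurable [set x | all (F^~ x) s].
  move=> mF; elim: {us A B mA mB prod_all} s => [|i s IH].
    by rewrite (_ : [set x | _] = setT); [exact: measurableT|apply/seteqP; split].
  rewrite (_ : [set x | _] = [set x | F i x] `&` [set x | all (F^~ x) s]).
    exact: measurableI.
  by apply/seteqP; split => x /=; [move=> /andP[]|move=> [-> ->]].
rewrite (@eq_Ex _ _ _ Q _ (fun x => (all (fun i => (H i x == r i) && b i (eps i x)) s)%:R));
  last by move=> x; rewrite prod_all.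
rewrite (@eq_Ex _ _ _ P _ (fun x => (all (fun i => b i (eps i x)) s)%:R));
  last by move=> x; rewrite prod_all.
rewrite Ex_ind; last by apply: (mall Q) => i; exact: measurable_cell.
rewrite Ex_ind; last by apply: (mall Q) => i; exact: measurable_eps.
have -> : [set x | all (fun i => (H i x == r i) && b i (eps i x)) s] =
    noise_event H eps A B.
  apply/seteqP; split => x /=.
    move=> /allP h; split => i; rewrite /A /B; case: ifP => // /h /andP[].
      by move=> /eqP.
    by [].
  move=> [hA hB]; apply/allP => i si; have := hA i; have := hB i.
  by rewrite /A /B si /= => -> ->; rewrite eqxx.
rewrite prob_noise_event//.
have -> : (\prod_i P (H i @^-1` A i))%E = (\prod_(i <- s) pr (r i))%:E.
  rewrite (big_uniq _ us)/= [X in _ = X%:E]big_mkcond/= (big_morph EFin EFinM erefl).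
  apply: eq_bigr => i _; rewrite /A; case: ifP => _; first exact: prob_H_eq.
  by rewrite preimage_setT probability_setT.
have -> : [set x | all (fun i => b i (eps i x)) s] = [set x | forall i, B i (eps i x)].
  apply/seteqP; split => x /=.
    by move=> /allP h i; rewrite /B; case: ifP => // /h.
  by move=> h; apply/allP => i si; have := h i; rewrite /B si.
rewrite fineM//= fin_num_measure//.
have -> : [set x | forall i, B i (eps i x)] = \bigcap_i (eps i @^-1` B i).
  by apply/seteqP; split => x /= h i; [move=> _; exact: h|exact: (h i I)].
apply: fin_bigcap_measurable => [|i _]; first exact: finite_finset.
by rewrite -[_ @^-1` _]setTI; apply: (measurable_funPT (eps i)).
Qed.

Lemma eps_gaussian m : is_gaussian_vector (@eps m) (block_corr sB rho2 m).
Proof. exact: (@model_eps_law _ _ _ _ _ _ _ _ _ _ hmodel m). Qed.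

Lemma measurable_eps_fun m (i : 'I_m) : measurable_fun [set: T] (eps i).
Proof. exact: measurable_funPT. Qed.

Lemma Ex_eps m (i : 'I_m) (g : R -> R) : stepf g ->
  Ex P (fun x => g (eps i x)) = Ex (normal_prob 0 1) g.
Proof.
move=> sg.
have g1 := gaussian_vector_cosines (@eps_gaussian m) (fun _ : unit => i).
have g2 : gaussian_cosines (normal_prob (0 : R) 1) (fun (_ : unit) (e : R) => e)
    (fun _ _ => block_corr sB rho2 m i i).
  move=> s a be.
  transitivity (Ex (normal_prob (0 : R) 1) (fun e => cos ((\sum_(j <- s) a j) * e + be))).
    by apply: eq_Ex => e; rewrite mulr_suml.
  rewrite Ex_cos_normal ?oner_neq0//; congr (_ * expR _).
  rewrite mxE eqxx expr1n mul1r -mulNr; congr (- _ / 2).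
  rewrite expr2 mulr_suml; apply: eq_bigr => j _.
  by rewrite mulr_sumr; apply: eq_bigr => k _; rewrite mulr1.
have h := @gaussian_same_law _ _ T (measurableTypeR R) R P (normal_prob (0 : R) 1) unit [:: tt]
  (fun _ => eps i) (fun _ e => e) _ (fun _ => g) isT
  (fun _ => measurable_eps_fun i) (fun _ => @measurable_id _ _ _) g1 g2 (fun _ => sg).
transitivity (Ex P (fun x => \prod_(j <- [:: tt]) g (eps i x))).
  by apply: eq_Ex => x; rewrite big_seq1.
by rewrite h; apply: eq_Ex => e; rewrite big_seq1.
Qed.

Lemma block_corr0 m (i j : 'I_m) : (i %/ sB != j %/ sB)%N ->
  block_corr sB rho2 m i j = 0.
Proof.
move=> ij; rewrite mxE (negbTE ij); case: eqP => // e.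
by rewrite e eqxx in ij.
Qed.

Lemma Ex_two_blocks m (i j : 'I_m) (g : R -> R) : (i %/ sB != j %/ sB)%N -> stepf g ->
  Ex P (fun x => g (eps i x) * g (eps j x)) = Ex (normal_prob 0 1) g ^+ 2.
Proof.
move=> ij sg.
have nij : i != j by apply: contraNneq ij => ->.
have g1 := gaussian_vector_cosines (@eps_gaussian m) id.
have h := @gaussian_independence _ T R P _ [:: i] [:: j] (fun k => eps k) _ (fun _ => g)
  _ (fun k => measurable_eps_fun k) g1 _ (fun _ => sg).
transitivity (Ex P (fun x => \prod_(k <- [:: i]) g (eps k x) * \prod_(k <- [:: j]) g (eps k x))).
  by apply: eq_Ex => x; rewrite !big_seq1.
rewrite h /=; last 2 first.
- by rewrite inE nij.
- move=> k l; rewrite !inE => /eqP -> /eqP ->; split; apply: block_corr0 => //.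
  by rewrite eq_sym.
have single k : Ex P (fun x => \prod_(l <- [:: k]) g (eps l x)) = Ex (normal_prob 0 1) g.
  by rewrite -(Ex_eps k sg); apply: eq_Ex => x; rewrite big_seq1.
by rewrite !single expr2.
Qed.

(** Within a block an index is determined by its residue modulo [sB]. *)
Lemma card_block m (i : 'I_m) : (#|[pred j : 'I_m | (i %/ sB == j %/ sB)%N]| <= sB)%N.
Proof.
pose f (j : 'I_m) : 'I_sB := Ordinal (ltn_pmod j hsB).
rewrite -[X in (_ <= X)%N]card_ord -(card_in_imset (f := f)) ?max_card//.
move=> j k; rewrite !inE => /eqP ej /eqP ek /(congr1 val)/= e.
by apply: val_inj; rewrite /= (divn_eq j sB) (divn_eq k sB) -ej -ek e.
Qed.

(** * Variance of the counts *)

Section cell_counts.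
Variables (r : bool) (b : R -> bool).
Hypotheses (mb : measurable [set e | b e]) (sb : stepf (fun e => (b e)%:R : R)).

(** The condition [b] stays general: a half-line counts p-values below t, a band those between s and
    t. *)
Definition cell_count m (x : T) : R := \sum_i ((H i x == r) && b (@eps m i x))%:R.

Definition cell_mean : R := pr r * Ex (normal_prob 0 1) (fun e => (b e)%:R).

Lemma Ex_cell m (i : 'I_m) :
  Ex Q (fun x => ((H i x == r) && b (eps i x))%:R) = cell_mean.
Proof.
have := @Ex_prod_cells m [:: i] (fun _ => r) (fun _ => b) isT (fun _ => mb).
under eq_Ex do rewrite big_seq1.
move=> ->; rewrite big_seq1 /cell_mean -(Ex_eps i sb); congr (_ * _).
by apply: eq_Ex => x; rewrite big_seq1.
Qed.

Lemma cell_mean_itv : 0 <= cell_mean <= 1.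
Proof.
apply/andP; split.
  by rewrite mulr_ge0 ?pi_ge0// Ex_ge0.
rewrite mulr_ile1 ?pi_ge0 ?pi_le1 ?Ex_ge0//.
rewrite -[leRHS](@Ex_cst _ _ _ (normal_prob (0 : R) 1) 1); apply: le_Ex.
- exact: (bmf_ind (T := measurableTypeR R)).
- exact: bmf_cst.
- by move=> x; case: (b x).
Qed.

(** Covariances across blocks vanish, and those within a block are at most the mean of one
    indicator, each index having at most [sB] partners. Being proportional to the mean, the bound is
    small for narrow bands. *)
Lemma cell_count_variance m :
  Ex Q (fun x => (cell_count m x - m%:R * cell_mean) ^+ 2) <= m%:R * sB%:R * cell_mean.
Proof.
pose A (i : 'I_m) x : R := ((H i x == r) && b (eps i x))%:R.
pose a := cell_mean.
have /andP[a0 a1] := cell_mean_itv.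
have bA i : bmf (A i) by exact: bmf_cell.
have bAa i : bmf (fun x => A i x - a) by apply: bmfB => //; exact: bmf_cst.
have -> : Ex Q (fun x => (cell_count m x - m%:R * a) ^+ 2) =
    \sum_i \sum_j Ex Q (fun x => (A i x - a) * (A j x - a)).
  transitivity (Ex Q (fun x => \sum_i \sum_j (A i x - a) * (A j x - a))).
    apply: eq_Ex => x.
    have -> : cell_count m x - m%:R * a = \sum_i (A i x - a).
      by rewrite big_split/= sumr_const card_ord mulNrn mulr_natl.
    by rewrite expr2 mulr_suml; apply: eq_bigr => i _; rewrite mulr_sumr.
  rewrite Ex_sum; last by move=> i _; apply: bmf_sum => j _; exact: bmfM.
  by apply: eq_bigr => i _; rewrite Ex_sum// => j _; exact: bmfM.
have covE i j : Ex Q (fun x => (A i x - a) * (A j x - a)) =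
    Ex Q (fun x => A i x * A j x) - a ^+ 2.
  transitivity (Ex Q (fun x => A i x * A j x - (a * (A i x + A j x) - a ^+ 2))).
    by apply: eq_Ex => x; ring.
  have bs : bmf (fun x => A i x + A j x) by exact: bmfD.
  have bas : bmf (fun x => a * (A i x + A j x)) by apply: bmfM => //; exact: bmf_cst.
  have bas2 : bmf (fun x => a * (A i x + A j x) - a ^+ 2).
    by apply: bmfB => //; exact: bmf_cst.
  rewrite (ExB Q (bmfM (bA i) (bA j)) bas2) (ExB Q bas (bmf_cst T _)) (ExZ Q _ bs).
  rewrite (ExD Q (bA i) (bA j)) Ex_cst !Ex_cell.
  by rewrite /a /cell_mean; ring.
have cov i j : Ex Q (fun x => (A i x - a) * (A j x - a)) <=
    a * (i %/ sB == j %/ sB)%N%:R.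
  rewrite covE; have [_|ij] := eqVneq (i %/ sB)%N (j %/ sB)%N.
    rewrite mulr1 -[leRHS](Ex_cell i) (@le_trans _ _ (Ex Q (fun x => A i x * A j x)))//.
      by rewrite lerBlDr lerDl sqr_ge0.
    apply: (le_Ex Q (bmfM (bA i) (bA j)) (bA i)) => x.
    by rewrite ler_piMr// /A; case: (_ && _).
  rewrite mulr0.
  have nij : i != j by apply: contraNneq ij => ->.
  have uij : uniq [:: i; j] by rewrite /= inE nij.
  have := @Ex_prod_cells m [:: i; j] (fun _ => r) (fun _ => b) uij (fun _ => mb).
  under eq_Ex do rewrite big_cons big_seq1.
  move=> ->; rewrite big_cons big_seq1; under eq_Ex do rewrite big_cons big_seq1.
  by rewrite (Ex_two_blocks ij sb) /a /cell_mean exprMn expr2 subrr.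
apply: (@le_trans _ _ (\sum_(i < m) sB%:R * a)); last first.
  by rewrite sumr_const card_ord -[_ *+ m]mulr_natl mulrA.
apply: ler_sum => i _.
apply: (@le_trans _ _ (\sum_(j < m) a * (i %/ sB == j %/ sB)%N%:R)).
  by apply: ler_sum => j _; exact: cov.
rewrite -mulr_sumr mulrC ler_wpM2r// -natr_sum ler_nat.
rewrite (leq_trans _ (card_block i))// -sum1_card [X in (_ <= X)%N]big_mkcond/=.
by apply: leq_sum => j _; rewrite inE; case: (_ == _).
Qed.

Lemma measurable_cell_count m : measurable_fun [set: T] (cell_count m).
Proof.
by apply: measurable_sum => i; apply: (bmf_cell _ _ _).1.
Qed.

Lemma cell_count_chebyshev m (y : R) : 0 < y ->
  fine (Q [set x | y <= `|cell_count m x - m%:R * cell_mean|]) <=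
  m%:R * sB%:R * cell_mean / y ^+ 2.
Proof.
move=> y0; pose D x := cell_count m x - m%:R * cell_mean.
have bD : bmf D.
  apply: bmfB; last exact: bmf_cst.
  by apply: bmf_sum => i _; exact: bmf_cell.
have mD : measurable [set x | y <= `|D x|] by exact: measurable_norm_ge bD.1.
rewrite -Ex_ind// ler_pdivlMr ?exprn_gt0// (le_trans _ (cell_count_variance m))//.
rewrite mulrC -ExZ; last exact: bmf_ind.
apply: le_Ex.
- by apply: bmfM; [exact: bmf_cst|exact: bmf_ind].
- exact: (bmfX 2 bD).
- move=> x; rewrite -/(D x).
  case: (leP y `|D x|) => h; last by rewrite mulr0 sqr_ge0.
  by rewrite mulr1 -[leRHS]real_normK ?num_real// lerXn2r ?nnegrE// ltW.
Qed.

End cell_counts.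

Lemma Ex_pair_same_block m (i j : 'I_m) (z0 z1 : R) : i != j -> (i %/ sB = j %/ sB)%N ->
  Ex P (fun x => (1 - (eps i x < z0)%R%:R) * (1 - (eps j x < z1)%R%:R)) =
  rho_tilde (Phibar z0) (Phibar z1) rho2 + Phibar z0 * Phibar z1.
Proof.
move=> ij sb; rewrite rho_tilde_stepf subrK.
pose f (b : bool) := if b then j else i.
pose g (b : bool) (e : R) : R := 1 + (-1) * (e < if b then z1 else z0)%R%:R.
have sg b : stepf (g b).
  by apply: stepf_add; [exact: stepf_cst|apply: stepf_scale; exact: stepf_ray].
have g1 := gaussian_vector_cosines (@eps_gaussian m) f.
have g2 := bivariate_gaussian_cosines hrho2.
have Ce : (fun b b' => block_corr sB rho2 m (f b) (f b')) =
    fun b b' => if b == b' then 1 else rho2.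
  apply/funext => b; apply/funext => b'; rewrite mxE.
  by case: b; case: b'; rewrite /f /= ?eqxx// ?(negbTE ij) ?[j == i]eq_sym ?(negbTE ij) ?sb eqxx.
rewrite Ce in g1.
have m2 b : measurable_fun [set: measurableTypeR R * measurableTypeR R]
    (fun z : R * R => if b then rho2 * z.1 + Num.sqrt (1 - rho2 ^+ 2) * z.2 else z.1).
  case: b; last exact: measurable_fst.
  apply: measurable_funD; apply: measurable_funM => //.
have h := gaussian_same_law (isT : uniq [:: false; true]) (fun b => measurable_eps_fun (f b)) m2
  g1 g2 sg.
transitivity (Ex P (fun x => \prod_(b <- [:: false; true]) g b (eps (f b) x))).
  by apply: eq_Ex => x; rewrite big_cons big_seq1 /g /f; ring.
rewrite h; apply: eq_Ex => z; rewrite big_cons big_seq1 /g /=; ring.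
Qed.

Lemma Ex_ray_normal (z : R) :
  Ex (normal_prob 0 1) (fun e : R => 1 - (e < z)%R%:R) = Phibar z.
Proof.
have mr : measurable ([set e : measurableTypeR R | e < z]).
  rewrite (_ : [set e | _] = `]-oo, z[%classic); first exact: measurable_itv.
  by apply/seteqP; split => x /=; rewrite in_itv.
rewrite ExB; [|exact: bmf_cst|exact: bmf_ind]; rewrite Ex_cst Ex_ind// /Phibar /Phi.
congr (1 - fine _).
rewrite (_ : [set e | e < z] = `]-oo, z[%classic); last first.
  by apply/seteqP; split => x /=; rewrite in_itv.
transitivity (\int[lebesgue_measure]_(x in [set` `]-oo, z[]) (normal_pdf 0 1 x)%:E)%E; first by [].
rewrite integral_itv_bndo_bndc//; apply/measurable_EFinP; apply: measurable_funTS.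
exact: measurable_normal_pdf.
Qed.

(** * Decomposition of the scores into iid blocks *)

Section block_decomposition.
Variables (cut coef : bool -> R).

Definition cell m (i : 'I_m) (x : T) : bool * bool := (H i x, cut (H i x) <= eps i x).

Definition score_mean : R := \sum_r coef r * (pr r * Phibar (cut r)).

(** Later [cut] is the cutoff at [tau_star], and [coef] is q / tau times 1 + alpha for nulls and
    times alpha for nonnulls. *)
Definition score (u : bool * bool) : R := coef u.1 * u.2%:R - score_mean.

Let bcell (u : bool * bool) (e : R) : bool := (cut u.1 <= e) == u.2.

Let cell_eq m (i : 'I_m) x u : (cell i x == u) = (H i x == u.1) && bcell u (eps i x).
Proof.
rewrite /cell /bcell; case: u => r c /=; rewrite xpair_eqE.
by case: eqP => //= ->.
Qed.

Let stepf_bcell u : stepf (fun e => (bcell u e)%:R : R).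
Proof.
rewrite /bcell; case: u.2.
  rewrite (_ : (fun e => _) = fun e => (cut u.1 <= e)%R%:R); first exact: stepf_coray.
  by apply/funext => e; rewrite eqb_id.
rewrite (_ : (fun e => _) = fun e => (e < cut u.1)%R%:R); first exact: stepf_ray.
by apply/funext => e; rewrite eqbF_neg -ltNge.
Qed.

Let measurable_bcell u : measurable [set e | bcell u e].
Proof.
have [mb _] := bmf_stepf (@measurable_id _ (measurableTypeR R) _) (stepf_bcell u).
rewrite (_ : [set e | bcell u e] = (fun e => (bcell u e)%:R : R) @^-1` [set 1]).
  by rewrite -[_ @^-1` _]setTI; apply: mb => //; exact: measurable_set1.
apply/seteqP; split => e /=; first by move=> ->.
by case: (bcell u e) => //= /eqP; rewrite eq_sym oner_eq0.
Qed.

Let bmf_cell_eq m (i : 'I_m) u : bmf (fun x => (cell i x == u)%:R : R).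
Proof.
rewrite (_ : (fun x => _) = fun x => ((H i x == u.1) && bcell u (eps i x))%:R).
  exact: bmf_cell.
by apply/funext => x; rewrite cell_eq.
Qed.

Lemma Ex_finite (D : finType) (X : T -> D) (F : D -> R) :
  (forall u, bmf (fun x => (X x == u)%:R : R)) ->
  Ex Q (fun x => F (X x)) = \sum_u Ex Q (fun x => (X x == u)%:R) * F u.
Proof.
move=> mX; transitivity (Ex Q (fun x => \sum_u F u * (X x == u)%:R)).
  apply: eq_Ex => x; rewrite (bigD1 (X x))//= eqxx mulr1 big1 ?addr0// => u.
  by rewrite eq_sym => /negbTE ->; rewrite mulr0.
rewrite Ex_sum; last by move=> u _; apply: bmfM; [exact: bmf_cst|exact: mX].
by apply: eq_bigr => u _; rewrite ExZ// mulrC.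
Qed.

Let ffun_eq_prod (I D : finType) (f g : {ffun I -> D}) :
  (f == g)%:R = \prod_i (f i == g i)%:R :> R.
Proof.
have [->|fg] := eqVneq f g; first by rewrite big1// => i _; rewrite eqxx.
have [i fgi] : exists i, f i != g i.
  apply/existsP; apply: contraNT fg; rewrite negb_exists => /forallP h.
  by apply/eqP/ffunP => i; apply/eqP; move: (h i); rewrite negbK.
by rewrite (bigD1 i)//= (negbTE fgi) mul0r.
Qed.

(** The array of size [sB] is one complete block; every complete block of any array has the law of
    this one. *)
Definition block_cells (x : T) : {ffun 'I_sB -> bool * bool} := [ffun j => @cell sB j x].

Definition block_law (f : {ffun 'I_sB -> bool * bool}) : R :=
  Ex Q (fun x => (block_cells x == f)%:R).

Definition block_score (f : {ffun 'I_sB -> bool * bool}) : R := \sum_j score (f j).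

Let bmf_block f : bmf (fun x => (block_cells x == f)%:R : R).
Proof.
rewrite (_ : (fun x => _) = fun x => \prod_j (@cell sB j x == f j)%:R).
  by apply: bmf_prod => j _; exact: bmf_cell_eq.
by apply/funext => x; rewrite ffun_eq_prod; apply: eq_bigr => j _; rewrite ffunE.
Qed.

Lemma block_lawE f : block_law f = (\prod_j pr (f j).1) *
  Ex P (fun x => \prod_j (bcell (f j) (@eps sB j x))%:R).
Proof.
rewrite /block_law -(@Ex_prod_cells sB (index_enum 'I_sB) (fun j => (f j).1)
  (fun j => bcell (f j)) (index_enum_uniq _) (fun j => measurable_bcell _)).
apply: eq_Ex => x; rewrite ffun_eq_prod; apply: eq_bigr => j _.
by rewrite ffunE cell_eq.
Qed.

Lemma big_nat_blocks (S : Type) (one : S) (op : Monoid.law one) (F : nat -> S) k :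
  \big[op/one]_(0 <= n < k * sB) F n =
  \big[op/one]_(b < k) \big[op/one]_(j < sB) F (j + b * sB)%N.
Proof.
elim: k => [|k IH]; first by rewrite mul0n big_geq// big_ord0.
rewrite big_ord_recr/= -IH mulSnr (big_cat_nat (n := (k * sB)%N))//= ?leq_addr//.
by congr (op _ _); rewrite -{1}[(k * sB)%N]add0n big_addn addKn big_mkord.
Qed.

Section one_sample_size.
Variables (m k : nat) (i0 : 'I_m).
Hypothesis km : (k * sB <= m)%N.

(** Numbering by naturals allows writing n = j + b * sB freely; the default [i0] is reached only for
    n >= m. *)
Definition idx (n : nat) : 'I_m := insubd i0 n.

Let val_idx n : (n < k * sB)%N -> idx n = n :> nat.
Proof. by move=> nk; rewrite val_insubd (leq_trans nk km). Qed.

Let blk_lt (b : nat) (j : 'I_sB) : (b < k)%N -> (j + b * sB < k * sB)%N.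
Proof.
move=> bk; apply: (@leq_trans (b.+1 * sB)); last by rewrite leq_mul2r bk orbT.
by rewrite mulSn ltn_add2r.
Qed.

(** Induction on the number of blocks: the last one is uncorrelated with all earlier ones, hence
    independent of them. *)
Lemma Ex_prod_blocks (g : nat -> R -> R) : (forall n, stepf (g n)) ->
  Ex P (fun x => \prod_(0 <= n < k * sB) g n (eps (idx n) x)) =
  \prod_(b < k) Ex P (fun x => \prod_(j < sB) g (j + b * sB)%N (eps (idx (j + b * sB)) x)).
Proof.
move=> sg; suff h l : (l <= k)%N ->
    Ex P (fun x => \prod_(0 <= n < l * sB) g n (eps (idx n) x)) =
    \prod_(b < l) Ex P (fun x => \prod_(j < sB) g (j + b * sB)%N (eps (idx (j + b * sB)) x)).
  exact: h.
elim: l => [|l IH] lk.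
  rewrite big_ord0 -[RHS](@Ex_cst _ _ _ P); apply: eq_Ex => x.
  by rewrite mul0n big_geq.
rewrite big_ord_recr/= -IH; last exact: ltnW.
pose s1 := index_iota 0 (l * sB); pose s2 := index_iota (l * sB) (l.+1 * sB).
have g1 := gaussian_vector_cosines (@eps_gaussian m) idx.
have us : uniq (s1 ++ s2).
  rewrite cat_uniq !iota_uniq andbT/=; apply/hasPn => n.
  by rewrite mem_index_iota => /andP[h _]; rewrite /= mem_index_iota /= -leqNgt.
have C0 : {in s1 & s2, forall a b : nat,
    block_corr sB rho2 m (idx a) (idx b) = 0 /\ block_corr sB rho2 m (idx b) (idx a) = 0}.
  move=> a b; rewrite !mem_index_iota => /andP[_ al] /andP[lb bl].
  have lk' : (l.+1 * sB <= k * sB)%N by rewrite leq_mul2r lk orbT.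
  have ab : (idx a %/ sB != idx b %/ sB)%N.
    rewrite !val_idx ?(leq_trans bl)//; last first.
      by rewrite (leq_trans al)// (leq_trans _ lk')// leq_mul2r leqnSn orbT.
    by rewrite neq_ltn (leq_trans (n := l)) ?leq_divRL// ltn_divLR.
  by split; apply: block_corr0; rewrite // eq_sym.
have := gaussian_independence us (fun n => measurable_eps_fun (idx n)) g1 C0 sg.
have -> : Ex P (fun x => \prod_(j <- s2) g j (eps (idx j) x)) =
    Ex P (fun x => \prod_(j < sB) g (j + l * sB)%N (eps (idx (j + l * sB)) x)).
  apply: eq_Ex => x; rewrite /s2 mulSnr -{1}[(l * sB)%N]add0n.
  by rewrite -[RHS](big_mkord xpredT (fun j => g (j + l * sB)%N (eps (idx (j + l * sB)) x)))
    -/(index_iota _ _) big_addn addKn.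
move=> <-; apply: eq_Ex => x.
by rewrite mulSnr (big_cat_nat (n := (l * sB)%N))//= ?leq_addr// /s2 mulSnr.
Qed.

(** Inside a block the correlation depends only on whether two positions coincide, so shifting by b
    * sB keeps the covariance kernel. *)
Lemma Ex_block_same (b : 'I_k) (g : 'I_sB -> R -> R) : (forall j, stepf (g j)) ->
  Ex P (fun x => \prod_(j < sB) g j (eps (idx (j + b * sB)) x)) =
  Ex P (fun x => \prod_(j < sB) g j (@eps sB j x)).
Proof.
move=> sg.
have g1 := gaussian_vector_cosines (@eps_gaussian m) (fun j : 'I_sB => idx (j + b * sB)).
have g2 := gaussian_vector_cosines (@eps_gaussian sB) id.
have Ce : (fun j j' : 'I_sB => block_corr sB rho2 m (idx (j + b * sB)) (idx (j' + b * sB))) =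
    fun j j' => block_corr sB rho2 sB j j'.
  apply/funext => j; apply/funext => j'; rewrite !mxE.
  have vi (l : 'I_sB) : idx (l + b * sB) = (l + b * sB)%N :> nat by rewrite val_idx ?blk_lt.
  rewrite -!val_eqE/= !vi eqn_add2r.
  by rewrite !divnDMl// !divn_small ?ltn_ord// !eqxx.
rewrite Ce in g1.
have h := gaussian_same_law (index_enum_uniq 'I_sB)
  (fun j : 'I_sB => measurable_eps_fun (idx (j + b * sB)))
  (fun j : 'I_sB => @measurable_eps_fun sB j) g1 g2 sg.
exact: h.
Qed.

Definition all_block_cells (x : T) : {ffun 'I_k -> {ffun 'I_sB -> bool * bool}} :=
  [ffun b : 'I_k => [ffun j : 'I_sB => cell (idx (j + b * sB)) x]].

Let all_block_eqE x D : (all_block_cells x == D)%:R =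
  \prod_(b < k) \prod_(j < sB) (cell (idx (j + b * sB)) x == D b j)%:R :> R.
Proof.
rewrite ffun_eq_prod; apply: eq_bigr => b _; rewrite ffunE ffun_eq_prod.
by apply: eq_bigr => j _; rewrite ffunE.
Qed.

Lemma all_block_law D :
  Ex Q (fun x => (all_block_cells x == D)%:R) = \prod_(b < k) block_law (D b).
Proof.
pose du (n : nat) : bool * bool :=
  if (insub (n %/ sB)%N : option 'I_k) is Some b then D b (Ordinal (ltn_pmod n hsB))
  else (true, true).
have duE (b : 'I_k) (j : 'I_sB) : du (j + b * sB)%N = D b j.
  rewrite /du divnDMl// divn_small// add0n valK; congr (D b _); apply: val_inj => /=.
  by rewrite addnC modnMDl modn_small.
pose s := [seq idx n | n <- index_iota 0 (k * sB)].
have us : uniq s.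
  rewrite map_inj_in_uniq ?iota_uniq// => a b.
  rewrite !mem_index_iota => /andP[_ ha] /andP[_ hb] /(congr1 val).
  by rewrite /= !val_idx.
have := @Ex_prod_cells m s (fun i : 'I_m => (du i).1) (fun i : 'I_m => bcell (du i)) us
  (fun i => measurable_bcell _).
have sE (F : 'I_m -> R) : \prod_(i <- s) F i = \prod_(0 <= n < k * sB) F (idx n).
  by rewrite big_map.
rewrite sE => h.
transitivity (Ex Q (fun x => \prod_(i <- s) ((H i x == (du i).1) && bcell (du i) (eps i x))%:R)).
  apply: eq_Ex => x; rewrite sE big_nat_blocks all_block_eqE.
  apply: eq_bigr => b _; apply: eq_bigr => j _.
  by rewrite val_idx ?blk_lt// duE cell_eq.
rewrite h big_nat_blocks.
under eq_Ex do rewrite sE.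
have -> : Ex P (fun x => \prod_(0 <= n < k * sB) (bcell (du (idx n)) (eps (idx n) x))%:R) =
    Ex P (fun x => \prod_(0 <= n < k * sB) (bcell (du n) (eps (idx n) x))%:R).
  apply: eq_Ex => x; rewrite big_nat [RHS]big_nat; apply: eq_bigr => n /andP[_ nk].
  by rewrite val_idx.
rewrite (@Ex_prod_blocks (fun n e => (bcell (du n) e)%:R))// -big_split/=.
apply: eq_bigr => b _; rewrite block_lawE; congr (_ * _).
  by apply: eq_bigr => j _; rewrite val_idx ?blk_lt// duE.
rewrite -(@Ex_block_same b (fun j e => (bcell (D b j) e)%:R))//.
by apply: eq_Ex => x; apply: eq_bigr => j _; rewrite duE.
Qed.

Lemma Ex_cos_blocks (t be : R) :
  Ex Q (fun x => cos (t * (\sum_(b < k) \sum_(j < sB) score (cell (idx (j + b * sB)) x)) + be)) =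
  \sum_(D : {ffun 'I_k -> {ffun 'I_sB -> bool * bool}})
    (\prod_b block_law (D b)) * cos (t * (\sum_b block_score (D b)) + be).
Proof.
transitivity (Ex Q (fun x => cos (t * (\sum_b block_score (all_block_cells x b)) + be))).
  apply: eq_Ex => x; congr (cos (_ * _ + _)); apply: eq_bigr => b _; rewrite ffunE.
  by apply: eq_bigr => j _; rewrite ffunE.
rewrite (@Ex_finite _ all_block_cells (fun D => cos (t * (\sum_b block_score (D b)) + be))).
  by apply: eq_bigr => D _; rewrite all_block_law.
move=> D; rewrite (_ : (fun x => _) = fun x => \prod_(b < k) \prod_(j < sB)
    (cell (idx (j + b * sB)) x == D b j)%:R); last exact/funext.
by apply: bmf_prod => b _; apply: bmf_prod => j _; exact: bmf_cell_eq.
Qed.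

End one_sample_size.

Lemma Ex_block_cells (F : {ffun 'I_sB -> bool * bool} -> R) :
  Ex Q (fun x => F (block_cells x)) = \sum_f block_law f * F f.
Proof. exact: Ex_finite bmf_block. Qed.

Lemma block_law_ge0 f : 0 <= block_law f.
Proof. by apply: Ex_ge0. Qed.

Lemma sum_block_law : \sum_f block_law f = 1.
Proof.
rewrite -[RHS](@Ex_cst _ _ _ Q) (Ex_block_cells (fun _ => 1)).
by apply: eq_bigr => f _; rewrite mulr1.
Qed.

Let exceed r m (i : 'I_m) x : R := ((H i x == r) && (cut r <= eps i x))%:R.

Let bmf_exceed r m (i : 'I_m) : bmf (exceed r i).
Proof. exact: (bmf_cell i r (measurable_coray (cut r))). Qed.

Let scoreE m (i : 'I_m) x :
  score (cell i x) = \sum_r coef r * exceed r i x - score_mean.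
Proof.
rewrite /score /cell /exceed big_bool/=; congr (_ - _).
by case: (H i x) => /=; rewrite ?mulr0 ?addr0 ?add0r.
Qed.

Lemma bmf_score m (i : 'I_m) : bmf (fun x => score (cell i x)).
Proof.
rewrite (_ : (fun x => _) = fun x => \sum_r coef r * exceed r i x - score_mean).
  apply: bmfB; last exact: bmf_cst.
  by apply: bmf_sum => r _; apply: bmfM; [exact: bmf_cst|exact: bmf_exceed].
by apply/funext => x; exact: scoreE.
Qed.

Lemma Ex_ge_normal (z : R) : Ex (normal_prob 0 1) (fun e : R => (z <= e)%R%:R) = Phibar z.
Proof.
rewrite -Ex_ray_normal; apply: eq_Ex => e.
by rewrite leNgt; case: (_ < _); rewrite /= ?subrr ?subr0.
Qed.

Let Ex_exceed r m (i : 'I_m) : Ex Q (exceed r i) = pr r * Phibar (cut r).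
Proof.
rewrite -Ex_ge_normal.
exact: (Ex_cell r (measurable_coray (cut r)) (stepf_coray (cut r)) i).
Qed.

Let Ex_exceed_mul r r' (j j' : 'I_sB) : j != j' ->
  Ex Q (fun x => exceed r j x * exceed r' j' x) =
  pr r * pr r' * (rho_tilde (Phibar (cut r)) (Phibar (cut r')) rho2 +
    Phibar (cut r) * Phibar (cut r')).
Proof.
move=> jj'.
have ujj' : uniq [:: j; j'] by rewrite /= inE jj'.
pose ri i := if i == j then r else r'.
have rj : ri j = r by rewrite /ri eqxx.
have rj' : ri j' = r' by rewrite /ri eq_sym (negbTE jj').
have := @Ex_prod_cells sB [:: j; j'] ri (fun i e => cut (ri i) <= e) ujj'
  (fun i => measurable_coray _).
under eq_Ex do rewrite big_cons big_seq1 rj rj'.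
rewrite -/(exceed _ _ _) => ->; rewrite big_cons big_seq1 rj rj'; congr (_ * _).
have same : (j %/ sB = j' %/ sB)%N by rewrite !divn_small.
rewrite -(Ex_pair_same_block _ _ jj' same); apply: eq_Ex => x.
rewrite big_cons big_seq1 rj rj'; congr (_ * _).
  by rewrite leNgt; case: (_ < _); rewrite /= ?subrr ?subr0.
by rewrite leNgt; case: (_ < _); rewrite /= ?subrr ?subr0.
Qed.

Let Ex_score m (i : 'I_m) : Ex Q (fun x => score (cell i x)) = 0.
Proof.
under eq_Ex do rewrite scoreE.
have b r : bmf (fun x => coef r * exceed r i x).
  by apply: bmfM; [exact: bmf_cst|exact: bmf_exceed].
rewrite ExB; [|by apply: bmf_sum|exact: bmf_cst].
rewrite Ex_cst Ex_sum// /score_mean; apply/eqP; rewrite subr_eq0; apply/eqP.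
by apply: eq_bigr => r _; rewrite ExZ// Ex_exceed.
Qed.

Lemma block_score_mean : \sum_f block_law f * block_score f = 0.
Proof.
rewrite -Ex_block_cells /block_score Ex_sum; last first.
  move=> j _; rewrite (_ : (fun x => _) = fun x => score (cell j x)); first exact: bmf_score.
  by apply/funext => x; rewrite ffunE.
by rewrite big1// => j _; under eq_Ex do rewrite ffunE; exact: Ex_score.
Qed.

Let Ex_score_mul m (j j' : 'I_m) :
  Ex Q (fun x => score (cell j x) * score (cell j' x)) =
  \sum_r \sum_r' coef r * coef r' * Ex Q (fun x => exceed r j x * exceed r' j' x)
  - score_mean ^+ 2.
Proof.
pose U (i : 'I_m) x := \sum_r coef r * exceed r i x.
have bU i : bmf (U i).
  by apply: bmf_sum => r _; apply: bmfM; [exact: bmf_cst|exact: bmf_exceed].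
have EU i : Ex Q (U i) = score_mean.
  rewrite Ex_sum; last by move=> r _; apply: bmfM; [exact: bmf_cst|exact: bmf_exceed].
  by apply: eq_bigr => r _; rewrite ExZ// Ex_exceed.
have bs : bmf (fun x => U j x + U j' x) by exact: bmfD.
have bas : bmf (fun x => score_mean * (U j x + U j' x)) by apply: bmfM => //; exact: bmf_cst.
have bas2 : bmf (fun x => score_mean * (U j x + U j' x) - score_mean ^+ 2).
  by apply: bmfB => //; exact: bmf_cst.
transitivity (Ex Q (fun x => U j x * U j' x - (score_mean * (U j x + U j' x) - score_mean ^+ 2))).
  by apply: eq_Ex => x; rewrite !scoreE /U; ring.
rewrite (ExB Q (bmfM (bU j) (bU j')) bas2) (ExB Q bas (bmf_cst T _)) (ExZ Q _ bs).
rewrite (ExD Q (bU j) (bU j')) Ex_cst !EU.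
have -> : Ex Q (fun x => U j x * U j' x) =
    \sum_r \sum_r' coef r * coef r' * Ex Q (fun x => exceed r j x * exceed r' j' x).
  transitivity (Ex Q (fun x => \sum_r \sum_r' coef r * coef r' * (exceed r j x * exceed r' j' x))).
    apply: eq_Ex => x; rewrite /U mulr_suml; apply: eq_bigr => r _; rewrite mulr_sumr.
    by apply: eq_bigr => r' _; ring.
  have b r r' : bmf (fun x => coef r * coef r' * (exceed r j x * exceed r' j' x)).
    by apply: bmfM; [exact: bmf_cst|exact: bmfM].
  rewrite Ex_sum => [|r _]; last by apply: bmf_sum => r' _.
  apply: eq_bigr => r _; rewrite Ex_sum//; apply: eq_bigr => r' _.
  by rewrite ExZ//; exact: bmfM.
by ring.
Qed.

(** The bracket of [sigma2_L2] for arbitrary coefficients: the asymptotic variance per index, a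
    block of [sB] indices contributing [sB] times as much. *)
Definition block_variance : R :=
  let g r := Phibar (cut r) in
  let same r := pr r * g r - pr r ^+ 2 * g r * g r
    + pr r ^+ 2 * (sB%:R - 1) * rho_tilde (g r) (g r) rho2 in
  let cross := - (pr false * pr true * g false * g true)
    + pr false * pr true * (sB%:R - 1) * rho_tilde (g false) (g true) rho2 in
  coef false ^+ 2 * same false + coef true ^+ 2 * same true
  + 2 * coef true * coef false * cross.

Lemma block_score_variance :
  \sum_f block_law f * block_score f ^+ 2 = sB%:R * block_variance.
Proof.
pose g r := Phibar (cut r).
(* Variance of one score, and below the covariance of two distinct scores; a block has sB terms of
   the first kind and sB (sB - 1) of the second. *)
pose diag := \sum_r coef r ^+ 2 * (pr r * g r) - score_mean ^+ 2.
pose off := coef false ^+ 2 * pr false ^+ 2 * rho_tilde (g false) (g false) rho2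
  + coef true ^+ 2 * pr true ^+ 2 * rho_tilde (g true) (g true) rho2
  + 2 * coef true * coef false * pr false * pr true * rho_tilde (g false) (g true) rho2.
have diagE (j : 'I_sB) : Ex Q (fun x => score (cell j x) * score (cell j x)) = diag.
  rewrite Ex_score_mul; congr (_ - _); apply: eq_bigr => r _.
  rewrite (bigD1 r)//= big1 ?addr0 => [|r' rr'].
    rewrite -(Ex_exceed r j) expr2; congr (_ * _); apply: eq_Ex => x.
    by rewrite /exceed; case: (_ && _); rewrite ?mulr1 ?mulr0.
  rewrite (_ : Ex Q _ = 0) ?mulr0//; rewrite -[RHS](@Ex_cst _ _ _ Q); apply: eq_Ex => x.
  rewrite /exceed; case: eqP => [->|_]; last by rewrite mul0r.
  by rewrite eq_sym (negbTE rr') mulr0.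
have offE (j j' : 'I_sB) : j' != j ->
    Ex Q (fun x => score (cell j x) * score (cell j' x)) = off.
  move=> jj'; have j'j : j != j' by rewrite eq_sym.
  rewrite Ex_score_mul !big_bool/=.
  have -> : Ex Q (fun x => exceed true j x * exceed false j' x) =
      Ex Q (fun x => exceed false j' x * exceed true j x).
    by apply: eq_Ex => x; rewrite mulrC.
  rewrite (Ex_exceed_mul _ _ jj') !(Ex_exceed_mul _ _ j'j).
  rewrite /off /score_mean !big_bool/= -!/(g _).
  by ring.
transitivity (Ex Q (fun x => \sum_j \sum_j' score (@cell sB j x) * score (@cell sB j' x))).
  rewrite -(Ex_block_cells (fun f => block_score f ^+ 2)); apply: eq_Ex => x.
  rewrite /block_score expr2 mulr_suml; apply: eq_bigr => j _; rewrite mulr_sumr.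
  by apply: eq_bigr => j' _; rewrite !ffunE.
have b (j j' : 'I_sB) : bmf (fun x => score (cell j x) * score (cell j' x)).
  by apply: bmfM; exact: bmf_score.
rewrite Ex_sum => [|j _]; last by apply: bmf_sum => j' _.
transitivity (\sum_(j < sB) (diag + (sB%:R - 1) * off)).
  apply: eq_bigr => j _; rewrite Ex_sum// (bigD1 j)//= diagE; congr (_ + _).
  rewrite (eq_bigr (fun _ => off)) => [|j' /offE//].
  rewrite sumr_const -[_ *+ _]mulr_natl; congr (_ * _).
  have := cardC1 j; rewrite card_ord => ->.
  by rewrite -[in RHS](prednK hsB) mulrS addrAC subrr add0r.
rewrite sumr_const card_ord -[_ *+ _]mulr_natl; congr (_ * _).
rewrite /diag /off /score_mean /block_variance !big_bool/= -!/(g _).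
by ring.
Qed.

Definition score_sum m (x : T) : R := \sum_(i < m) score (@cell m i x).

Lemma bmf_score_sum m : bmf (score_sum m).
Proof. by apply: bmf_sum => i _; exact: bmf_score. Qed.

Let score_max : R := \sum_u `|score u|.

Let score_max_ge u : `|score u| <= score_max.
Proof. by rewrite /score_max (bigD1 u)//= lerDl sumr_ge0. Qed.

Let blocks_sum m (i0 : 'I_m) x : R :=
  \sum_(b < m %/ sB) \sum_(j < sB) score (cell (idx i0 (j + b * sB)) x).

Let bmf_blocks_sum m (i0 : 'I_m) : bmf (blocks_sum i0).
Proof. by apply: bmf_sum => b _; apply: bmf_sum => j _; exact: bmf_score. Qed.

Let leftover m (i0 : 'I_m) x : `|score_sum m x - blocks_sum i0 x| <= sB%:R * score_max.
Proof.
have km := leq_divM m sB.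
have -> : score_sum m x = \sum_(0 <= n < m) score (cell (idx i0 n) x).
  rewrite big_mkord; apply: eq_bigr => i _; congr (score (cell _ x)).
  by rewrite /idx valKd.
rewrite (big_cat_nat (n := (m %/ sB * sB)%N))//= big_nat_blocks addrAC subrr add0r.
rewrite (le_trans (ler_norm_sum _ _ _))//.
apply: (@le_trans _ _ (\sum_(m %/ sB * sB <= n < m) score_max)).
  by apply: ler_sum => n _; exact: score_max_ge.
have M0 : 0 <= score_max by apply: sumr_ge0.
rewrite sumr_const_nat -[_ *+ _]mulr_natl ler_wpM2r// ler_nat.
by rewrite {1}(divn_eq m sB) addKn ltnW// ltn_pmod.
Qed.

Lemma block_variance_ge0 : 0 <= block_variance.
Proof.
rewrite -(pmulr_rge0 _ (_ : 0 < sB%:R)) ?ltr0n// -block_score_variance.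
by apply: sumr_ge0 => f _; rewrite mulr_ge0 ?block_law_ge0 ?sqr_ge0.
Qed.

Let blocks_ratio (m : nat) : R := (m %/ sB * sB)%:R / m%:R.

Let cvg_blocks_ratio : blocks_ratio m @[m --> \oo] --> (1 : R).
Proof.
apply/cvgrPdist_le => e e0; near=> m.
have m0 : 0 < m%:R :> R by rewrite ltr0n; near: m; exact: nbhs_infty_gt.
have -> : 1 - blocks_ratio m = (m %% sB)%:R / m%:R.
  have dm : m%:R = (m %/ sB * sB)%N%:R + (m %% sB)%N%:R :> R by rewrite -natrD -divn_eq.
  apply: (mulIf (lt0r_neq0 m0)).
  by rewrite mulrBl mul1r !divfK ?gt_eqF// {1}dm addrAC subrr add0r.
rewrite ger0_norm ?divr_ge0// ler_pdivrMr// (@le_trans _ _ sB%:R)//.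
  by rewrite ler_nat ltnW// ltn_pmod.
rewrite mulrC -ler_pdivrMr//; near: m; exact: nbhs_infty_ger.
Unshelve. all: end_near. Qed.

(** Three errors vanish: the iid bound for the m / sB complete blocks, the fewer than [sB] leftover
    scores, and the ratio of indices in complete blocks to m. *)
Lemma score_sum_clt (t be : R) :
  Ex Q (fun x => cos (t * (score_sum m x / Num.sqrt m%:R) + be)) @[m --> \oo] -->
  cos be * expR (- (t ^+ 2 * block_variance / 2)).
Proof.
have [K [K0 hK]] := iid_cos_clt block_law_ge0 sum_block_law block_score_mean.
pose L m := cos be * expR (- (t ^+ 2 * (blocks_ratio m * block_variance) / 2)).
have cL : L m @[m --> \oo] --> cos be * expR (- (t ^+ 2 * (1 * block_variance) / 2)).
  apply: cvgMr; apply: (@cvg_comp _ _ _ _ expR _ (nbhs (- (t ^+ 2 * (1 * block_variance) / 2)))).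
    apply: cvgN; apply: cvgMl; apply: cvgMr; apply: cvgMl; exact: cvg_blocks_ratio.
  exact: continuous_expR.
rewrite mul1r in cL; apply/cvgrPdist_le => e e0.
have e2 : 0 < e / 2 by rewrite divr_gt0.
move/cvgrPdist_le : cL => /(_ _ e2) cL.
(* Leftover and iid errors together are at most C / sqrt m. *)
pose C := `|t| * (sB%:R * score_max) + K * `|t| ^+ 3.
near=> m.
have m0 : (0 < m)%N by near: m; exact: nbhs_infty_gt.
have sC : C / (e / 2) <= Num.sqrt m%:R by near: m; exact: near_sqrt_ge.
have st : `|t| <= Num.sqrt m%:R by near: m; exact: near_sqrt_ge.
set s := Num.sqrt m%:R.
have s0 : 0 < s by rewrite sqrtr_gt0 ltr0n.
have ss : s ^+ 2 = m%:R by rewrite sqr_sqrtr.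
have hL : `|cos be * expR (- (t ^+ 2 * block_variance / 2)) - L m| <= e / 2 by near: m.
pose i0 := Ordinal m0.
have km := leq_divM m sB.
have h1 : `|Ex Q (fun x => cos (t / s * blocks_sum i0 x + be)) - L m| <= K * `|t| ^+ 3 / s.
  rewrite (Ex_cos_blocks i0 km).
  have ts1 : `|t / s| <= 1 by rewrite normrM normfV (gtr0_norm s0) ler_pdivrMr// mul1r.
  have := hK (m %/ sB)%N (t / s) be ts1; rewrite block_score_variance.
  have -> : (m %/ sB)%N%:R * (t / s) ^+ 2 * (sB%:R * block_variance) / 2 =
      t ^+ 2 * (blocks_ratio m * block_variance) / 2.
    by rewrite exprMn exprVn ss /blocks_ratio natrM; ring.
  move=> h; apply: (le_trans h).
  rewrite normrM normfV (gtr0_norm s0) exprMn mulrA -mulrA exprVn.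
  have k1 : (m %/ sB)%N%:R <= s ^+ 2 by rewrite ss ler_nat leq_div.
  apply: (@le_trans _ _ (s ^+ 2 * K * `|t| ^+ 3 / s ^+ 3)).
    rewrite -[leLHS]mulrA -[leRHS]mulrA -[leRHS]mulrA ler_wpM2r//.
    by rewrite mulr_ge0// divr_ge0// exprn_ge0// ltW.
  rewrite le_eqVlt; apply/orP; left; apply/eqP; field.
  by rewrite gt_eqF.
have h2 : `|Ex Q (fun x => cos (t * (score_sum m x / s) + be)) -
    Ex Q (fun x => cos (t / s * blocks_sum i0 x + be))| <= `|t| * (sB%:R * score_max) / s.
  have b1 : bmf (fun x => cos (t * (score_sum m x / s) + be)).
    apply: bmf_cos; apply: measurable_funD => //; apply: measurable_funM => //.
    by apply: measurable_funM => //; exact: (bmf_score_sum m).1.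
  have b2 : bmf (fun x => cos (t / s * blocks_sum i0 x + be)).
    apply: bmf_cos; apply: measurable_funD => //; apply: measurable_funM => //.
    exact: (bmf_blocks_sum i0).1.
  rewrite -(ExB Q b1 b2); apply: norm_Ex_le; first exact: bmfB.
  move=> x; rewrite (le_trans (norm_cos_sub_le _ _))//.
  have -> : t * (score_sum m x / s) + be - (t / s * blocks_sum i0 x + be) =
      t / s * (score_sum m x - blocks_sum i0 x) by ring.
  rewrite normrM normrM normfV (gtr0_norm s0) -mulrA [leRHS]mulrAC -[leRHS]mulrA.
  rewrite ler_wpM2l//.
  by apply: ler_wpM2l; [rewrite invr_ge0 ltW|exact: leftover].
have h3 : `|t| * (sB%:R * score_max) / s + K * `|t| ^+ 3 / s <= e / 2.
  have Cs : C <= s * (e / 2) by rewrite -ler_pdivrMr.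
  by rewrite -mulrDl ler_pdivrMr// [leRHS]mulrC.
move: hL h1 h2 h3; rewrite !ler_norml => /andP[? ?] /andP[? ?] /andP[? ?] ?.
by apply/andP; split; lra.
Unshelve. all: end_near. Qed.

End block_decomposition.

(** * Asymptotics of the threshold and of the FDP *)

Section asymptotics.
Variables (q muA w : R).
Hypotheses (hq : 0 < q < 1) (hrho1 : 0 <= rho1 < 1).

Local Notation ncut := (noise_cut muA rho1 w).
Local Notation gam := (gamma muA rho1 w).
Local Notation g := (G muA pi1 rho1 w).
Local Notation tau := (tau_star q muA pi1 rho1 w).
Local Notation slack := (1 / q - g^`()%classic tau).

Hypotheses (tau_gt0 : 0 < tau) (slack_neq0 : slack != 0).

Let q_gt0 : 0 < q. Proof. by case/andP: hq. Qed.

Let tau_itv : 0 < tau < 1. Proof. exact: tau_star_itv. Qed.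

Definition exceed_count r (t : R) m (x : T) : R :=
  cell_count r (fun e : R => (ncut r t <= e)%R) m x.

Definition exceed_mean r (t : R) : R := pr r * gam r t.

Let exceed_slope r : R := pr r * (gam r)^`()%classic tau.

Lemma exceed_count_homo r s t m x : 0 < s -> s <= t -> t < 1 ->
  exceed_count r s m x <= exceed_count r t m x.
Proof.
move=> s0 st t1; apply: ler_sum => i _; rewrite ler_nat.
case: (_ == _) => //=; case h : (_ <= _) => //=.
by rewrite (le_trans (noise_cut_le muA w hrho1 r s0 st t1) h).
Qed.

(** Noise for which the p-value of an index of type [r] lies in (s, t]; cutoffs decrease in t. *)
Let band r s t (e : R) : bool := (ncut r t <= e)%R && (e < ncut r s)%R.

Let exceed_count_sub r s t m x : 0 < s -> s <= t -> t < 1 ->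
  exceed_count r t m x - exceed_count r s m x = cell_count r (band r s t) m x.
Proof.
move=> s0 st t1; rewrite /exceed_count /cell_count -sumrB; apply: eq_bigr => i _.
have h := noise_cut_le muA w hrho1 r s0 st t1.
rewrite /band; case: (_ == _) => /=; last by rewrite subrr.
rewrite [(ncut r s <= _)%R]leNgt; case h2 : (_ < ncut r s)%R => /=.
  by rewrite andbT subr0.
by rewrite (le_trans h) ?subrr// leNgt h2.
Qed.

Let stepf_band r s t : 0 < s -> s <= t -> t < 1 -> stepf (fun e : R => (band r s t e)%:R : R).
Proof.
move=> s0 st t1; have h := noise_cut_le muA w hrho1 r s0 st t1.
rewrite (_ : (fun e => _) = fun e => (e < ncut r s)%R%:R + (-1) * (e < ncut r t)%R%:R).
  by apply: stepf_add; [exact: stepf_ray|apply: stepf_scale; exact: stepf_ray].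
apply/funext => e; rewrite /band leNgt mulN1r.
case h2 : (e < ncut r t)%R => /=; last by rewrite subr0.
by rewrite (lt_le_trans h2 h) subrr.
Qed.

Let measurable_band r s t : measurable [set e | band r s t e].
Proof.
rewrite (_ : [set e | _] = (~` [set e : R | (e < ncut r t)%R]) `&` [set e | (e < ncut r s)%R]).
  by apply: measurableI; [apply: measurableC|]; exact: measurable_ray.
apply/seteqP; split => x /=; rewrite /band leNgt.
  by move=> /andP[/negP].
by move=> [/negP -> ->].
Qed.

Let mean_band r s t : 0 < s -> s <= t -> t < 1 ->
  cell_mean r (band r s t) = exceed_mean r t - exceed_mean r s.
Proof.
move=> s0 st t1; have h := noise_cut_le muA w hrho1 r s0 st t1.
rewrite /cell_mean /exceed_mean -mulrBr; congr (_ * _).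
rewrite !gammaE -!Ex_ray_normal -ExB; last 2 first.
- by apply: bmfB; [exact: bmf_cst|apply: bmf_ind; exact: measurable_ray].
- by apply: bmfB; [exact: bmf_cst|apply: bmf_ind; exact: measurable_ray].
apply: eq_Ex => e; rewrite /band leNgt.
case h2 : (e < ncut r t)%R => /=; last by rewrite subr0 opprB addrC subrK.
by rewrite (lt_le_trans h2 h) subrr.
Qed.

Lemma exceed_count_chebyshev r s t m y : 0 < s < 1 -> 0 < t < 1 -> 0 < y ->
  fine (Q [set x | y <= `|exceed_count r t m x - exceed_count r s m x
                          - m%:R * (exceed_mean r t - exceed_mean r s)|]) <=
  m%:R * sB%:R * `|exceed_mean r t - exceed_mean r s| / y ^+ 2.
Proof.
wlog st : s t / s <= t => [wlog_st s01 t01 y0|/andP[s0 s1] /andP[t0 t1] y0].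
  have [st|/ltW ts] := leP s t; first exact: wlog_st.
  rewrite [X in _ <= _ * X / _]distrC.
  rewrite (_ : [set x | _] = [set x | y <= `|exceed_count r s m x - exceed_count r t m x
      - m%:R * (exceed_mean r s - exceed_mean r t)|]); first exact: wlog_st.
  apply/seteqP; split => x /=; rewrite -normrN; congr (is_true (_ <= `|_|)); ring.
have := cell_count_chebyshev r (measurable_band r s t) (stepf_band r s0 st t1) m y0.
rewrite (mean_band r s0 st t1) => h.
rewrite [X in _ <= _ * X / _]ger0_norm; last first.
  by rewrite -(mean_band r s0 st t1); have /andP[] := cell_mean_itv r (measurable_band r s t).
rewrite (_ : [set x | _] = [set x | y <= `|cell_count r (band r s t) m x -
    m%:R * (exceed_mean r t - exceed_mean r s)|])//.
by apply/seteqP; split => x /=; rewrite exceed_count_sub.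
Qed.

Lemma measurable_exceed_count r t m : measurable_fun [set: T] (exceed_count r t m).
Proof. exact: (measurable_cell_count r (measurable_coray (ncut r t)) m). Qed.

Definition deviates r t m (y : R) x : bool :=
  y <= `|exceed_count r t m x - m%:R * exceed_mean r t|.

Lemma measurable_deviates r t m y : measurable [set x | deviates r t m y x].
Proof.
apply: measurable_norm_ge; apply: measurable_funB => //; exact: measurable_exceed_count.
Qed.

Lemma prob_deviates r t m y : 0 < y ->
  fine (Q [set x | deviates r t m y x]) <= m%:R * sB%:R / y ^+ 2.
Proof.
move=> y0.
have := cell_count_chebyshev r (measurable_coray (ncut r t)) (stepf_coray (ncut r t)) m y0.
have /andP[_ h1] := cell_mean_itv r (measurable_coray (ncut r t)).
have -> : cell_mean r (fun e => (ncut r t <= e)%R) = exceed_mean r t.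
  by rewrite /cell_mean Ex_ge_normal.
move=> h; apply: (le_trans h); rewrite ler_wpM2r ?invr_ge0 ?exprn_ge0 ?(ltW y0)//.
by rewrite ler_piMr//; move: h1; rewrite /cell_mean Ex_ge_normal.
Qed.

Lemma exceed_count_tight r e : 0 < e -> exists2 M, 0 < M &
  whp Q e (fun m x =>
    `|exceed_count r tau m x - m%:R * exceed_mean r tau| <= M * Num.sqrt m%:R).
Proof.
(* Chebyshev gives sB / M^2, at most [e] because M >= 1 and M >= sB / e. *)
move=> e0; pose M := 1 + sB%:R / e.
have M1 : 1 <= M by rewrite lerDl divr_ge0// ltW.
have M0 : 0 < M by apply: lt_le_trans M1.
exists M => //; near=> m.
have m0 : 0 < m%:R :> R by rewrite ltr0n; near: m; exact: nbhs_infty_gt.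
have s0 : 0 < Num.sqrt m%:R :> R by rewrite sqrtr_gt0.
exists (deviates r tau m (M * Num.sqrt m%:R)); split.
- exact: measurable_deviates.
- rewrite (le_trans (prob_deviates _ _ _ _)) ?mulr_gt0//.
  have -> : (M * Num.sqrt m%:R) ^+ 2 = M ^+ 2 * m%:R by rewrite exprMn sqr_sqrtr ?ltW.
  rewrite ler_pdivrMr ?mulr_gt0 ?exprn_gt0//.
  have -> : e * (M ^+ 2 * m%:R) = m%:R * (e * M ^+ 2) by ring.
  rewrite ler_pM2l// mulrC -ler_pdivrMr//.
  apply: (@le_trans _ _ M); first by rewrite lerDr.
  by rewrite expr2 ler_peMr// ltW.
- by move=> x; rewrite /deviates -ltNge => /ltW.
Unshelve. all: end_near. Qed.

(** The quantifier over c is inside, so one rank m serves the whole window, random points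
    included. *)
Let tau_near (C : R) : \forall m \near \oo, forall c : R, `|c| <= C ->
  0 < tau + c / Num.sqrt m%:R < 1.
Proof.
have /andP[t0 t1] := tau_itv.
have d0 : 0 < Num.min tau (1 - tau) by rewrite lt_min t0 subr_gt0.
near=> m => c cC.
have s0 : 0 < Num.sqrt m%:R :> R.
  by rewrite (@lt_le_trans _ _ 1)//; near: m; exact: near_sqrt_ge.
have sC : (C + 1) / Num.min tau (1 - tau) <= Num.sqrt m%:R by near: m; exact: near_sqrt_ge.
have h : `|c / Num.sqrt m%:R| < Num.min tau (1 - tau).
  rewrite normrM normfV (gtr0_norm s0) ltr_pdivrMr// mulrC -ltr_pdivrMr//.
  apply: lt_le_trans sC; rewrite ltr_pM2r ?invr_gt0//; lra.
by move: h; rewrite lt_min !ltr_norml => /andP[/andP[? ?] /andP[? ?]]; apply/andP; split; lra.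
Unshelve. all: end_near. Qed.

(** At distance |c| / sqrt m the increment has variance O(sqrt m), so Chebyshev at level of order
    sqrt m leaves probability O(1 / sqrt m); its mean is linear up to o(sqrt m) by
    differentiability. *)
Let exceed_increment_pt r (c e e' : R) : 0 < e -> 0 < e' ->
  whp Q e' (fun m x =>
    `|exceed_count r (tau + c / Num.sqrt m%:R) m x - exceed_count r tau m x
      - Num.sqrt m%:R * exceed_slope r * c| <= e * Num.sqrt m%:R).
Proof.
move=> e0 e'0.
pose f t := exceed_mean r t.
have df : derivable f tau 1.
  by apply: derivableM => //; exact: derivable_gamma.
have f' : f^`()%classic tau = exceed_slope r.
  have dg : derivable (gam r) tau 1 by exact: derivable_gamma.
  by rewrite /exceed_slope !derive1E; exact: (@deriveZ _ _ _ (gam r) (pr r) tau 1 dg).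
pose eta := e / (4 * (`|c| + 1)).
have c1 : 0 < `|c| + 1 by rewrite ltr_wpDl.
have eta0 : 0 < eta by rewrite divr_gt0// mulr_gt0.
have etac : eta * `|c| <= e / 4.
  rewrite /eta invfM mulrA -mulrA ler_piMr ?divr_ge0 ?ltW//.
  by rewrite mulrC ltr_pdivrMr// mul1r ltrDl.
have [dl dl0 hd] := derivable_expansion df eta0.
pose K := (`|exceed_slope r| + eta) * `|c|.
have K0 : 0 <= K by rewrite mulr_ge0// addr_ge0// ltW.
near=> m.
have m0 : 0 < m%:R :> R by rewrite ltr0n; near: m; exact: nbhs_infty_gt.
have sge1 : 1 <= Num.sqrt m%:R :> R by near: m; exact: near_sqrt_ge.
have sdl : `|c| / dl <= Num.sqrt m%:R by near: m; exact: near_sqrt_ge.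
have sK : sB%:R * K * 4 / (e ^+ 2 * e') <= Num.sqrt m%:R by near: m; exact: near_sqrt_ge.
have u01 : 0 < tau + c / Num.sqrt m%:R < 1.
  have h : forall c' : R, `|c'| <= `|c| -> 0 < tau + c' / Num.sqrt m%:R < 1.
    by near: m; exact: tau_near.
  exact: h.
set s := Num.sqrt m%:R in sge1 sdl sK u01 *.
have s0 : 0 < s by apply: lt_le_trans sge1.
have ss : s ^+ 2 = m%:R by rewrite sqr_sqrtr// ltW.
set u := tau + c / s in u01 *.
have utau : u - tau = c / s by rewrite /u addrC addKr.
have nu : `|u - tau| = `|c| / s by rewrite utau normrM normfV (gtr0_norm s0).
have hu : `|f u - f tau - exceed_slope r * (u - tau)| <= eta * `|u - tau|.
  by rewrite -f'; apply: hd; rewrite nu ler_pdivrMr// mulrC -ler_pdivrMr.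
have hfu : `|f u - f tau| <= K / s.
  have -> : f u - f tau = (f u - f tau - exceed_slope r * (u - tau)) + exceed_slope r * (u - tau).
    by rewrite subrK.
  rewrite (le_trans (ler_normD _ _))// normrM.
  apply: (@le_trans _ _ (eta * `|u - tau| + `|exceed_slope r| * `|u - tau|)); first by rewrite lerD2r.
  by rewrite -mulrDl nu /K mulrA [eta + _]addrC.
pose y := e / 2 * s.
have y0 : 0 < y by rewrite mulr_gt0// divr_gt0.
pose b x := y <= `|exceed_count r u m x - exceed_count r tau m x - m%:R * (f u - f tau)|.
exists b; split.
- apply: measurable_norm_ge; apply: measurable_funB => //.
  by apply: measurable_funB; exact: measurable_exceed_count.
- apply: (le_trans (exceed_count_chebyshev r m tau_itv u01 y0)).
  rewrite ler_pdivrMr ?exprn_gt0//.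
  apply: (@le_trans _ _ (m%:R * sB%:R * (K / s))); first by rewrite ler_wpM2l// mulr_ge0// ltW.
  have -> : e' * y ^+ 2 = m%:R * (e ^+ 2 * e' / 4) by rewrite /y -ss; field.
  rewrite -mulrA ler_pM2l// mulrA ler_pdivrMr// mulrAC [leRHS]mulrC.
  have h4 : 0 < e ^+ 2 * e' by rewrite mulr_gt0// exprn_gt0.
  move: sK; rewrite ler_pdivrMr// => sK'.
  by move: sK'; lra.
- move=> x; rewrite /b -ltNge => h.
  have e1 : s * exceed_slope r * c = m%:R * (exceed_slope r * (u - tau)).
    by rewrite utau -ss; field; rewrite gt_eqF.
  have -> : exceed_count r u m x - exceed_count r tau m x - s * exceed_slope r * c =
      (exceed_count r u m x - exceed_count r tau m x - m%:R * (f u - f tau)) +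
      m%:R * (f u - f tau - exceed_slope r * (u - tau)).
    by rewrite e1; ring.
  rewrite (le_trans (ler_normD _ _))// normrM (gtr0_norm m0).
  have h2 : m%:R * `|f u - f tau - exceed_slope r * (u - tau)| <= s * (e / 4).
    apply: (@le_trans _ _ (m%:R * (eta * (`|c| / s)))); first by rewrite -nu ler_pM2l.
    have -> : m%:R * (eta * (`|c| / s)) = s * (eta * `|c|).
      by rewrite -ss; field; rewrite gt_eqF.
    by rewrite ler_pM2l.
  have es : 0 < e * s by rewrite mulr_gt0.
  by move: h h2; rewrite /y; lra.
Unshelve. all: end_near. Qed.

Let foldr_and (I : eqType) (F : I -> Prop) (s : seq I) :
  foldr (fun i => and (F i)) True s -> forall i, i \in s -> F i.
Proof.
elim: s => [_ i|j s IH [Fj Fs] i]; first by rewrite in_nil.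
by rewrite inE => /orP[/eqP ->//|]; exact: IH.
Qed.

(* Counts are monotone in t, so a grid of fixed size on the scale 1 / sqrt m suffices. *)
Lemma exceed_increment r (L e e' : R) : 0 <= L -> 0 < e -> 0 < e' ->
  whp Q e' (fun m x => forall t, `|t - tau| <= L / Num.sqrt m%:R ->
    `|exceed_count r t m x - exceed_count r tau m x
      - m%:R * exceed_slope r * (t - tau)| <= e * Num.sqrt m%:R).
Proof.
move=> L0 e0 e'0; set sl := exceed_slope r.
(* Mesh of the grid: over one cell the linear term moves by at most e / 2 on the scale sqrt m. *)
pose dl := e / (2 * (`|sl| + 1)).
have sl1 : 0 < `|sl| + 1 by rewrite ltr_wpDl.
have dl0 : 0 < dl by rewrite divr_gt0// mulr_gt0.
have sldl : `|sl| * dl <= e / 2.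
  have -> : `|sl| * dl = e / 2 * (`|sl| / (`|sl| + 1)).
    by rewrite /dl; field; rewrite gt_eqF.
  by rewrite ler_piMr ?divr_ge0 ?ltW// ltr_pdivrMr// mul1r ltrDl.
pose K := Num.truncn (2 * L / dl).
pose grid l : R := l%:R * dl - L.
have e20 : 0 < e / 2 by rewrite divr_gt0.
apply: whpS (whp_all (iota 0 K.+2) (fun l e'' => exceed_increment_pt r (grid l) e20) e'0).
near=> m => x hx t tL.
have m0 : 0 < m%:R :> R by rewrite ltr0n; near: m; exact: nbhs_infty_gt.
have near01 (c : R) : `|c| <= L + dl -> 0 < tau + c / Num.sqrt m%:R < 1.
  by move: c; near: m; exact: tau_near.
set s := Num.sqrt m%:R in tL near01 *.
have s0 : 0 < s by rewrite sqrtr_gt0.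
have ss : s ^+ 2 = m%:R by rewrite sqr_sqrtr// ltW.
pose c := (t - tau) * s.
have tE : t = tau + c / s by rewrite /c mulfK ?gt_eqF// addrC subrK.
have cL : `|c| <= L by rewrite normrM (gtr0_norm s0) -ler_pdivlMr.
have /andP[cL1 cL2] : - L <= c <= L by rewrite -ler_norml.
have z0 : 0 <= (c + L) / dl by rewrite divr_ge0 ?(ltW dl0)//; lra.
pose l := Num.truncn ((c + L) / dl).
have /andP[l1 l2] := truncn_itv z0; rewrite -/l in l1 l2.
have g1 : grid l <= c by move: l1; rewrite ler_pdivlMr// /grid; lra.
have g2 : c <= grid l.+1 by move: l2; rewrite ltr_pdivrMr// /grid => /ltW; lra.
have g3 : grid l.+1 = grid l + dl by rewrite /grid mulrS; ring.
have lK : (l <= K)%N.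
  by apply: le_truncn; rewrite ler_pM2r ?invr_gt0//; lra.
have gL l' : l' \in [:: l; l.+1] -> `|grid l'| <= L + dl.
  rewrite !inE ler_norml => /orP[] /eqP ->; apply/andP; split; lra.
have Hl l' : l' \in [:: l; l.+1] ->
    `|exceed_count r (tau + grid l' / s) m x - exceed_count r tau m x - s * sl * grid l'|
    <= e / 2 * s.
  move=> hl'; apply: (foldr_and hx); rewrite mem_iota add0n/= ltnS.
  by move: hl'; rewrite !inE => /orP[] /eqP ->; rewrite ?ltnS// (leq_trans lK).
have in1 : l \in [:: l; l.+1] by rewrite inE eqxx.
have in2 : l.+1 \in [:: l; l.+1] by rewrite !inE eqxx orbT.
have Hl1 := Hl l in1; have Hl2 := Hl l.+1 in2.
have /andP[a1 _] : 0 < tau + grid l / s < 1 by apply/near01/gL; rewrite inE eqxx.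
have /andP[_ a2] : 0 < tau + grid l.+1 / s < 1 by apply/near01/gL; rewrite !inE eqxx orbT.
have /andP[a3 a4] : 0 < t < 1 by rewrite tE near01// (le_trans cL)// lerDl ltW.
have N1 : exceed_count r (tau + grid l / s) m x <= exceed_count r t m x.
  by apply: exceed_count_homo => //; rewrite tE lerD2l ler_pM2r ?invr_gt0.
have N2 : exceed_count r t m x <= exceed_count r (tau + grid l.+1 / s) m x.
  by apply: exceed_count_homo => //; rewrite tE lerD2l ler_pM2r ?invr_gt0.
have -> : m%:R * sl * (t - tau) = s * (sl * c) by rewrite /c -ss; ring.
have b1 : `|sl * (c - grid l)| <= e / 2.
  apply: le_trans sldl; rewrite normrM ler_wpM2l// ger0_norm ?subr_ge0//; lra.
have b2 : `|sl * (grid l.+1 - c)| <= e / 2.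
  apply: le_trans sldl; rewrite normrM ler_wpM2l// ger0_norm ?subr_ge0//; lra.
have b1s : `|s * (sl * (c - grid l))| <= s * (e / 2) by rewrite normrM (gtr0_norm s0) ler_pM2l.
have b2s : `|s * (sl * (grid l.+1 - c))| <= s * (e / 2) by rewrite normrM (gtr0_norm s0) ler_pM2l.
move: b1s b2s Hl1 Hl2; rewrite !ler_norml.
move=> /andP[? ?] /andP[? ?] /andP[? ?] /andP[? ?]; apply/andP; split; lra.
Unshelve. all: end_near. Qed.

(** The p-value with the constant [w] in place of [W]: it depends only on [H] and [eps], whose law
    under [Q] is known. *)
Definition noise_pvalue m (x : T) (i : 'I_m) : R :=
  Phibar (muA * (H i x)%:R + Num.sqrt rho1 * w + Num.sqrt (1 - rho1) * eps i x).

(** The critical value rather than the largest rejected p-value: it solves the counting equation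
    exactly. *)
Definition threshold m x : R := (BH_R q (@noise_pvalue m x))%:R * q / m%:R.

Lemma count_le_exceed m x t : 0 < t < 1 ->
  (count_le (@noise_pvalue m x) t)%:R = exceed_count false t m x + exceed_count true t m x.
Proof.
move=> t01; rewrite /count_le -sum1_card natr_sum big_mkcond/= /exceed_count /cell_count.
rewrite -big_split/=; apply: eq_bigr => i _.
rewrite inE /noise_pvalue (pvalue_le_noise_cut muA w hrho1)//.
by case: (H i x) => /=; case: (_ <= _); rewrite ?addr0 ?add0r.
Qed.

Lemma card_null_exceed m x t : 0 < t < 1 ->
  #|[pred i | (@noise_pvalue m x i <= t) && ~~ H i x]|%:R = exceed_count false t m x.
Proof.
move=> t01; rewrite -sum1_card natr_sum big_mkcond/= /exceed_count /cell_count.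
apply: eq_bigr => i _; rewrite inE /noise_pvalue (pvalue_le_noise_cut muA w hrho1)//.
by case: (H i x) => /=; case: (_ <= _).
Qed.

Lemma threshold_le m x : (0 < m)%N -> threshold m x <= q.
Proof.
move=> m0; rewrite /threshold ler_pdivrMr ?ltr0n// mulrC ler_pM2l// ler_nat.
exact: BH_R_max.
Qed.

Let exceed_total t m (y : R) x : ~~ deviates false t m y x -> ~~ deviates true t m y x ->
  `|exceed_count false t m x + exceed_count true t m x - m%:R * g t| < 2 * y.
Proof.
rewrite /deviates -!ltNge => h0 h1.
have -> : exceed_count false t m x + exceed_count true t m x - m%:R * g t =
    (exceed_count false t m x - m%:R * exceed_mean false t) +
    (exceed_count true t m x - m%:R * exceed_mean true t).
  by rewrite /G /exceed_mean /pi_; ring.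
by rewrite (le_lt_trans (ler_normD _ _))// mulr2n mulrDl mul1r ltrD.
Qed.

Let prob_deviates_any t m (y : R) : 0 < y ->
  measurable [set x | deviates false t m y x || deviates true t m y x] /\
  fine (Q [set x | deviates false t m y x || deviates true t m y x]) <=
  2 * (m%:R * sB%:R / y ^+ 2).
Proof.
move=> y0.
have -> : [set x | deviates false t m y x || deviates true t m y x] =
    [set x | deviates false t m y x] `|` [set x | deviates true t m y x].
  by apply/seteqP; split => x /=; [move=> /orP[]; [left|right]|move=> [->//|->]; rewrite orbT].
have mf := measurable_deviates false t m y; have mt := measurable_deviates true t m y.
split; first exact: measurableU.
rewrite (le_trans (fine_measureU _ mf mt))// mulr2n mulrDl mul1r lerD//; exact: prob_deviates.
Qed.

(** One point suffices: at tau - L / sqrt m the expected count exceeds m t / q by c L sqrt m, so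
    without a large deviation [le_crit_BH_R] puts the threshold above it. All large L are allowed
    because the upper bound will impose its own. *)
Let threshold_lower c dl : 0 < c -> 0 < dl ->
  (forall t, tau - dl <= t <= tau -> t / q - g t <= - (c * (tau - t))) ->
  forall e, 0 < e -> exists2 L0, 0 < L0 & forall L, L0 <= L ->
  whp Q e (fun m x => tau - L / Num.sqrt m%:R <= threshold m x).
Proof.
move=> c0 dl0 margin e e0.
pose L0 := 1 + 8 * sB%:R / (c ^+ 2 * e).
have ce0 : 0 < c ^+ 2 * e by rewrite mulr_gt0// exprn_gt0.
have L01 : 1 <= L0 by rewrite lerDl divr_ge0// ltW.
exists L0; first exact: lt_le_trans L01.
move=> L LL; have L1 : 1 <= L := le_trans L01 LL.
have Lpos : 0 < L by apply: lt_le_trans L1.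
near=> m.
have m0 : 0 < m%:R :> R by rewrite ltr0n; near: m; exact: nbhs_infty_gt.
have sdl : L / Num.min dl (tau / 2) <= Num.sqrt m%:R by near: m; exact: near_sqrt_ge.
set s := Num.sqrt m%:R in sdl *.
have s0 : 0 < s by rewrite sqrtr_gt0.
have ss : s ^+ 2 = m%:R by rewrite sqr_sqrtr// ltW.
have /andP[t0 t1] := tau_itv.
have d0 : 0 < Num.min dl (tau / 2) by rewrite lt_min dl0 divr_gt0.
have hL : L / s <= Num.min dl (tau / 2).
  by rewrite ler_pdivrMr// mulrC -ler_pdivrMr.
have Ls0 : 0 < L / s by rewrite divr_gt0.
move: hL; rewrite le_min => /andP[hL1 hL2].
pose t := tau - L / s.
have t01 : 0 < t < 1 by apply/andP; split; rewrite /t; lra.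
(* Half of the margin for each of the two types. *)
pose y := c / 2 * L * s.
have y0 : 0 < y by rewrite /y !mulr_gt0// divr_gt0.
have [mb Qb] := prob_deviates_any t m y0.
exists (fun x => deviates false t m y x || deviates true t m y x); split => //.
  apply: (le_trans Qb).
  have -> : 2 * (m%:R * sB%:R / y ^+ 2) = 8 * sB%:R / (c ^+ 2 * L ^+ 2).
    by rewrite /y -ss; field; rewrite !gt_eqF.
  rewrite ler_pdivrMr ?mulr_gt0 ?exprn_gt0//.
  have h : 8 * sB%:R <= L * (c ^+ 2 * e).
    by rewrite -ler_pdivrMr// (le_trans _ LL)// lerDr.
  have h2 : L * (c ^+ 2 * e) <= L ^+ 2 * (c ^+ 2 * e).
    by rewrite ler_pM2r// expr2 ler_peMr// ltW.
  by apply: (le_trans h); apply: (le_trans h2); rewrite le_eqVlt; apply/orP; left; apply/eqP; ring.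
move=> x; rewrite negb_or => /andP[h0 h1].
apply: le_crit_BH_R => //; first by rewrite -(ltr0n R).
rewrite (@count_le_exceed m x _ t01).
have := exceed_total h0 h1; rewrite ltr_norml => /andP[h _].
have hm : tau - dl <= t <= tau by apply/andP; split; rewrite /t; lra.
have := margin t hm; rewrite (_ : tau - t = L / s); last by rewrite /t; ring.
rewrite -(ler_pM2l m0) => h2.
have h3 : m%:R * - (c * (L / s)) = - (2 * y).
  by rewrite /y -ss; field; rewrite gt_eqF.
rewrite -/t; move: h h2; rewrite h3 mulrBr.
by move: (2 * y) (m%:R * (t / q)) (m%:R * g t) => y2 a1 a2; lra.
Unshelve. all: end_near. Qed.

(* By Chebyshev at tau + l / sqrt m, exceeding distance l has probability
   O(1 / l^2), which is summable over l >= L. *)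
Let threshold_upper c : 0 < c ->
  (forall t, tau <= t <= (1 + q) / 2 -> c * (t - tau) <= t / q - g t) ->
  forall e, 0 < e -> exists2 L, 0 < L &
  whp Q e (fun m x => threshold m x <= tau + L / Num.sqrt m%:R).
Proof.
move=> c0 margin e e0.
(* The second term makes the rounding error s / q smaller than half the margin; the third brings the
   summed Chebyshev bounds below [e]. *)
pose Lr := 1 + 2 / (c * q) + 32 * sB%:R / (c ^+ 2 * e).
have cq0 : 0 < c * q by rewrite mulr_gt0.
have ce0 : 0 < c ^+ 2 * e by rewrite mulr_gt0// exprn_gt0.
have Lr1 : 0 <= 2 / (c * q) by rewrite divr_ge0// ltW.
have Lr2 : 0 <= 32 * sB%:R / (c ^+ 2 * e) by rewrite divr_ge0// ltW.
pose L := (Num.truncn Lr).+1.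
have LL : Lr <= L%:R.
  have Lr0 : 0 <= Lr by rewrite /Lr; lra.
  by have /andP[_ /ltW] := truncn_itv Lr0.
have Lpos : 0 < L%:R :> R by rewrite ltr0n.
exists L%:R => //; near=> m.
have m0 : (0 < m)%N by near: m; exact: nbhs_infty_gt.
have Lm : (L <= m)%N by near: m; exact: nbhs_infty_ge.
have sge1 : 1 <= Num.sqrt m%:R :> R by near: m; exact: near_sqrt_ge.
have sq : 2 / (1 - q) <= Num.sqrt m%:R by near: m; exact: near_sqrt_ge.
set s := Num.sqrt m%:R in sge1 sq *.
have mr0 : 0 < m%:R :> R by rewrite ltr0n.
have s0 : 0 < s by rewrite sqrtr_gt0.
have ss : s ^+ 2 = m%:R by rewrite sqr_sqrtr// ltW.
have /andP[t0 t1] := tau_itv; have /andP[q0 q1] := hq.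
pose t l : R := tau + l%:R / s.
(* A quarter of the margin for each type, the remaining half for rounding the threshold to the
   grid. *)
pose y l : R := c / 4 * l%:R * s.
pose b l x := deviates false (t l.+1) m (y l.+1) x || deviates true (t l.+1) m (y l.+1) x.
have y0 l : 0 < y l.+1 by rewrite /y !mulr_gt0// ?divr_gt0// ltr0n.
have mb l : measurable [set x | b l x] := (prob_deviates_any (t l.+1) m (y0 l)).1.
have [mh Qh] := prob_has_le Q (index_iota L m) mb.
exists (fun x => has (b^~ x) (index_iota L m)); split => //.
  apply: (le_trans Qh).
  apply: (@le_trans _ _ (\sum_(L <= l < m) 32 * sB%:R / c ^+ 2 * (l.+1%:R ^+ 2)^-1)).
    apply: ler_sum => l _; apply: (le_trans (prob_deviates_any (t l.+1) m (y0 l)).2).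
    rewrite le_eqVlt; apply/orP; left; apply/eqP.
    have l0 : l.+1%:R != 0 :> R by rewrite pnatr_eq0.
    rewrite /y -ss; move: (l.+1%:R : R) l0 => z z0; field.
    by rewrite z0 !gt_eqF.
  rewrite -mulr_sumr.
  apply: (@le_trans _ _ (32 * sB%:R / c ^+ 2 * L%:R^-1)).
    apply: ler_wpM2l; last exact: sum_inv_sqr_le.
    by rewrite divr_ge0// exprn_ge0// ltW.
  rewrite ler_pdivrMr// -ler_pdivrMl// -[leLHS](_ : 32 * sB%:R / (c ^+ 2 * e) = _).
    by apply: le_trans LL; rewrite /Lr; lra.
  by field; rewrite !gt_eqF.
move=> x hb; rewrite leNgt; apply/negP => ht.
set T0 := threshold m x in ht.
have Tq : T0 <= q by exact: threshold_le.
have z0 : 0 <= (T0 - tau) * s.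
  by rewrite mulr_ge0 ?(ltW s0)// subr_ge0 (le_trans _ (ltW ht))// lerDl divr_ge0 ?ltW.
(* The threshold lies between the grid points l and l + 1; by monotonicity the count at l + 1 is
   still at least m T0 / q, short of the diagonal there by at most s / q. *)
pose l := Num.truncn ((T0 - tau) * s).
have /andP[l1 l2] := truncn_itv z0; rewrite -/l in l1 l2.
have Ll : (L <= l)%N.
  by rewrite truncn_ge_nat// -ler_pdivrMr// lerBrDl ltW.
have lm : (l < m)%N.
  rewrite -(ltr_nat R) (le_lt_trans l1)// -ss expr2 ltr_pM2r//; lra.
have nb : ~~ b l x.
  by apply: contra hb => bl; apply/hasP; exists l => //; rewrite mem_index_iota Ll lm.
have T01 : 0 < T0 < 1 by apply/andP; split; [rewrite (lt_trans _ ht)// ltr_wpDr ?divr_ge0 ?ltW|lra].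
have Ttl : T0 <= t l.+1.
  by rewrite /t -lerBlDl ler_pdivlMr// ltW.
have tT : t l.+1 <= T0 + 1 / s.
  rewrite /t -natr1 mulrDl addrA lerD2r -lerBrDl ler_pdivrMr//.
have sinv : 1 / s <= (1 - q) / 2.
  rewrite ler_pdivrMr//; move: sq; rewrite ler_pdivrMr ?subr_gt0//; lra.
have tl1 : t l.+1 < 1 by lra.
have tl0 : 0 < t l.+1 by case/andP: T01 => h _; apply: lt_le_trans Ttl.
have tl01 : 0 < t l.+1 < 1 by rewrite tl0.
have cnt : (count_le (@noise_pvalue m x) T0)%:R <= (count_le (@noise_pvalue m x) (t l.+1))%:R :> R.
  by rewrite ler_nat; exact: count_le_homo.
have cntT : (count_le (@noise_pvalue m x) T0)%:R = m%:R * (T0 / q).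
  rewrite /T0 /threshold count_le_BH_R//; field.
  by rewrite !gt_eqF.
move: nb; rewrite /b negb_or => /andP[h0 h1].
have := exceed_total h0 h1; rewrite -(@count_le_exceed m x _ tl01) ltr_norml => /andP[_ h].
have hm : tau <= t l.+1 <= (1 + q) / 2.
  apply/andP; split; last lra.
  by rewrite /t lerDl divr_ge0 ?ltW.
have := margin _ hm; rewrite (_ : t l.+1 - tau = l.+1%:R / s); last by rewrite /t; ring.
rewrite -(ler_pM2l mr0) => h2.
have h3 : m%:R * (c * (l.+1%:R / s)) = c * l.+1%:R * s.
  by rewrite -ss; field; rewrite gt_eqF.
have h4 : m%:R * (t l.+1 / q) <= m%:R * (T0 / q) + s / q.
  have -> : m%:R * (T0 / q) + s / q = m%:R * ((T0 + 1 / s) / q).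
    by rewrite -ss; field; rewrite !gt_eqF.
  by rewrite ler_pM2l// ler_pM2r ?invr_gt0.
have h5 : s / q < c / 2 * l.+1%:R * s.
  have : 2 / (c * q) < l.+1%:R.
    apply: (@lt_le_trans _ _ L%:R); last by rewrite ler_nat (leq_trans Ll).
    by apply: lt_le_trans LL; rewrite /Lr; lra.
  rewrite ltr_pdivrMr// => hl.
  rewrite ltr_pdivrMr// (_ : c / 2 * l.+1%:R * s * q = s * (l.+1%:R * (c * q) / 2)); last by ring.
  by rewrite -{1}[s]mulr1 ltr_pM2l//; lra.
move: h h2; rewrite h3 mulrBr /y.
by move: (m%:R * (t l.+1 / q)) (m%:R * g (t l.+1)) h4 => a1 a2 h4; lra.
Unshelve. all: end_near. Qed.

Lemma threshold_rate e : 0 < e -> exists2 L, 0 < L &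
  whp Q e (fun m x => `|threshold m x - tau| <= L / Num.sqrt m%:R).
Proof.
move=> e0; have e2 : 0 < e / 2 by rewrite divr_gt0.
have [c [c0 hr [dl dl0 hl]]] := crossing_margin hq hpi1 tau_gt0 slack_neq0.
have [L0 L00 hL0] := threshold_lower c0 dl0 hl e2.
have [L1 L10 hL1] := threshold_upper c0 hr e2.
exists (Num.max L0 L1); first by rewrite lt_max L00.
have hL0' : L0 <= Num.max L0 L1 by rewrite le_max lexx.
rewrite [e]splitr; apply: whpS (whpI (hL0 _ hL0') hL1).
near=> m => x [h1 h2].
have s0 : 0 <= (Num.sqrt m%:R)^-1 :> R by rewrite invr_ge0.
have h3 : L1 / Num.sqrt m%:R <= Num.max L0 L1 / Num.sqrt m%:R.
  by rewrite ler_wpM2r// le_max lexx orbT.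
by rewrite ler_norml; apply/andP; split; lra.
Unshelve. all: end_near. Qed.

Local Notation a := (alpha q muA pi1 rho1 w).

Let tau_cut r : R := ncut r tau.

Let coef (r : bool) : R := q / tau * (if r then a else 1 + a).

Let score_sumE m x : score_sum tau_cut coef m x =
  q / tau * ((1 + a) * (exceed_count false tau m x - m%:R * exceed_mean false tau)
             + a * (exceed_count true tau m x - m%:R * exceed_mean true tau)).
Proof.
have mE : score_mean tau_cut coef = coef false * exceed_mean false tau + coef true * exceed_mean true tau.
  by rewrite /score_mean big_bool/= addrC.
transitivity (\sum_(i < m) (coef false * ((H i x == false) && (ncut false tau <= eps i x))%:R
    + coef true * ((H i x == true) && (ncut true tau <= eps i x))%:R
    - (coef false * exceed_mean false tau + coef true * exceed_mean true tau))).
  apply: eq_bigr => i _; rewrite /score mE; congr (_ - _).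
  by rewrite /cell /tau_cut; case: (H i x) => /=; rewrite ?mulr0 ?addr0 ?add0r.
rewrite sumrB big_split/= -!mulr_sumr sumr_const card_ord -[_ *+ m]mulr_natl.
by rewrite -!/(cell_count _ _ _ _) -!/(exceed_count _ _ _ _) /coef; ring.
Qed.

Let fdp_fluctuation m x : R := Num.sqrt m%:R *
  (FDP q (@noise_pvalue m x) (fun i : 'I_m => H i x) - q * (1 - pi1) * gam false tau / tau).

Let scaled_score m x : R := score_sum tau_cut coef m x / Num.sqrt m%:R.

(** [fdp_linearization] leaves two errors: the increment errors, which are o(sqrt m), and (t - tau)
    times the score, which is O(1 / sqrt m) times O(sqrt m). Both are then divided by sqrt m. *)
Let fdp_fluctuation_approx e : 0 < e ->
  whp Q e (fun m x => `|fdp_fluctuation m x - scaled_score m x| <= e).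
Proof.
move=> e0.
have halve (q' L' B' M' s' u : R) : 4 * q' * L' * B' * M' <= s' * (u ^+ 2 * e) ->
    2 * q' * L' * B' * M' <= e / 2 * s' * u ^+ 2 by lra.
have e5 : 0 < e / 5 by rewrite divr_gt0.
(* Bound for |1 + a| + |a|. *)
pose B := 1 + 2 * `|a|.
have B1 : 1 <= B by rewrite lerDl mulr_ge0.
have B0 : 0 < B by apply: lt_le_trans B1.
have [L L0 hL] := threshold_rate e5.
have [Mf Mf0 hMf] := exceed_count_tight false e5.
have [Mt Mt0 hMt] := exceed_count_tight true e5.
pose M := Mf + Mt.
have M0 : 0 < M by rewrite addr_gt0.
(* With 1 / t <= 2 / tau, the increment errors contribute exactly e / 2. *)
pose e1 := e * tau / (4 * q * B).
have e10 : 0 < e1 by rewrite divr_gt0 ?mulr_gt0.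
have hf := exceed_increment false (ltW L0) e10 e5.
have ht := exceed_increment true (ltW L0) e10 e5.
have e5s : e / 5 + e / 5 + e / 5 + e / 5 + e / 5 <= e by lra.
apply: whp_le e5s _.
apply: whpS (whpI (whpI (whpI (whpI hL hf) ht) hMf) hMt).
near=> m => x [[[[rate incf] inct] tf] tt].
have m0 : (0 < m)%N by near: m; exact: nbhs_infty_gt.
have sL : 2 * L / tau <= Num.sqrt m%:R by near: m; exact: near_sqrt_ge.
have sM : 4 * q * L * B * M / (tau ^+ 2 * e) <= Num.sqrt m%:R by near: m; exact: near_sqrt_ge.
have mr0 : 0 < m%:R :> R by rewrite ltr0n.
rewrite /fdp_fluctuation /scaled_score.
set s := Num.sqrt m%:R in rate incf inct tf tt sL sM *.
have s0 : 0 < s by rewrite sqrtr_gt0.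
have ss : m%:R = s ^+ 2 by rewrite sqr_sqrtr// ltW.
set t := threshold m x in rate.
have /andP[t0 t1] := tau_itv.
(* This keeps the threshold above tau / 2, so there is at least one rejection and the [maxn] in
   [FDP] is harmless. *)
have Ls : L / s <= tau / 2.
  by rewrite ler_pdivrMr//; move: sL; rewrite ler_pdivrMr//; lra.
have := rate; rewrite ler_norml => /andP[rate1 rate2].
have tge : tau / 2 <= t by lra.
have tpos : 0 < t by lra.
have tlt : t < 1 by rewrite (le_lt_trans (threshold_le x m0))//; case/andP: hq.
have t01 : 0 < t < 1 by rewrite tpos.
have RE : (BH_R q (@noise_pvalue m x))%:R = m%:R * (t / q) :> R.
  by rewrite /t /threshold; field; rewrite !gt_eqF.
have R1 : (0 < BH_R q (@noise_pvalue m x))%N.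
  by rewrite -(ltr0n R) RE mulr_gt0// divr_gt0.
have VE : (BH_V q (@noise_pvalue m x) (fun i : 'I_m => H i x))%:R = exceed_count false t m x.
  by rewrite BH_V_crit// -card_null_exceed.
have sumE : exceed_count false t m x + exceed_count true t m x = m%:R * (t / q).
  by rewrite -(@count_le_exceed m x _ t01) -RE /t /threshold count_le_BH_R.
have FE : FDP q (@noise_pvalue m x) (fun i : 'I_m => H i x) =
    exceed_count false t m x / (m%:R * (t / q)).
  by rewrite /FDP VE -RE (maxn_idPl R1).
pose A r := exceed_count r tau m x - m%:R * exceed_mean r tau.
pose E r := exceed_count r t m x - exceed_count r tau m x - m%:R * exceed_slope r * (t - tau).
have VrE r : exceed_count r t m x =
    s ^+ 2 * exceed_mean r tau + A r + E r + s ^+ 2 * exceed_slope r * (t - tau).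
  by rewrite /A /E ss; ring.
have kE : slack = 1 / q - (exceed_slope false + exceed_slope true).
  by rewrite derive_G.
have vv : exceed_mean false tau + exceed_mean true tau = tau / q.
  by rewrite -(G_tau_star hq hpi1 tau_gt0).
have sumE' := sumE; rewrite ss in sumE'.
have := fdp_linearization q_gt0 t0 tpos s0 kE slack_neq0 vv (VrE false) (VrE true) sumE'.
have aE : (exceed_slope false - exceed_mean false tau / tau) / slack = a by [].
rewrite aE /= => lin.
rewrite score_sumE FE -!/(A _) ss.
have -> : q * (1 - pi1) * gam false tau / tau = q * exceed_mean false tau / tau.
  by rewrite /exceed_mean mulrA.
rewrite lin.
have comb (al u v c : R) : 0 <= c -> `|u| <= c -> `|v| <= c ->
    `|(1 + al) * u + al * v| <= (1 + 2 * `|al|) * c.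
  move=> c0 uc vc; have na : `|1 + al| <= 1 + `|al|.
    by rewrite (le_trans (ler_normD _ _))// normr1.
  rewrite (le_trans (ler_normD _ _))// !normrM.
  have h1 : `|1 + al| * `|u| <= (1 + `|al|) * c by rewrite ler_pM.
  have h2 : `|al| * `|v| <= `|al| * c by rewrite ler_wpM2l.
  by apply: (le_trans (lerD h1 h2)); rewrite le_eqVlt; apply/orP; left; apply/eqP; ring.
have Yb : `|(1 + a) * A false + a * A true| <= B * (M * s).
  apply: comb; first by rewrite mulr_ge0 ?ltW.
    by apply: (le_trans tf); rewrite ler_pM2r// lerDl ltW.
  by apply: (le_trans tt); rewrite ler_pM2r// lerDr ltW.
have Eb : `|(1 + a) * E false + a * E true| <= B * (e1 * s).
  apply: comb; first by rewrite mulr_ge0 ?ltW.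
    exact: incf.
  exact: inct.
have ti : t^-1 <= 2 / tau by rewrite -[leRHS]invf_div lef_pV2 ?posrE// divr_gt0.
have b1 : `|((1 + a) * E false + a * E true) / t| <= B * (e1 * s) * (2 / tau).
  by rewrite normrM normfV (gtr0_norm tpos) ler_pM// invr_ge0 ltW.
have b2 : `|(t - tau) / (t * tau) * ((1 + a) * A false + a * A true)| <=
    L / s * (2 / tau / tau) * (B * (M * s)).
  rewrite normrM ler_pM// normrM normfV (gtr0_norm (mulr_gt0 tpos t0)) invfM ler_pM//.
    by rewrite mulr_ge0// invr_ge0 ltW.
  by rewrite ler_pM2r ?invr_gt0.
rewrite normrM (ger0_norm (divr_ge0 (ltW q_gt0) (ltW s0))).
apply: (@le_trans _ _ (q / s * (B * (e1 * s) * (2 / tau) + L / s * (2 / tau / tau) * (B * (M * s))))).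
  apply: ler_wpM2l; first exact: divr_ge0 (ltW q_gt0) (ltW s0).
  by rewrite (le_trans (ler_normB _ _))// lerD.
have -> : q / s * (B * (e1 * s) * (2 / tau) + L / s * (2 / tau / tau) * (B * (M * s))) =
    e / 2 + 2 * q * L * B * M / tau ^+ 2 / s.
  by rewrite /e1; field; rewrite !gt_eqF.
have h : 2 * q * L * B * M / tau ^+ 2 / s <= e / 2.
  rewrite ler_pdivrMr// ler_pdivrMr ?exprn_gt0//.
  by move: sM; rewrite ler_pdivrMr ?mulr_gt0 ?exprn_gt0//; exact: halve.
by rewrite [leRHS](splitr e) lerD2l.
Unshelve. all: end_near. Qed.

Let scaled_score_tight e : 0 < e -> exists L : R, \forall m \near \oo,
  fine (Q [set x | L < `|scaled_score m x|]) <= e.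
Proof.
move=> e0; have e2 : 0 < e / 2 by rewrite divr_gt0.
have [Mf Mf0 hMf] := exceed_count_tight false e2.
have [Mt Mt0 hMt] := exceed_count_tight true e2.
exists (`|q / tau| * (`|1 + a| * Mf + `|a| * Mt)).
have := whpI hMf hMt; rewrite -splitr => h; near=> m.
have m0 : 0 < m%:R :> R by rewrite ltr0n; near: m; exact: nbhs_infty_gt.
have [b [mb Qb hb]] : holds_outside Q e (fun x =>
    `|exceed_count false tau m x - m%:R * exceed_mean false tau| <= Mf * Num.sqrt m%:R /\
    `|exceed_count true tau m x - m%:R * exceed_mean true tau| <= Mt * Num.sqrt m%:R).
  by near: m; exact: h.
have s0 : 0 < Num.sqrt m%:R :> R by rewrite sqrtr_gt0.
apply: le_trans Qb; apply: fine_le; rewrite ?fin_num_measure//.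
  apply: (measurable_gtr_preimage _ (X := fun x => `|scaled_score m x|)).
  apply: measurableT_comp => //; apply: measurable_funM => //.
  exact: (bmf_score_sum _ _ _).1.
apply: le_measure; rewrite ?inE//.
  apply: (measurable_gtr_preimage _ (X := fun x => `|scaled_score m x|)).
  apply: measurableT_comp => //; apply: measurable_funM => //.
  exact: (bmf_score_sum _ _ _).1.
move=> x /=; apply: contraTT => /hb[h1 h2]; rewrite -leNgt /scaled_score score_sumE.
move: h1 h2; move: (alpha q muA pi1 rho1 w) => al.
set s := Num.sqrt m%:R in s0 *; set u := _ - _; set v := _ - _ => h1 h2.
rewrite normrM normfV (gtr0_norm s0) ler_pdivrMr// [`|q / tau * _|]normrM -[leRHS]mulrA.
rewrite ler_wpM2l// (le_trans (ler_normD _ _))// !normrM mulrDl -!mulrA.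
by rewrite lerD// ler_wpM2l.
Unshelve. all: end_near. Qed.

Let block_variance_sigma : block_variance tau_cut coef = sigma2_L2 q muA pi1 rho1 sB rho2 w.
Proof.
rewrite /block_variance /sigma2_L2 /c_same /c_cross /coef /= -!gammaE.
move: (alpha q muA pi1 rho1 w) => al; field.
by rewrite gt_eqF.
Qed.

Lemma measurable_noise_FDP m :
  measurable_fun [set: T] (fun x => FDP q (@noise_pvalue m x) (fun i : 'I_m => H i x)).
Proof.
apply: measurable_FDP => // [i|i].
  apply: measurableT_comp; first exact: continuous_measurable_fun continuous_Phibar.
  apply: measurable_funD; last by apply: measurable_funM => //; exact: measurable_eps_fun.
  apply: measurable_funD => //; apply: measurable_funM => //.
  exact: (@bmf_ind _ _ _ (fun x => H i x) (measurable_H i [set true])).1.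
by exact: (measurable_H i [set true]).
Qed.

(** The limit law with [W] frozen at [w], under any [Q] giving the noise its original law. *)
Theorem noise_FDP_clt x0 : normal_law (sigma2_L2 q muA pi1 rho1 sB rho2 w) [set x0] = 0%E ->
  fine (Q [set x | Num.sqrt m%:R *
    (FDP q (@noise_pvalue m x) (fun i : 'I_m => H i x) - q * (1 - pi1) * gam false tau / tau)
    <= x0]) @[m --> \oo] -->
  fine (normal_law (sigma2_L2 q muA pi1 rho1 sB rho2 w) [set` `]-oo, x0]]).
Proof.
move=> hx0; apply: (@slutsky_cvg_normal _ _ _ _ fdp_fluctuation scaled_score) => //.
- move=> m; apply: measurable_funM => //; apply: measurable_funB => //.
  exact: measurable_noise_FDP.
- by move=> m; apply: measurable_funM => //; exact: (bmf_score_sum _ _ _).1.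
- by rewrite -block_variance_sigma block_variance_ge0.
- by move=> t be; rewrite -block_variance_sigma; exact: score_sum_clt.
Qed.

End asymptotics.

End conditional_model.

(** * Passage to the conditional law given W = w *)

Section kernel_probability.
Context d d' (X : measurableType d) (Y : measurableType d') (R : realType)
  (k : R.-pker X ~> Y) (x : X).

(* As a value of the kernel, [k x] is only typed as a measure. *)
Definition kernel_prob (A : set Y) : \bar R := k x A.

HB.instance Definition _ := Measure.on kernel_prob.

Let kernel_prob_setT : kernel_prob setT = 1%E.
Proof. exact: prob_kernel. Qed.

HB.instance Definition _ := Measure_isProbability.Build _ _ _ kernel_prob kernel_prob_setT.

End kernel_probability.

Lemma probability_congr d (T : measurableType d) (R : realType) (Q : probability T R)
    (A B E : set T) : measurable A -> measurable B -> measurable E -> Q E = 1%E ->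
  (forall x, E x -> A x <-> B x) -> Q A = Q B.
Proof.
move=> mA mB mE QE AB.
have QEC : Q (~` E) = 0%E by rewrite probability_setC// QE subee.
have part C : measurable C -> Q C = Q (C `&` E).
  move=> mC; rewrite -{1}(setIT C) -(setvU E) setIUr measureU.
  - rewrite [X in (X + _)%E](_ : _ = 0%E) ?add0e//.
    apply: (@subset_measure0 _ _ _ Q _ (~` E)) => //.
    + by apply: measurableI => //; exact: measurableC.
    + exact: measurableC.
  - by apply: measurableI => //; exact: measurableC.
  - exact: measurableI.
  - by rewrite setIACA setIid setICl setI0.
rewrite part// [RHS]part//; congr (Q _).
by apply/seteqP; split => x [Cx Ex]; split => //; apply/AB.
Qed.

Theorem corollary5p1 (d : measure_display) (T : measurableType d)
  (R : realType) (P : probability T R)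
  (q muA pi1 rho1 : R) (sB : nat) (rho2 : R)
  (hq : 0 < q < 1) (hmuA : 0 < muA) (hpi1 : 0 < pi1 < 1)
  (hrho1 : 0 <= rho1 < 1) (hsB : (0 < sB)%N) (hrho2 : -1 <= rho2 <= 1)
  (H : forall m, 'I_m -> {RV P >-> bool}) (W : {RV P >-> R})
  (eps : forall m, 'I_m -> {RV P >-> R})
  (hmodel : one_factor_model H W eps pi1 sB rho2)
  (kappa : R.-pker (measurableTypeR R) ~> T)
  (hkappa : conditional_given_W H W eps kappa)
  (w : R)
  (htau_pos : 0 < tau_star q muA pi1 rho1 w)
  (htau_strict : tau_star q muA pi1 rho1 w =
     sup [set t | 0 < t < 1 /\ t / q < G muA pi1 rho1 w t])
  (htau_isolated :
     ~ limit_point [set t : R | 0 < t < 1 /\ G muA pi1 rho1 w t = t / q]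
         (tau_star q muA pi1 rho1 w))
  (halpha_defined :
     1 / q - (G muA pi1 rho1 w)^`()%classic (tau_star q muA pi1 rho1 w) != 0) :
  let tau := tau_star q muA pi1 rho1 w in
  let FDP_lim := q * (1 - pi1) * gamma muA rho1 w false tau / tau in
  cvg_in_law
    (fun m A => kappa w
       [set x | A (Num.sqrt m%:R * (FDP_BH H W eps q muA rho1 m x - FDP_lim))])
    (normal_law (sigma2_L2 q muA pi1 rho1 sB rho2 w)).
Proof.
move=> tau FDP_lim x0 hx0.
pose Q : probability T R := kernel_prob kappa w.
have hQ m (A : 'I_m -> set bool) (B : 'I_m -> set R) : (forall i, measurable (A i)) ->
    (forall i, measurable (B i)) -> Q (noise_event H eps A B) = P (noise_event H eps A B).
  exact: (cond_noise hkappa).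
have /andP[q0 _] := hq.
have QW : Q (W @^-1` [set w]) = 1%E := cond_W hkappa w.
have clt := noise_FDP_clt hpi1 hsB hrho2 hmodel hQ hq hrho1 htau_pos halpha_defined hx0.
pose FW m x := Num.sqrt m%:R * (FDP_BH H W eps q muA rho1 m x - FDP_lim).
pose Fw m x := Num.sqrt m%:R *
  (FDP q (noise_pvalue rho1 H eps muA w (m := m) x) (fun i : 'I_m => H m i x) - FDP_lim).
have mH m i : measurable [set x | H m i x] by exact: (@measurable_H _ _ _ P H m i [set true]).
have mFW m : measurable [set x | FW m x <= x0].
  apply: measurable_ler_preimage; apply: measurable_funM => //; apply: measurable_funB => //.
  apply: (@measurable_FDP _ _ _ q m (fun x i => pvalue H W eps muA rho1 x i)
    (fun x i => H m i x)) => // i.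
  apply: measurableT_comp; first exact: continuous_measurable_fun continuous_Phibar.
  apply: measurable_funD; last by apply: measurable_funM => //; exact: measurable_eps_fun.
  apply: measurable_funD; last by apply: measurable_funM.
  by apply: measurable_funM => //; exact: (@bmf_ind _ _ _ (fun x => H m i x) (mH m i)).1.
have mFw m : measurable [set x | Fw m x <= x0].
  apply: measurable_ler_preimage; apply: measurable_funM => //; apply: measurable_funB => //.
  exact: measurable_noise_FDP.
have mW : measurable (W @^-1` [set w]).
  by rewrite -[_ @^-1` _]setTI; apply: (measurable_funPT W).
have same m : Q [set x | FW m x <= x0] = Q [set x | Fw m x <= x0].
  apply: (probability_congr (mFW m) (mFw m) mW QW) => x Wx.
  have pw : pvalue H W eps muA rho1 x = noise_pvalue rho1 H eps muA w (m := m) x.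
    by apply/funext => i; rewrite /pvalue /Xstat Wx.
  by rewrite /= /FW /FDP_BH pw.
have -> : (fun m => kappa w [set x | [set` `]-oo, x0]] (FW m x)]) =
    fun m => (fine (Q [set x | Fw m x <= x0]))%:E.
  apply/funext => m; transitivity (Q [set x | FW m x <= x0]).
    transitivity (kappa w [set x | FW m x <= x0]); last by [].
    by congr (kappa w _); apply/seteqP; split => x; rewrite /= in_itv.
  exact: (etrans (same m) (probability_EFin Q (mFw m))).
(* [normal_law] is a bare set function, so finiteness is checked in its Dirac and normal cases. *)
have -> : normal_law (sigma2_L2 q muA pi1 rho1 sB rho2 w) [set` `]-oo, x0]] =
    (fine (normal_law (sigma2_L2 q muA pi1 rho1 sB rho2 w) [set` `]-oo, x0]]))%:E.
  rewrite fineK// /normal_law; case: ifP => _; last exact: fin_num_measure.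
  by rewrite diracE.
by apply: cvg_EFin; [exact: nearW|exact: clt].
Qed.
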